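(* Let $T>0$, let $\mathcal L$ be an unbounded closed operator on $L^2(\mathbb R^d)$ with dense domain $D\subseteq L^2(\mathbb R^d)$ which generates a $C_0$-semigroup on $L^2(\mathbb R^d)$. Let $F\in C([0,T];L^2(\mathbb R^d))\otimes (S)_{-1}$ be a generalized stochastic process with chaos expansion $F=\sum_{\gamma\in\mathcal I}f_\gamma H_\gamma$ whose coefficients $f_\gamma\in C([0,T];L^2(\mathbb R^d))$ are Lipschitz continuous with respect to $t$ for every $\gamma\in\mathcal I$, and let $G\in D\otimes (S)_{-1}$. Let $q\in\mathcal D'(\mathbb R^d)$. Then the stochastic parabolic problem $$\Big(\frac{\partial}{\partial t}-\mathcal L\Big)U(t,x,\omega)+q(x)\cdot U(t,x,\omega)=F(t,x,\omega),\qquad U(0,x,\omega)=G(x,\omega),$$ $t\in(0,T]$, $x\in\mathbb R^d$, $\omega\in\Omega$, has a (stochastic) very weak solution $(U_\varepsilon)_{\varepsilon\in(0,1]}$ in $C([0,T];L^2(\mathbb R^d))\otimes (S)_{-1}$.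
   Context: Chaos expansions. $(\Omega,\mathcal F,\mathbb P)$ is the Gaussian white noise space. $\mathcal I$ is the set of sequences $\gamma=(\gamma_1,\gamma_2,\dots)$ of non-negative integers with only finitely many nonzero entries. For $\gamma\in\mathcal I$, $H_\gamma(\omega)=\prod_{k\ge1}h_{\gamma_k}(\langle\omega,\xi_k\rangle)$ is the Fourier–Hermite polynomial ($h_k$ Hermite polynomials, $\xi_k$ Hermite functions), and $(2\mathbb N)^{\gamma}=\prod_{i\ge1}(2i)^{\gamma_i}$. For a normed space $Y$ and $p\ge0$, $Y\otimes (S)_{-p}$ is the space of formal expansions $F=\sum_{\gamma\in\mathcal I}f_\gamma H_\gamma$ with $f_\gamma\in Y$ and $\|F\|^2_{Y\otimes (S)_{-p}}=\sum_{\gamma\in\mathcal I}\|f_\gamma\|_Y^2(2\mathbb N)^{-p\gamma}<\infty$; $Y\otimes (S)_{-1}$ denotes the union (inductive limit) of the spaces $Y\otimes (S)_{-p}$ over $p\ge0$. Write $X=C([0,T];L^2(\mathbb R^d))$ with norm $\sup_{t\in[0,T]}\|f(t,\cdot)\|_{L^2(\mathbb R^d)}$; $D$ and $C([0,T];D)$ are taken with the norms of $L^2(\mathbb R^d)$ and $X$. Solutions. $\mathcal L$ acts coefficientwise in the space variable, $\mathcal LU=\sum_\gamma(\mathcal Lu_\gamma)H_\gamma$, and so does multiplication by a bounded potential. For a bounded potential $r$, $U=\sum_\gamma u_\gamma H_\gamma\in C([0,T];D)\otimes(S)_{-1}$ is a solution of $(\partial_t-\mathcal L)U+rU=F$, $U(0)=G$,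 if for each $\gamma\in\mathcal I$, $u_\gamma$ solves $(\partial_t-\mathcal L)u_\gamma+ru_\gamma=f_\gamma$, $u_\gamma(0,\cdot)=g_\gamma$ in the semigroup (strong) sense: $u_\gamma\in C([0,T];D)$ is absolutely continuous and differentiable a.e. as an $L^2(\mathbb R^d)$-valued function with $u_\gamma'\in L^1(0,T;L^2(\mathbb R^d))$, and satisfies the equation for a.e. $t$ and the initial condition. Regularization. A mollifier is $\varphi\in C_0^\infty(\mathbb R^d)$ with $\varphi\ge0$, $\int\varphi=1$; a mollifying net is $\varphi_\varepsilon(x)=l(\varepsilon)^{-d}\varphi(x/l(\varepsilon))$, $\varepsilon\in(0,1]$, with $l>0$ and $l(\varepsilon)\to0$ as $\varepsilon\to0$. A regularizing net of a distribution $q$ is a net of smooth functions $(q_\varepsilon)_{\varepsilon\in(0,1]}$ converging to $q$ in $\mathcal D'(\mathbb R^d)$, of the form $q_\varepsilon=q*\varphi_\varepsilon$; for a general $q\in\mathcal D'(\mathbb R^d)$, not compactly supported or bounded, the convolution may be combined with cut-off functions, i.e. $q_\varepsilon=(\chi_\varepsilon q)*\varphi_\varepsilon$ with $\chi_\varepsilon\in C_0^\infty(\mathbb R^d)$, $0\le\chi_\varepsilon\le1$, such that for each compact set $K$ one has $\chi_\varepsilon=1$ on $K$ for all sufficiently small $\varepsilon$. Moderateness. A net $(b_\varepsilon)_{\varepsilon\in(0,1]}$ in a Banach space $\mathcal B$ is $\mathcal B$-moderate if there exist $N\in\mathbb N_0$, $C>0$ with $\|b_\varepsilon\|_{\mathcal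 B}\le C\varepsilon^{-N}$ for each $\varepsilon\in(0,1]$. A net $U_\varepsilon\in X\otimes(S)_{-p_\varepsilon}$, $p_\varepsilon\ge0$, for which $p=\sup_\varepsilon p_\varepsilon$ exists, is $X\otimes(S)_{-p}$-moderate if there exist $N\in\mathbb N_0$ and $C>0$ such that $\|U_\varepsilon\|_{X\otimes(S)_{-p}}\le C\varepsilon^{-N}$ for each $\varepsilon\in(0,1]$; it is assumed that $p>1$. Stochastic very weak solution. A net $(U_\varepsilon)_{\varepsilon\in(0,1]}$ of stochastic processes in $X\otimes(S)_{-1}$ is a very weak solution to the stochastic problem if there exists an $L^\infty(\mathbb R^d)$-moderate regularizing net $(q_\varepsilon)_{\varepsilon\in(0,1]}$ of $q$ such that for every $\varepsilon\in(0,1]$ the process $U_\varepsilon$ is a solution to the regularized equation $(\partial_t-\mathcal L)U+q_\varepsilon U=F$, $U(0)=G$, and $(U_\varepsilon)_{\varepsilon\in(0,1]}$ is a moderate net of stochastic processes. *)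

(* Defs.v *)
From HB Require Import structures.
From mathcomp Require Import all_boot all_order all_algebra finmap.
From mathcomp Require Import all_classical all_reals all_analysis.
From mathcomp Require Import measurable_realfun ess_sup_inf.

Set Implicit Arguments.
Unset Strict Implicit.
Unset Printing Implicit Defensive.

Import Order.TTheory GRing.Theory Num.Theory.
Import numFieldNormedType.Exports.

Local Open Scope classical_set_scope.
Local Open Scope ring_scope.

Definition measure_rV_display : measure_display -> measure_display.
Proof. exact. Qed.

Section measurable_rV.
Context (R : realType) (n : nat).
Let coors : 'I_n -> 'rV[R]_n -> measurableTypeR R := fun i x => x ord0 i.

Let rV_set0 : g_sigma_preimage coors set0.
Proof. exact: sigma_algebra0. Qed.

Let rV_setC A : g_sigma_preimage coors A -> g_sigma_preimage coors (~` A).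
Proof. exact: sigma_algebraC. Qed.

Let rV_bigcup (F : _^nat) : (forall i, g_sigma_preimage coors (F i)) ->
  g_sigma_preimage coors (\bigcup_i (F i)).
Proof. exact: sigma_algebra_bigcup. Qed.

(* The product Borel sigma-algebra, as done for n.-tuple in the library. *)
HB.instance Definition _ :=
  @isMeasurable.Build (measure_rV_display default_measure_display)
    'rV[R]_n (g_sigma_preimage coors) rV_set0 rV_setC rV_bigcup.
End measurable_rV.

Section lebesgue_rV.
Context (R : realType).

Lemma measurable_coord_rV n (i : 'I_n) :
  measurable_fun [set: 'rV[R]_n] (fun x : 'rV[R]_n => x ord0 i).
Proof.
move=> _ Y mY; rewrite setTI; apply: sub_sigma_algebra => /=.
rewrite -bigcup_seq/=; exists i => /=; first by rewrite mem_index_enum.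
by exists Y => //; rewrite setTI.
Qed.

Lemma measurable_fun_rV d (T : measurableType d) n (f : T -> 'rV[R]_n) :
  (forall i, measurable_fun [set: T] (fun t => f t ord0 i)) ->
  measurable_fun [set: T] f.
Proof.
move=> mf _ A; rewrite setTI.
pose G : set_system 'rV[R]_n := [set B | measurable (f @^-1` B)].
suff : measurable `<=` G by move=> /[apply].
apply: smallest_sub.
- split; first by rewrite /G/= preimage_set0.
  + by move=> B; rewrite /G/= setTD preimage_setC => mB; exact: measurableC.
  + by move=> F mF; rewrite /G/= preimage_bigcup; apply: bigcup_measurable => k _; exact: mF.
- rewrite -bigcup_seq => B [i _ [C mC <-]]; rewrite /G/= setTI.
  by rewrite -comp_preimage -[X in measurable X]setTI; exact: (mf i).
Qed.

Definition cons_rV n (p : measurableTypeR R * 'rV[R]_n) : 'rV[R]_n.+1 :=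
  \row_(i < n.+1) if unlift ord0 i is Some j then p.2 ord0 j else p.1.

Definition uncons_rV n (x : 'rV[R]_n.+1) : measurableTypeR R * 'rV[R]_n :=
  (x ord0 ord0, \row_(j < n) x ord0 (lift ord0 j)).

Lemma cons_rVK n : cancel (@cons_rV n) (@uncons_rV n).
Proof.
case=> a v; rewrite /uncons_rV !mxE unlift_none; congr pair.
by apply/rowP => j; rewrite !mxE liftK.
Qed.

Lemma measurable_cons_rV n : measurable_fun [set: _] (@cons_rV n).
Proof.
apply: measurable_fun_rV => i.
case: (unliftP ord0 i) => [j ->|->].
  rewrite (_ : (fun _ => _) = (fun v : 'rV[R]_n => v ord0 j) \o snd).
    by apply: measurableT_comp => //; exact: measurable_coord_rV.
  by apply/funext => p /=; rewrite mxE liftK.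
rewrite (_ : (fun _ => _) = fst) //.
by apply/funext => p /=; rewrite mxE unlift_none.
Qed.

Lemma measurable_uncons_rV n : measurable_fun [set: _] (@uncons_rV n).
Proof.
apply: measurable_fun_pair; first exact: measurable_coord_rV.
apply: measurable_fun_rV => i.
under eq_fun do rewrite mxE; exact: measurable_coord_rV.
Qed.


Section step.
Context (n : nat) (lambda : {sigma_finite_measure set (measurableTypeR R) -> \bar R}).
Variable mu : {sigma_finite_measure set 'rV[R]_n -> \bar R}.

Definition product_cons : set 'rV[R]_n.+1 -> \bar R :=
  pushforward (lambda \x mu)%E (@cons_rV n).

Let product_cons0 : product_cons set0 = 0%E.
Proof. by rewrite /product_cons /pushforward preimage_set0 measure0. Qed.

Let product_cons_ge0 A : (0 <= product_cons A)%E.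
Proof. by rewrite /product_cons /pushforward measure_ge0. Qed.

Let product_cons_sigma_additive : semi_sigma_additive product_cons.
Proof.
have preim_measurable B : measurable B -> measurable (@cons_rV n @^-1` B).
  by move=> mB; rewrite -[X in measurable X]setTI; exact: measurable_cons_rV.
move=> F mF tF mUF; rewrite /product_cons /pushforward preimage_bigcup.
apply: measure_semi_sigma_additive.
- by move=> k; exact: preim_measurable.
- apply/trivIsetP => /= i j _ _ ij; rewrite -preimage_setI.
  by move/trivIsetP : tF => /(_ _ _ _ _ ij) ->//; rewrite preimage_set0.
- by rewrite -preimage_bigcup; exact: preim_measurable.
Qed.

HB.instance Definition _ := isMeasure.Build _ _ _ product_cons
  product_cons0 product_cons_ge0 product_cons_sigma_additive.

Let product_cons_sigma_finite : sigma_finite setT product_cons.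
Proof.
have /sigma_finiteP[F [TF ndF Foo]] := sigma_finiteT lambda.
have /sigma_finiteP[G [TG ndG Goo]] := sigma_finiteT mu.
exists (fun k => @uncons_rV n @^-1` (F k `*` G k)).
  rewrite -preimage_bigcup (_ : \bigcup_k _ = setT) ?preimage_setT//.
  apply/seteqP; split=> // -[x y] _.
  have [i _ Fix] : (\bigcup_k F k) x by rewrite -TF.
  have [j _ Gjy] : (\bigcup_k G k) y by rewrite -TG.
  exists (maxn i j) => //; split => /=.
    by move: x Fix; apply/subsetPset/ndF/leq_maxl.
  by move: y Gjy; apply/subsetPset/ndG/leq_maxr.
move=> k; have [mF Fk] := Foo k; have [mG Gk] := Goo k; split.
  rewrite -[X in measurable X]setTI; apply: measurable_uncons_rV => //.
  exact: measurableX.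
rewrite /product_cons /pushforward -comp_preimage.
rewrite (_ : _ \o _ = id) ?preimage_id; last first.
  by apply/funext; exact: cons_rVK.
by rewrite product_measure1E// lte_mul_pinfty// ge0_fin_numE.
Qed.

HB.instance Definition _ := Measure_isSigmaFinite.Build _ _ _ product_cons
  product_cons_sigma_finite.

End step.

Fixpoint lebesgue_rV n : {sigma_finite_measure set 'rV[R]_n -> \bar R} :=
  match n with
  | 0 => [the {sigma_finite_measure set 'rV[R]_0 -> \bar R} of \d_(0 : 'rV[R]_0)]
  | m.+1 => [the {sigma_finite_measure set 'rV[R]_m.+1 -> \bar R} of
              product_cons lebesgue_measure (lebesgue_rV m)]
  end.
End lebesgue_rV.
Arguments lebesgue_rV : clear implicits.

Section Lspace_normed.
Local Open Scope quotient_scope.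
Context d (T : measurableType d) (R : realType).
Variables (mu : {measure set T -> \bar R}) (p : \bar R) (p1 : (1 <= p)%E).
Local Notation Lp := (LspaceType mu p1).
Local Notation M := {mfun_ mu, T >-> measurableTypeR R}.

Lemma measurable_Lspace (u : Lp) : measurable_fun [set: T] (u : T -> R).
Proof. exact: (@measurable_funPT _ _ _ (measurableTypeR R) (repr (u : M))). Qed.

Lemma Lspace_Lfun (u : Lp) : (u : T -> R) \in Lfun mu p.
Proof.
rewrite inE; apply/andP; split; rewrite inE; first exact: measurable_Lspace.
exact: Lebesgue_finite.
Qed.

(* LspaceType is equipped with its structure of normed module, which the
   library does not provide. *)
Lemma eq_Lspace (u v : Lp) : (u : T -> R) = v %[ae mu] -> u = v.
Proof.
move=> uv; have /eqP : (u : M) == (v : M).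
  by rewrite -(reprK (u : M)) -(reprK (v : M)) eqmodE; apply/asboolP.
case: u v {uv} => [u [[uP]]] [v [[vP]]] /= uv.
by move: uv uP vP => -> uP vP; rewrite (Prop_irrelevance uP vP).
Qed.

Lemma eq_ae_Lnorm (f g : T -> R) :
  measurable_fun [set: T] f -> measurable_fun [set: T] g ->
  f = g %[ae mu] -> ('N[mu]_p[EFin \o f] = 'N[mu]_p[EFin \o g])%E.
Proof.
move=> mf mg fg; rewrite unlock; case: p p1 => [r r1|_|//].
- have mr (h : T -> R) : measurable_fun [set: T] h ->
      measurable_fun [set: T] (fun x => `|(EFin \o h) x| `^ r)%E.
    move=> mh; apply: (measurableT_comp (measurable_poweR r)).
    by apply: measurableT_comp => //; exact/measurable_EFinP.
  congr (_ `^ _)%E; apply: ge0_ae_eq_integral => //; [exact: mr|exact: mr|by move=> *; exact: poweR_ge0|by move=> *; exact: poweR_ge0|].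
  by apply: filterS fg => x /= fg xT; rewrite fg.
- case: ifPn => // _; apply: eq_ess_sup.
  by apply: filterS fg => x /= ->.
Qed.

Section class.
Variables (f : T -> R) (fL : f \in Lfun mu p).

Let mf : measurable_fun [set: T] f.
Proof. by move: fL; rewrite inE => /andP[]; rewrite inE. Qed.

Let fm : {mfun T >-> measurableTypeR R} :=
  HB.pack f (isMeasurableFun.Build _ _ _ (measurableTypeR R) f mf).

Let cls : M := \pi_M fm.

Lemma cls_ae : (cls : T -> R) = f %[ae mu].
Proof.
have : repr cls = fm %[mod M] by rewrite reprK.
by move=> /eqP; rewrite eqmodE => /asboolP.
Qed.

Let cls_fin : finite_norm mu p cls.
Proof.
have mcls : measurable_fun [set: T] (cls : T -> R).
  exact: (@measurable_funPT _ _ _ (measurableTypeR R) (repr cls)).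
rewrite /finite_norm (eq_ae_Lnorm mcls mf cls_ae).
by move: fL; rewrite inE => /andP[_]; rewrite inE.
Qed.

Definition Lclass_of : LspaceType mu p1 := HB.pack cls (isFinLebesgue.Build _ T R mu p p1 cls cls_fin).

Lemma Lclass_ofE : (Lclass_of : T -> R) = f %[ae mu].
Proof. exact: cls_ae. Qed.
End class.

Local Notation nm f := (fine 'N[mu]_p[EFin \o f]%E).
Implicit Types u v w : Lp.

Lemma measurable_Lfun (f : T -> R) : f \in Lfun mu p -> measurable_fun setT f.
Proof. by rewrite inE => /andP[]; rewrite inE. Qed.


Lemma Lfun_comb (a : R) (f g : T -> R) : f \in Lfun mu p -> g \in Lfun mu p ->
  (fun x => a * f x + g x) \in Lfun mu p.
Proof. by move=> fL gL; have [_ /(_ a _ _ fL gL)] := Lfun_submod_closed mu p1. Qed.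

Definition Lcomb a u v : Lp := Lclass_of (Lfun_comb a (Lspace_Lfun u) (Lspace_Lfun v)).

Lemma LcombE a u v : (Lcomb a u v : T -> R) = (fun x => a * u x + v x) %[ae mu].
Proof. exact: Lclass_ofE. Qed.

Lemma Lfun0 : (cst 0 : T -> R) \in Lfun mu p.
Proof. by have [] := Lfun_submod_closed mu p1. Qed.

Definition L0 : Lp := Lclass_of Lfun0.

Lemma L0E : (L0 : T -> R) = cst 0 %[ae mu].
Proof. exact: Lclass_ofE. Qed.

Definition Ladd u v := Lcomb 1 u v.
Definition Lscale a u := Lcomb a u L0.
Definition Lopp u := Lscale (-1) u.

Lemma LaddE u v : (Ladd u v : T -> R) = (fun x => u x + v x) %[ae mu].
Proof. by apply: filterS (LcombE 1 u v) => x h xT; rewrite h// mul1r. Qed.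

Lemma LscaleE a u : (Lscale a u : T -> R) = (fun x => a * u x) %[ae mu].
Proof. by apply: filterS2 (LcombE a u L0) L0E => x h h0 xT; rewrite h// h0// addr0. Qed.

Lemma LaddA : associative Ladd.
Proof.
move=> u v w; apply: eq_Lspace.
apply: filterS3 (LaddE u (Ladd v w)) (LaddE v w)
  (filterI (LaddE (Ladd u v) w) (LaddE u v)) => x h1 h2 [h3 h4] xT.
by rewrite h1// h2// h3// h4// addrA.
Qed.

Lemma LaddC : commutative Ladd.
Proof.
move=> u v; apply: eq_Lspace.
by apply: filterS2 (LaddE u v) (LaddE v u) => x h1 h2 xT; rewrite h1// h2// addrC.
Qed.

Lemma Ladd0 : left_id L0 Ladd.
Proof.
move=> u; apply: eq_Lspace.
by apply: filterS2 (LaddE L0 u) L0E => x h1 h2 xT; rewrite h1// h2// add0r.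
Qed.

Lemma LaddN : left_inverse L0 Lopp Ladd.
Proof.
move=> u; apply: eq_Lspace.
apply: filterS3 (LaddE (Lopp u) u) L0E (LscaleE (-1) u) => x h1 h2 h3 xT.
by rewrite h1// h2// h3// mulN1r addNr.
Qed.

HB.instance Definition _ := gen_eqMixin Lp.
HB.instance Definition _ := gen_choiceMixin Lp.
HB.instance Definition _ := GRing.isZmodule.Build Lp LaddA LaddC Ladd0 LaddN.

Lemma LscaleA a b u : Lscale a (Lscale b u) = Lscale (a * b) u.
Proof.
apply: eq_Lspace.
apply: filterS3 (LscaleE a (Lscale b u)) (LscaleE b u) (LscaleE (a * b) u)
  => x h1 h2 h3 xT.
by rewrite h1// h2// h3// mulrA.
Qed.

Lemma Lscale1 : left_id 1 Lscale.
Proof.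
move=> u; apply: eq_Lspace.
by apply: filterS (LscaleE 1 u) => x h xT; rewrite h// mul1r.
Qed.

Lemma LscaleDr : right_distributive Lscale +%R.
Proof.
move=> a u v; apply: eq_Lspace.
apply: filterS3 (filterI (LscaleE a (Ladd u v)) (LaddE u v))
  (LaddE (Lscale a u) (Lscale a v)) (filterI (LscaleE a u) (LscaleE a v))
  => x [h1 h2] h3 [h4 h5] xT.
by rewrite h1// h2// h3// h4// h5// mulrDr.
Qed.

Lemma LscaleDl u : {morph Lscale^~ u : a b / a + b}.
Proof.
move=> a b; apply: eq_Lspace.
apply: filterS3 (LscaleE (a + b) u) (LaddE (Lscale a u) (Lscale b u))
  (filterI (LscaleE a u) (LscaleE b u)) => x h1 h2 [h3 h4] xT.
by rewrite h1// h2// h3// h4// mulrDl.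
Qed.

HB.instance Definition _ :=
  GRing.Zmodule_isLmodule.Build R Lp LscaleA Lscale1 LscaleDr LscaleDl.

Definition Lspace_norm u : R := fine 'N[mu]_p[EFin \o u]%E.

Lemma Lspace_normE u : (Lspace_norm u)%:E = 'N[mu]_p[EFin \o u]%E.
Proof.
rewrite /Lspace_norm fineK// fin_numElt (lt_le_trans ltNy0) ?Lnorm_ge0//=.
exact: Lebesgue_finite.
Qed.

Lemma ler_Lspace_normD u v :
  Lspace_norm (u + v) <= Lspace_norm u + Lspace_norm v.
Proof.
have mD : measurable_fun [set: T] (fun x => u x + v x).
  by apply: measurable_funD; exact: measurable_Lspace.
rewrite -lee_fin EFinD !Lspace_normE.
rewrite (eq_ae_Lnorm (measurable_Lspace _) mD (LaddE u v)).
by apply: eminkowski => //; exact: measurable_Lspace.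
Qed.

Lemma Lspace_normZ a u : Lspace_norm (a *: u) = `|a| * Lspace_norm u.
Proof.
have mZ : measurable_fun [set: T] (fun x => a * u x).
  by apply: measurable_funM => //; exact: measurable_Lspace.
apply: EFin_inj; rewrite EFinM !Lspace_normE.
rewrite (eq_ae_Lnorm (measurable_Lspace _) mZ (LscaleE a u)).
exact: (LnormZ (Lfun_Sub p1 (Lspace_Lfun u))).
Qed.

Lemma Lspace_norm_eq0 u : Lspace_norm u = 0 -> u = 0.
Proof.
move=> u0; apply: eq_Lspace.
have p0 : (0 < p)%E by rewrite (lt_le_trans _ p1)// lte01.
have := Lspace_normE u; rewrite u0 => /esym.
move=> /(Lnorm_eq0_eq0 _ p0) h.
have /h : measurable_fun [set: T] (EFin \o u).
  by apply/measurable_EFinP; exact: measurable_Lspace.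
by move=> h'; apply: filterS2 h' L0E => x h1 h2 xT; rewrite h2//; case: (h1 xT).
Qed.

HB.instance Definition _ :=
  Lmodule_isNormed.Build R Lp ler_Lspace_normD Lspace_normZ Lspace_norm_eq0.

(* Junk value 0 when f is not p-integrable. *)
Definition Lclass (f : T -> R) : Lp :=
  if pselect (f \in Lfun mu p) is left fL then Lclass_of fL else 0.

End Lspace_normed.



Notation L2 R d := (LspaceType (lebesgue_rV R d) (lee1n 2)).

(* Multiplication by a bounded potential: meaningful for r in L^oo, for which
   the product is square integrable. *)
Definition Lmul (R : realType) (d : nat) (r : 'rV[R]_d -> R) (u : L2 R d) :
  L2 R d := Lclass _ _ (fun x => r x * u x).

Section distributions.
Context (R : realType) (d : nat).
Local Notation E := 'rV[R]_d.
Local Notation leb := (lebesgue_rV R d).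
Implicit Types (f phi chi : E -> R) (q : (E -> R) -> R).

Definition pderive (s : seq 'I_d) f : E -> R :=
  foldr (fun i g x => 'D_(delta_mx ord0 i) g x) f s.

Definition smooth f := forall s : seq 'I_d,
  continuous (pderive s f) /\
  forall i x, derivable (pderive s f) x (delta_mx ord0 i).

Definition supp f : set E := closure [set x | f x != 0].

Definition test_function f := smooth f /\ compact (supp f).

Definition Cnorm (N : nat) f : R :=
  sup [set y | exists (s : seq 'I_d) (x : E),
                 (size s <= N)%N /\ y = `|pderive s f x|].

(* A distribution only matters on test functions; its values on other
   functions are unconstrained and never used. *)
Record schwartz_distribution := SchwartzDistribution {
  pairing :> (E -> R) -> R ;
  distribution_linear : forall a f g, test_function f -> test_function g ->
    pairing (fun x => a * f x + g x) = a * pairing f + pairing g ;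
  distribution_continuous : forall K : set E, compact K ->
    exists (C : R) (N : nat), forall f, test_function f -> supp f `<=` K ->
      `|pairing f| <= C * Cnorm N f }.

Definition compactly_supported q := exists2 K : set E, compact K &
  forall f, test_function f -> supp f `&` K = set0 -> q f = 0.

Definition bounded_distribution q := exists2 g : E -> R,
  g \in Lfun leb +oo%E &
  forall f, test_function f -> q f = \int[leb]_x (g x * f x).

Definition convolution q phi : E -> R := fun x => q (fun y => phi (x - y)).

Definition dist_mul chi q : (E -> R) -> R := fun f => q (fun x => chi x * f x).

Definition mollifier phi :=
  [/\ test_function phi, forall x, 0 <= phi x & \int[leb]_x phi x = 1].

Definition mollifying_scale (l : R -> R) :=
  (forall e, 0 < e <= 1 -> 0 < l e) /\ l e @[e --> 0^'+] --> (0 : R).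

Definition mollify phi (l : R -> R) (e : R) : E -> R :=
  fun x => l e ^- d * phi ((l e)^-1 *: x).

Definition cutoff_net (chi : R -> E -> R) :=
  (forall e, 0 < e <= 1 ->
     test_function (chi e) /\ forall x, 0 <= chi e x <= 1) /\
  (forall K : set E, compact K ->
     \forall e \near 0^'+, forall x, K x -> chi e x = 1).

(* Cut-offs are reserved for distributions that are neither compactly
   supported nor bounded. *)
Definition regularizing_net q (qe : R -> E -> R) :=
  [/\ forall e, 0 < e <= 1 -> smooth (qe e),
      forall f, test_function f ->
        \int[leb]_x (qe e x * f x) @[e --> 0^'+] --> q f &
      exists phi (l : R -> R), [/\ mollifier phi, mollifying_scale l &
        (forall e, 0 < e <= 1 -> qe e = convolution q (mollify phi l e)) \/
        [/\ ~ compactly_supported q, ~ bounded_distribution q &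
            exists2 chi, cutoff_net chi & forall e, 0 < e <= 1 ->
              qe e = convolution (dist_mul (chi e) q) (mollify phi l e)]]].

End distributions.

Definition moderate (R : realType) (B : Type) (nrm : B -> \bar R)
    (b : R -> B) :=
  exists (N : nat) (C : R), 0 < C /\
    forall e, 0 < e <= 1 -> (nrm (b e) <= (C * e ^- N)%:E)%E.

Section operators.
Context (R : realType) (V : normedModType R).

(* A linear operator given by a domain and a function that is only relevant on
   that domain. *)
Record linop := Linop {
  dom : set V ;
  op :> V -> V ;
  dom0 : dom 0 ;
  domP : forall a x y, dom x -> dom y -> dom (a *: x + y) ;
  opP : forall a x y, dom x -> dom y -> op (a *: x + y) = a *: op x + op y }.

Definition closed_op (A : linop) :=
  closed [set xy : V * V | dom A xy.1 /\ xy.2 = A xy.1].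

Definition C0_semigroup (S : R -> V -> V) :=
  [/\ forall t, 0 <= t -> linear (S t) /\ continuous (S t),
      S 0 = id,
      forall s t, 0 <= s -> 0 <= t -> S (s + t) = S s \o S t &
      forall x, S t x @[t --> 0^'+] --> x].

Definition generates (A : linop) (S : R -> V -> V) := forall x y,
  (dom A x /\ y = A x) <-> h^-1 *: (S h x - x) @[h --> 0^'+] --> y.

(* Functions on [0, T] are total; values outside [0, T] are irrelevant. *)
Definition CT (T : R) (Y : set V) : set (R -> V) :=
  [set u | {within `[0, T], continuous u} /\ forall t, t \in `[0, T] -> Y (u t)].

Definition sup_norm (T : R) (u : R -> V) : R :=
  sup [set `|u t| | t in `[0, T]].

Definition abs_continuous (T : R) (u : R -> V) :=
  forall e : R, 0 < e -> exists2 delta : R, 0 < delta &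
    forall n (a b : 'I_n -> R),
      (forall i, [/\ 0 <= a i, a i <= b i & b i <= T]) ->
      (forall i j, i != j -> `]a i, b i[ `&` `]a j, b j[ = set0) ->
      \sum_i (b i - a i) < delta -> \sum_i `|u (b i) - u (a i)| < e.

Definition simple_fun (s : measurableTypeR R -> V) :=
  finite_set (range s) /\ forall v, measurable (s @^-1` [set v]).

Definition bochner_integrable (D : set R) (u : R -> V) :=
  (exists2 s : nat -> R -> V, forall n, simple_fun (s n) &
     {ae @lebesgue_measure R, forall t, D t -> s n t @[n --> \oo] --> u t}) /\
  (\int[@lebesgue_measure R]_(t in D) `|u t|%:E < +oo)%E.

End operators.

Section chaos.
Context (R : realType).

Definition multiindex := {fsfun nat -> nat with 0%N}.

(* Indices start from 0, hence the factor 2 (i + 1). *)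
Definition weight (gamma : multiindex) : R :=
  \prod_(i <- finsupp gamma) (2 * i.+1)%:R ^+ gamma i.

(* A formal expansion is identified with the family of its coefficients. *)
Definition chaos_norm (Y : Type) (nrm : Y -> R) (p : R) (F : multiindex -> Y) :
    \bar R :=
  ((\esum_(gamma in [set: multiindex])
      (nrm (F gamma) ^+ 2 * weight gamma `^ (- p))%:E) `^ 2^-1)%E.

Definition chaos_p (Y : Type) (C : set Y) (nrm : Y -> R) (p : R) :
    set (multiindex -> Y) :=
  [set F | (forall gamma, C (F gamma)) /\ (chaos_norm nrm p F < +oo)%E].

Definition chaos (Y : Type) (C : set Y) (nrm : Y -> R) : set (multiindex -> Y) :=
  [set F | exists2 p, 0 <= p & chaos_p C nrm p F].

Definition moderate_process (V : normedModType R) (T : R)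
    (U : R -> multiindex -> R -> V) :=
  exists pe : R -> R,
    let P := [set pe e | e in `]0, 1]] in
    [/\ forall e, 0 < e <= 1 ->
          0 <= pe e /\ chaos_p (CT T setT) (sup_norm T) (pe e) (U e),
        has_sup P, 1 < sup P &
        moderate (chaos_norm (sup_norm T) (sup P)) U].

End chaos.

Section problem.
Context (R : realType) (d : nat) (T : R) (A : linop (L2 R d)).
Local Notation leb := (lebesgue_rV R d).

Definition strong_solution (r : 'rV[R]_d -> R) (f : R -> L2 R d) (g : L2 R d)
    (u : R -> L2 R d) :=
  [/\ CT T (dom A) u,
      abs_continuous T u,
      {ae @lebesgue_measure R, forall t, t \in `]0, T[ -> derivable u t 1},
      bochner_integrable `]0, T[ (derive1 u) &
      {ae @lebesgue_measure R, forall t, t \in `]0, T[ ->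
         derive1 u t - A (u t) + Lmul r (u t) = f t} /\ u 0 = g].

Definition chaos_solution (r : 'rV[R]_d -> R)
    (F : multiindex -> R -> L2 R d) (G : multiindex -> L2 R d)
    (U : multiindex -> R -> L2 R d) :=
  chaos (CT T (dom A)) (sup_norm T) U /\
  forall gamma, strong_solution r (F gamma) (G gamma) (U gamma).

Definition very_weak_solution (q : schwartz_distribution R d)
    (F : multiindex -> R -> L2 R d) (G : multiindex -> L2 R d)
    (U : R -> multiindex -> R -> L2 R d) :=
  (forall e, 0 < e <= 1 -> chaos (CT T setT) (sup_norm T) (U e)) /\
  exists qe : R -> 'rV[R]_d -> R,
    [/\ regularizing_net q qe,
        moderate (fun b : 'rV[R]_d -> R => 'N[leb]_(+oo)[EFin \o b])%E qe,
        forall e, 0 < e <= 1 -> chaos_solution (qe e) F G (U e) &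
        moderate_process T U].

End problem.

(* Main.v *)
(* Regularize q at a scale that shrinks so slowly in e that sup |q_e| grows at
   most like ln (1 / e); the exponential of this bound given by the Gronwall
   estimate is then a power of 1 / e, with an exponent independent of the chaos
   coefficient. Each q_e is bounded because a mollification of a compactly
   supported distribution has compact support, and q_e converges to q since
   < q * phi, f > = < q, f smeared by phi >, a pairing obtained by passing to the
   limit in Riemann sums, and f smeared by phi_e tends to f with all its
   derivatives.
   For a fixed bounded potential the mild solution u of u' = A u + B u + f is
   Lipschitz when f is. In a Hilbert space a Lipschitz orbit stays in the domain
   of the generator, and w = A u + B u + f satisfies an estimate
   |w t - S (t - s) (w s)| <= C (t - s) that makes w continuous, whence u is C^1. *)
From HB Require Import structures.
Require Import Defs.
From mathcomp Require Import all_boot all_order all_algebra finmap.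
From mathcomp Require Import all_classical all_reals all_analysis.
From mathcomp Require Import measurable_realfun ess_sup_inf ring lra.

Set Implicit Arguments.
Unset Strict Implicit.
Unset Printing Implicit Defensive.

Import Order.TTheory GRing.Theory Num.Theory.
Import numFieldNormedType.Exports.

Local Open Scope classical_set_scope.
Local Open Scope ring_scope.

(** * Linear identities in modules *)

(* The trivial square-zero extension of R by V: linear identities in V become
   identities in a commutative ring, where the ring tactic applies. *)
Section trivial_extension.
Context (R : comNzRingType) (V : lmodType R).

(** The Lipschitz constants of the coefficients [F gamma] are not controlled as [gamma] varies. They
    can serve only the regularity of each single coefficient; the estimate summed over [gamma] must
    involve nothing but [|G gamma|] and [sup_norm T (F gamma)]. The Picard scheme therefore carries
    two separate bounds, one on the size and one on the increments. Its weight
    [expR (2 * M * b * t)] makes the Duhamel term at most half of what it acts on, which is the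
    origin of the factors 2 and of the exponent [2 * M * b * (T + 1)]; with [b = B0 + 1 - ln e] this
    yields [e ^- N] for an integer [N] above [2 * M * (T + 1)]. Vector integrals are increments of
    primitives, built as limits of polygons, and are handled by a mean value inequality that asks
    only for right increments, because a mild solution is first known to have a right derivative.
    Everything is solved on [[0, T + 1]], so that this derivative exists at [T] too. Distributions
    enter only through linearity and one continuity estimate per ball containing the supports. *)

Definition trivial_ext : Type := (R * V)%type.

HB.instance Definition _ := GRing.Zmodule.on trivial_ext.

Let mul (x y : trivial_ext) : trivial_ext := (x.1 * y.1, x.1 *: y.2 + y.1 *: x.2).
Let one : trivial_ext := (1, 0).

Let mulA : associative mul.
Proof.
move=> x y z; rewrite /mul /= mulrA !scalerDr !scalerA addrA.
by congr (_, _ + _ + _); rewrite mulrC.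
Qed.

Let mulC : commutative mul.
Proof. by move=> x y; rewrite /mul mulrC addrC. Qed.

Let mul1 : left_id one mul.
Proof. by case=> a v; rewrite /mul /= mul1r scale1r scaler0 addr0. Qed.

Let mulD : left_distributive mul +%R.
Proof.
by move=> x y z; rewrite /mul /= mulrDl scalerDl scalerDr; congr (_, _); rewrite addrACA.
Qed.

Let oner_neq0 : one != 0.
Proof. by apply/eqP => -[/eqP]; rewrite oner_eq0. Qed.

HB.instance Definition _ := GRing.Zmodule_isComNzRing.Build trivial_ext
  mulA mulC mul1 mulD oner_neq0.

Definition ext_scalar (a : R) : trivial_ext := (a, 0).
Definition ext_vector (v : V) : trivial_ext := (0, v).

Let ext_scalar_zmod : zmod_morphism ext_scalar.
Proof.
by move=> a b; apply: (congr2 pair) => //; rewrite -[RHS]/(0 - 0) subrr.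
Qed.

Let ext_scalar_monoid : monoid_morphism ext_scalar.
Proof.
split=> // a b; rewrite /ext_scalar [RHS](_ : _ = (a * b, a *: 0 + b *: 0))//.
by rewrite !scaler0 addr0.
Qed.

HB.instance Definition _ := GRing.isZmodMorphism.Build R trivial_ext ext_scalar ext_scalar_zmod.
HB.instance Definition _ := GRing.isMonoidMorphism.Build R trivial_ext ext_scalar ext_scalar_monoid.

Lemma ext_vector_inj : injective ext_vector.
Proof. by move=> u v []. Qed.

Lemma ext_vectorE : (ext_vector 0 = 0) *
  ((forall u v, ext_vector (u + v) = ext_vector u + ext_vector v) *
  ((forall u, ext_vector (- u) = - ext_vector u) *
  (forall a u, ext_vector (a *: u) = ext_scalar a * ext_vector u))).
Proof.
split=> //; split=> [u v|].
  by apply: (congr2 pair) => //; rewrite -[RHS]/(0 + 0) addr0.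
split=> [u|a u].
  by apply: (congr2 pair) => //; rewrite -[RHS]/(- 0) oppr0.
rewrite /ext_vector [RHS](_ : _ = (a * 0, a *: u + 0 *: 0))//.
by rewrite mulr0 scaler0 addr0.
Qed.

End trivial_extension.

Ltac lmodule := apply: ext_vector_inj; rewrite !ext_vectorE; ring.

(** * Vector-valued functions of a real variable *)

Lemma near_comp (S : Type) (F : set_system S) (W : topologicalType) (f : S -> W) (y : W)
    (P : W -> Prop) : f @ F --> y -> (\forall z \near y, P z) -> \forall x \near F, P (f x).
Proof. by move=> fy; apply: fy. Qed.

Lemma near_dist_lt (R : realType) (U : normedModType R) (x : U) (e : R) : 0 < e ->
  \forall y \near x, `|x - y| < e.
Proof. by move=> e0; apply/nbhs_ballP; exists e => //=; rewrite -ball_normE. Qed.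

Lemma compact_norm_bounded (R : realType) (V : normedModType R) (K : set V) : compact K ->
  exists2 C : R, 0 <= C & forall x, K x -> `|x| <= C.
Proof.
move=> /compact_bounded[C [_ H]]; exists (`|C| + 1); first by rewrite addr_ge0.
by move=> x Kx; apply: (H (`|C| + 1)) => //; rewrite (le_lt_trans (ler_norm _))// ltrDl.
Qed.

Section has_der.
Context (R : realType) (V : normedModType R).
Implicit Types (K D k : R -> V) (t s : R).

(** Division-free differentiability: the inequality also makes sense at [s = t], and estimates on
    increments can be fed into it directly. It is equivalent to [is_derive] by [has_derP]. *)
Definition has_der K t (l : V) := forall e : R, 0 < e ->
  \forall s \near t, `|K s - K t - (s - t) *: l| <= e * `|s - t|.

Lemma has_derP K t l : is_derive t 1 K l <-> has_der K t l.
Proof.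
have -> : is_derive t 1 K l <->
    h^-1 *: ((K \o shift t) (h *: 1) - K t) @[h --> 0^'] --> l.
  split=> [[dK <-]|Kl]; first exact: dK.
  by apply: DeriveDef; [apply/cvg_ex; exists l|exact: cvg_lim].
split=> [/cvgrPdist_le Kl e e0|Kl].
  have := Kl _ e0; rewrite near_withinE => H.
  have : \forall s \near t, ((s - t != 0) ->
      `|l - (s - t)^-1 *: ((K \o shift t) ((s - t) *: 1) - K t)| <= e).
    have /(_ _ H) : (fun s => s - t) @ t --> (0 : R).
      rewrite -[X in _ --> X](subrr t); apply: cvgB; [exact: cvg_id|exact: cvg_cst].
    by [].
  apply: filterS => s; have [-> _|st] := eqVneq s t.
    by rewrite !subrr scale0r oppr0 addr0 !normr0 mulr0.
  have st0 : s - t != 0 by rewrite subr_eq0.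
  move=> /(_ st0) /=; rewrite [_ *: 1]mulr1 subrK => Hs.
  rewrite (_ : _ - _ *: l = (s - t) *: ((s - t)^-1 *: (K s - K t) - l)).
    by rewrite normrZ mulrC ler_pM2r ?normr_gt0// distrC.
  by rewrite scalerBr scalerA divff// scale1r.
apply/cvgrPdist_le => e e0; rewrite near_withinE.
have : \forall h \near (0 : R), `|K (h + t) - K t - (h + t - t) *: l| <= e * `|h + t - t|.
  have /(_ _ (Kl _ e0)) : (fun h : R => h + t) @ 0 --> t.
    rewrite -[X in _ --> X]add0r; apply: cvgD; [exact: cvg_id|exact: cvg_cst].
  by [].
apply: filterS => h; rewrite addrK => Hh h0 /=; rewrite [_ *: 1]mulr1.
rewrite -(ler_pM2l (_ : 0 < `|h|)) ?normr_gt0// -normrZ scalerBr scalerA divff//.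
by rewrite scale1r distrC mulrC.
Qed.

Lemma has_der_continuous K t l : has_der K t l -> {for t, continuous K}.
Proof.
move=> /has_derP[dK _]; apply: differentiable_continuous.
exact/derivable1_diffP.
Qed.

Lemma has_derB K D t l m : has_der K t l -> has_der D t m ->
  has_der (fun s => K s - D s) t (l - m).
Proof. by move=> /has_derP Kl /has_derP Dm; apply/has_derP; exact: is_deriveB. Qed.

Lemma has_der_cst t v : has_der (cst v) t 0.
Proof. by apply/has_derP; exact: is_derive_cst. Qed.

Lemma has_derZ t v c : has_der (fun s => (s - c) *: v) t v.
Proof.
move=> e e0; near=> s.
by rewrite -scalerBl opprB addrA subrK subrr normr0 mulr_ge0// ltW.
Unshelve. all: by end_near. Qed.

Lemma has_der_shift K t c l : has_der K (t + c) l -> has_der (fun s => K (s + c)) t l.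
Proof.
move=> Kl e e0.
have H : (fun s : R => s + c) @ t --> t + c.
  by apply: cvgD; [exact: cvg_id|exact: cvg_cst].
have := near_comp H (Kl _ e0); apply: filterS => s.
by rewrite opprD [s + c + _]addrACA subrr addr0.
Qed.

Lemma has_der_right K t l : has_der K t l -> forall e, 0 < e ->
  \forall h \near (0:R)^'+, `|K (t + h) - K t - h *: l| <= e * h.
Proof.
move=> Kl e e0.
have H : (fun h : R => t + h) @ 0 --> t.
  rewrite -[X in _ --> X]addr0; apply: cvgD; [exact: cvg_cst|exact: cvg_id].
rewrite near_withinE; have := near_comp H (Kl _ e0); apply: filterS => h + h0.
by rewrite [t + h]addrC addrK (gtr0_norm h0).
Qed.

End has_der.

Lemma has_der_linear (R : realType) (V W : normedModType R) (L : V -> W) (M : R)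
    (K : R -> V) t l : (forall a x y, L (a *: x + y) = a *: L x + L y) ->
  (forall x, `|L x| <= M * `|x|) -> has_der K t l -> has_der (L \o K) t (L l).
Proof.
move=> linL LM Kl e e0.
have M0 : 0 < `|M| + 1 by rewrite ltr_wpDl.
have := Kl (e / (`|M| + 1)); rewrite divr_gt0// => /(_ isT).
apply: filterS => s Ks /=.
have LB x y : L (x - y) = L x - L y.
  by rewrite -[x - y]addrC -scaleN1r linL scaleN1r addrC.
have L0 : L 0 = 0 by rewrite -(subrr 0) LB subrr.
have -> : (s - t) *: L l = L ((s - t) *: l) by rewrite -[in RHS](addr0 (_ *: _)) linL L0 addr0.
rewrite -!LB (le_trans (LM _))//.
apply: (@le_trans _ _ ((`|M| + 1) * `|K s - K t - (s - t) *: l|)).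
  by apply: ler_wpM2r => //; rewrite (le_trans (ler_norm _))// lerDl.
rewrite (le_trans (ler_wpM2l (ltW M0) Ks))// mulrA mulrCA divff ?gt_eqF// mulr1.
exact: lexx.
Qed.

(** * Mean value inequalities from right increments *)

Section mean_value.
Context (R : realType) (V : normedModType R).
Implicit Types (K D k : R -> V) (p : R -> R) (t s : R).

(** Continuous induction. Let [s] be the supremum of the points up to which the estimate holds with
    an extra slope [e]. Left continuity carries the estimate to [s], and the hypothesis on right
    increments at [s] carries it strictly beyond, unless [s = b]. The extra slope costs [e0] in
    total, which is arbitrary. *)
Lemma mean_value_right D p a b : a <= b ->
  (forall t, a <= t <= b -> {for t, continuous D} /\ {for t, continuous p}) ->
  (forall t, a <= t < b -> forall e, 0 < e -> \forall h \near (0:R)^'+,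
     `|D (t + h) - D t| <= p (t + h) - p t + e * h) ->
  `|D b - D a| <= p b - p a.
Proof.
move=> ab cDp Dp; apply/ler_addgt0Pr => e0 e00.
have [->|neqab] := eqVneq b a; first by rewrite !subrr normr0 add0r ltW.
have ltab : a < b by rewrite lt_neqAle eq_sym neqab.
pose e := e0 / (b - a); have e_gt0 : 0 < e by rewrite divr_gt0// subr_gt0.
pose G c := `|D c - D a| <= p c - p a + e * (c - a).
suff : G b by rewrite /G /e divfK// subr_eq0.
pose E := [set c | a <= c <= b /\ forall x, a <= x <= c -> G x].
have Ga : G a by rewrite /G !subrr mulr0 normr0 addr0.
have Ea : E a.
  by split; rewrite ?lexx// => x /andP[ax xa]; rewrite (@le_anti _ _ x a)// ax xa.
have Eub : ubound E b by move=> c [/andP[]].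
have hsE : has_sup E by split; [exists a|exists b].
set s := sup E.
have as_ : a <= s by apply: (ub_le_sup (proj2 hsE)).
have sb : s <= b by apply: ge_sup => //; exists a.
have Glt x : a <= x < s -> G x.
  move=> /andP[ax xs]; have [y [_ Ey] xy] := sup_gt (ex_intro _ a Ea) xs.
  by apply: Ey; rewrite ax ltW.
have Gs : G s.
  have [<-//|sa] := eqVneq a s.
  have lt_as : a < s by rewrite lt_neqAle sa.
  rewrite /G.
  have [cD cp] : {for s, continuous D} /\ {for s, continuous p}.
    by apply: cDp; rewrite as_.
  have cl : `|D x - D a| @[x --> s^'-] --> `|D s - D a|.
    apply: cvg_norm; apply: cvgB; last exact: cvg_cst.
    exact: cvg_at_left_filter.
  have cr : (p x - p a + e * (x - a)) @[x --> s^'-] --> p s - p a + e * (s - a).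
    apply: cvgD.
      by apply: cvgB; [exact: cvg_at_left_filter|exact: cvg_cst].
    apply: cvgMr; apply: cvgB; last exact: cvg_cst.
    exact: cvg_at_left_filter.
  rewrite -(cvg_lim _ cl)// -(cvg_lim _ cr)//.
  apply: ler_lim; first by apply/cvg_ex; exists (`|D s - D a|).
    by apply/cvg_ex; exists (p s - p a + e * (s - a)).
  near=> x; apply: Glt; apply/andP; split; near: x.
    exact: nbhs_left_ge.
  exact: nbhs_left_lt.
have Es : E s.
  split; first by rewrite as_.
  move=> x /andP[ax]; rewrite le_eqVlt => /predU1P[->//|xs]; apply: Glt.
  by rewrite ax.
have [<-//|nsb] := eqVneq s b.
have lt_sb : s < b by rewrite lt_neqAle nsb.
have := Dp s; rewrite as_ lt_sb => /(_ isT _ e_gt0).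
rewrite near_withinE => -[d /= d0 Hd].
pose d' := Num.min (d / 2) (b - s).
have d'0 : 0 < d' by rewrite lt_min divr_gt0//= subr_gt0.
suff : E (s + d') by move=> /(ub_le_sup (proj2 hsE)); rewrite -/s gerDl leNgt d'0.
split.
  rewrite (le_trans as_) ?lerDl ?(ltW d'0)//=.
  by rewrite -lerBrDl ge_min lexx orbT.
move=> x /andP[ax xs].
have [xls|sx] := leP x s.
  by case: Es => _; apply; rewrite ax.
have h0 : 0 < x - s by rewrite subr_gt0.
have /= := Hd (x - s); rewrite sub0r normrN gtr0_norm// => /(_ _ h0).
rewrite [s + _]addrC subrK => H.
have {}H : `|D x - D s| <= p x - p s + e * (x - s).
  apply: H; rewrite (@le_lt_trans _ _ d')// ?lerBlDl//.
  by rewrite gt_min ltr_pdivrMr// ltr_pMr// ltr1n.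
rewrite /G -(subrK (D s) (D x)) -addrA (le_trans (ler_normD _ _))//.
rewrite (le_trans (lerD H Gs))//; lra.
Unshelve. all: by end_near. Qed.

Lemma mean_value_norm K k p p' a b : a <= b ->
  (forall t, a <= t <= b -> has_der K t (k t)) ->
  (forall t, a <= t <= b -> has_der p t (p' t)) ->
  (forall t, a <= t <= b -> `|k t| <= p' t) ->
  `|K b - K a| <= p b - p a.
Proof.
move=> ab dK dp kp; apply: mean_value_right => // [t tab|t /andP[at_ tb] e e0].
  by split; [exact: has_der_continuous (dK _ tab)|exact: has_der_continuous (dp _ tab)].
have tab : a <= t <= b by rewrite at_ ltW.
have e20 : 0 < e / 2 by rewrite divr_gt0.
have := has_der_right (dp _ tab) e20; have := has_der_right (dK _ tab) e20.
apply: filterS2.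
move=> h Kh ph.
have : 0 <= h.
  have := le_trans (normr_ge0 _) Kh; by rewrite pmulr_rge0.
move=> h0; rewrite -(subrK (h *: k t) (K (t + h) - K t)).
rewrite (le_trans (ler_normD _ _))// normrZ (ger0_norm h0).
have := ler_wpM2l h0 (kp _ tab).
have := ler_norm (- (p (t + h) - p t - h *: p' t)); rewrite normrN.
have -> : h *: p' t = h * p' t by [].
move: ph; have -> : h *: p' t = h * p' t by [].
lra.
Qed.

Lemma has_der_inc_unique K D k a b : a <= b ->
  (forall t, a <= t <= b -> has_der K t (k t)) ->
  (forall t, a <= t <= b -> has_der D t (k t)) ->
  K b - K a = D b - D a.
Proof.
move=> ab dK dD; apply/eqP; rewrite -subr_eq0 -normr_le0.
have -> : K b - K a - (D b - D a) = (K b - D b) - (K a - D a).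
  by rewrite !opprD !opprK addrACA.
have := @mean_value_norm (fun s => K s - D s) (fun=> 0) (cst 0) (cst 0) a b ab.
rewrite /= subrr; apply => [t tab|t _|t _].
- by rewrite -(subrr (k t)); apply: has_derB; [exact: dK|exact: dD].
- exact: has_der_cst.
- by rewrite normr0.
Qed.

End mean_value.

Lemma lipschitz_fun_continuous (R : realType) (U V : normedModType R) (f : U -> V) (C : R) :
  (forall x y, `|f x - f y| <= C * `|x - y|) -> continuous f.
Proof.
move=> fC x; have C0 : 0 < `|C| + 1 by rewrite ltr_wpDl.
apply/cvgrPdist_le => e e0; near=> y.
rewrite (le_trans (fC _ _))// (@le_trans _ _ ((`|C| + 1) * `|x - y|))//.
  by rewrite ler_wpM2r// (le_trans (ler_norm _))// lerDl.
rewrite -ler_pdivlMl// mulrC ltW//.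
by near: y; apply: near_dist_lt; rewrite divr_gt0.
Unshelve. all: by end_near. Qed.

Lemma min_continuous (R : realType) (c : R) : continuous (fun t => Num.min t c).
Proof.
apply: (@lipschitz_fun_continuous R _ _ _ 1) => x y; rewrite mul1r.
wlog xy : x y / x <= y.
  by move=> H; have [/H//|/ltW /H] := leP x y; rewrite distrC [X in _ <= X]distrC.
rewrite ler0_norm ?ler0_norm ?subr_le0 ?le_min ?ge_min ?lexx ?xy ?orbT//.
by rewrite !opprB; rewrite /Num.min; do ![case: ifPn]; rewrite -?leNgt; lra.
Unshelve. all: by end_near. Qed.

(** * Polygonal approximation of primitives *)

Section polygon.
Context (R : realType) (V : normedModType R).
Variables (k : R -> V) (a : R).

Let node h j : R := a + j%:R * h.

(** Euler polygon: zero up to [a], then piecewise linear with slope [k (node h j)] on the [j]-th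
    step. Each difference of minima is the length of the part of that step lying below [t]. *)
Definition polygon (h : R) (m : nat) (t : R) : V :=
  \sum_(j < m) (Num.min t (node h j.+1) - Num.min t (node h j)) *: k (node h j).

(** The increment is a combination of values of [k] with weights [w j], the lengths of the steps
    inside [[s, t]]. The weights are nonnegative, add up to [t - s], and vanish unless the left node
    lies in [[s - h, t]]. *)
Lemma polygon_increment (h : R) m (s t : R) (c : V) (eta : R) : 0 < h -> 0 <= eta ->
  a <= s <= t -> t <= a + m%:R * h ->
  (forall r, s - h <= r <= t -> `|k r - c| <= eta) ->
  `|polygon h m t - polygon h m s - (t - s) *: c| <= eta * (t - s).
Proof.
move=> h0 eta0 /andP[as_ st] tm kc.
pose w j := (Num.min t (node h j.+1) - Num.min t (node h j)) -
  (Num.min s (node h j.+1) - Num.min s (node h j)).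
have sumw : \sum_(j < m) w j = t - s.
  rewrite sumrB -!(big_mkord xpredT (fun j => Num.min _ (node h j.+1) - Num.min _ (node h j))).
  have at_ := le_trans as_ st; have sm := le_trans st tm.
  by rewrite !telescope_sumr// /node mul0r addr0 (min_l tm) (min_l sm)
     (min_r at_) (min_r as_); lra.
have nodeS j : node h j.+1 = node h j + h by rewrite /node -natr1 mulrDl mul1r addrA.
have w0 j : 0 <= w j.
  rewrite /w nodeS subr_ge0; have [sj|sj] := leP s (node h j).
    have -> : Num.min s (node h j + h) = s by apply: min_l; lra.
    by rewrite subrr subr_ge0 le_min !ge_min lexx lerDl (ltW h0) orbT.
  by rewrite (min_r (le_trans (ltW sj) st)) lerD2r le_min !ge_min lexx st orbT.
have wkc j : `|w j *: (k (node h j) - c)| <= eta * w j.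
  rewrite normrZ (ger0_norm (w0 j)) mulrC.
  have [->|wj] := eqVneq (w j) 0; first by rewrite !mulr0.
  apply: ler_wpM2r; first exact: w0.
  apply: kc; apply: contraNT wj; rewrite negb_and -!ltNge /w nodeS => wj; apply/eqP.
  have h_ge0 := ltW h0.
  move: wj => /orP[sj|tj].
    have sj1 : node h j + h <= s by lra.
    have sj0 : node h j <= s by lra.
    by rewrite !min_r ?(le_trans _ st)// subrr.
  have tj1 : t <= node h j + h by lra.
  by rewrite !min_l ?(le_trans st)// ?(ltW tj)// ?subrr.
rewrite /polygon -sumrB -sumw scaler_suml -sumrB mulr_sumr.
rewrite (le_trans (ler_norm_sum _ _ _))// ler_sum// => j _.
by rewrite -scalerBl -/(w j) -scalerBr; exact: wkc.
Qed.

Lemma polygon_continuous h m : continuous (polygon h m).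
Proof.
elim: m => [|m IHm] t.
  by rewrite /polygon; under eq_fun do rewrite big_ord0; exact: cvg_cst.
rewrite /polygon; under eq_fun do rewrite big_ord_recr.
apply: (@cvgD _ _ _ _ _ (polygon h m)); first exact: IHm.
by apply: cvgZr_tmp; apply: cvgB; exact: min_continuous.
Qed.

End polygon.

(** Only [x] has to lie in [K], because [f] is continuous at the points of [K] along the whole
    space. Compactness is used in its near-covering form: a property that holds around each point of
    [K] for all small [d] holds on [K] for a common [d]. *)
Lemma heine_cantor (R : realType) (U V : normedModType R) (K : set U) (f : U -> V) :
  compact K -> (forall x, K x -> {for x, continuous f}) ->
  forall e : R, 0 < e -> exists2 d : R, 0 < d &
    forall x y, K x -> `|x - y| < d -> `|f x - f y| <= e.
Proof.
move=> /compact_near_coveringP cK fK e e0.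
have e20 : 0 < e / 2 by rewrite divr_gt0.
pose P (d : R) x := forall y, `|x - y| < d -> `|f x - f y| <= e.
have : \forall d \near (0 : R)^'+, K `<=` P d.
  apply: cK => x Kx.
  have /cvgrPdist_le /(_ _ e20) /nbhs_ballP [d /= d0] := fK _ Kx.
  rewrite -ball_normE => Hd.
  have d20 : 0 < d / 2 by rewrite divr_gt0.
  exists (ball x (d / 2), [set c : R | c < d / 2]) => /=.
    by split; [exact: nbhsx_ballx|exact: nbhs_right_lt].
  move=> [z c] /= []; rewrite -ball_normE /= => xz cd y zy.
  have fxz : `|f x - f z| <= e / 2.
    by apply: Hd; rewrite /= (lt_le_trans xz)// ler_pdivrMr// ler_pMr// ler1n.
  have fxy : `|f x - f y| <= e / 2.
    apply: Hd; rewrite /= -(subrK z x) -addrA (le_lt_trans (ler_normD _ _))//.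
    by rewrite [d]splitr ltrD// (lt_trans zy).
  rewrite -(subrK (f x) (f z)) -addrA (le_trans (ler_normD _ _))//.
  by rewrite [e]splitr lerD// distrC.
rewrite near_withinE => -[d /= d0 Hd]; exists (d / 2); first by rewrite divr_gt0.
move=> x y Kx xy; apply: (Hd (d / 2)) => //=; rewrite ?divr_gt0//.
by rewrite sub0r normrN gtr0_norm ?divr_gt0// ltr_pdivrMr// ltr_pMr// ltr1n.
Qed.

Lemma cauchy_seq_cvg (R : realType) (V : completeNormedModType R) (u : nat -> V) :
  (forall e : R, 0 < e -> exists N, forall n m, (N <= n)%N -> (N <= m)%N ->
     `|u n - u m| <= e) -> exists l : V, u n @[n --> \oo] --> l.
Proof.
move=> cu; apply/cvg_ex; apply: cauchy_cvg; apply/cauchy_exP => e e0.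
have e20 : 0 < e / 2 by rewrite divr_gt0.
have [N HN] := cu _ e20; exists (u N); exists N => // m /= Nm.
rewrite -ball_normE /= (le_lt_trans (HN _ _ _ _))//.
by rewrite ltr_pdivrMr// ltr_pMr// ltr1n.
Qed.

Lemma ler_norm_lim (R : realType) (V : normedModType R) (u : nat -> V) (l v : V) (c : R) :
  u n @[n --> \oo] --> l -> (\forall n \near \oo, `|u n - v| <= c) -> `|l - v| <= c.
Proof.
move=> ul uc; have cl : `|u n - v| @[n --> \oo] --> `|l - v|.
  by apply: cvg_norm; apply: cvgB; [|exact: cvg_cst].
by rewrite -(cvg_lim _ cl)//; apply: limr_le => //; apply/cvg_ex; exists (`|l - v|).
Qed.

(** * Primitives of continuous functions *)

Section primitive.
Context (R : realType) (V : completeNormedModType R).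
Implicit Types k : R -> V.

(** With steps [1 / (n + 1)], in number [(n + 1) ^ 2], the polygons eventually cover any interval.
    By uniform continuity the increments of two fine polygons over a short [[s, t]] are both close
    to [(t - s) *: k s], so [mean_value_right] makes their difference small at [T]. The limit
    inherits [polygon_increment], which is differentiability. *)
Lemma primitive_exists k (a : R) : continuous k ->
  exists K : R -> V, forall t, a < t -> has_der K t (k t).
Proof.
move=> ck.
pose h n : R := n.+1%:R^-1; pose m n := (n.+1 * n.+1)%N.
have h0 n : 0 < h n by rewrite invr_gt0.
have mh n : (m n)%:R * h n = n.+1%:R.
  by rewrite /m natrM mulfK.
pose K_ n := polygon k a (h n) (m n).
have K_a n : K_ n a = 0.
  rewrite /K_ /polygon big1// => j _; rewrite !min_l ?subrr ?scale0r// lerDl.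
    by rewrite mulr_ge0// ltW.
  by rewrite mulr_ge0// ltW.
have hd (d : R) : 0 < d -> exists N, forall n, (N <= n)%N -> h n < d.
  move=> d0; exists (Num.truncn d^-1) => n Nn; rewrite /h -[d]invrK ltf_pV2 ?posrE ?invr_gt0//.
  by rewrite (lt_le_trans (truncnS_gt _))// ler_nat.
have hT (T : R) : exists N, forall n, (N <= n)%N -> T <= a + (m n)%:R * h n.
  exists (Num.truncn (T - a)) => n Nn; rewrite mh -lerBlDl ltW//.
  by rewrite (lt_le_trans (truncnS_gt _))// ler_nat.
have cauchyK T : a <= T -> exists l : V, K_ n T @[n --> \oo] --> l.
  move=> aT; apply: cauchy_seq_cvg => e e0.
  (* Each of the two polygons contributes a slope [e1], whence the 2; the added 1 keeps the
     denominator positive when [T = a]. *)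
  pose e1 := e / (2 * (T - a + 1)).
  have Ta0 : 0 < T - a + 1 by lra.
  have e10 : 0 < e1 by rewrite divr_gt0// mulr_gt0.
  have [d d0 Hd] := heine_cantor (@segment_compact _ a T) (fun x _ => ck x) e10.
  have d20 : 0 < d / 2 by rewrite divr_gt0.
  have [N1 HN1] := hd _ d20; have [N2 HN2] := hT T.
  exists (maxn N1 N2) => n n'; rewrite !geq_max => /andP[N1n N2n] /andP[N1n' N2n'].
  have incr s t : a <= s -> s <= t -> t <= T -> t - s < d / 2 ->
      `|(K_ n t - K_ n' t) - (K_ n s - K_ n' s)| <= 2 * e1 * (t - s).
    move=> as_ st tT ts.
    have sub x : (N1 <= x)%N -> (N2 <= x)%N -> `|K_ x t - K_ x s - (t - s) *: k s| <= e1 * (t - s).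
      move=> x1 x2; apply: polygon_increment => //; first exact: ltW.
      - by rewrite as_.
      - by rewrite (le_trans tT)// HN2.
      move=> r /andP[sr rt]; rewrite distrC; apply: Hd; first by rewrite /= in_itv/= as_ (le_trans st).
      have := HN1 _ x1; rewrite ltr_norml => ?; lra.
    rewrite (_ : _ - _ = (K_ n t - K_ n s - (t - s) *: k s) -
        (K_ n' t - K_ n' s - (t - s) *: k s)); last by lmodule.
    by rewrite (le_trans (ler_normB _ _))// mulr2n !mulrDl mul1r lerD ?sub.
  have := @mean_value_right _ _ (fun t => K_ n t - K_ n' t) (fun t => 2 * e1 * t) a T aT.
  rewrite /= !K_a subrr subr0 => H; apply: (@le_trans _ _ (2 * e1 * T - 2 * e1 * a)).
    apply: H => [t /andP[at_ tT]|t /andP[at_ tT] e' e'0].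
      split; last by apply: cvgMr; exact: cvg_id.
      by apply: cvgB; exact: polygon_continuous.
    near=> x.
    have x0 : 0 < x by near: x; exact: nbhs_right_gt.
    have := @incr t (t + x) at_.
    rewrite lerDl (ltW x0) [t + x - t]addrC addKr => /(_ isT) {}incr.
    apply: (le_trans (incr _ _)).
    - by rewrite -lerBrDl ltW//; near: x; apply: nbhs_right_lt; rewrite subr_gt0.
    - by near: x; exact: nbhs_right_lt.
    have : 0 <= e' * x by rewrite mulr_ge0// ltW.
    lra.
  have e1E : 2 * e1 * (T - a + 1) = e by rewrite /e1; field; rewrite gt_eqF.
  lra.
have KT T : exists l : V, a <= T -> K_ n T @[n --> \oo] --> l.
  have [aT|_] := leP a T; last by exists 0.
  by have [l Hl] := cauchyK _ aT; exists l.
have [K HK] := choice KT.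
exists K => t at_ e e0.
have [d d0 Hd] : exists2 d : R, 0 < d & forall r, `|t - r| < d -> `|k r - k t| <= e.
  have /cvgrPdist_le /(_ _ e0) /nbhs_ballP [d /= d0] := ck t.
  rewrite -ball_normE => Hd; exists d => // r tr; rewrite distrC; exact: Hd.
have d20 : 0 < d / 2 by rewrite divr_gt0.
near=> s.
have as_ : a < s by near: s; exact: lt_nbhsr.
have ts : `|t - s| < d / 2 by near: s; exact: nbhsx_ballx.
have cu : K_ n s - K_ n t - (s - t) *: k t @[n --> \oo] --> K s - K t - (s - t) *: k t.
  by apply: cvgB; [apply: cvgB; apply: HK; exact: ltW|exact: cvg_cst].
rewrite -[X in `|X|]subr0; apply: (ler_norm_lim cu).
have [N1 HN1] := hd _ d20; have [N2 HN2] := hT (Num.max s t).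
exists (maxn N1 N2) => // n /=; rewrite geq_max => /andP[N1n N2n].
have hnd := HN1 _ N1n.
have := HN2 _ N2n; rewrite ge_max => /andP[sm tm].
rewrite subr0; have [st|st] := leP s t.
  rewrite ler0_norm ?subr_le0// opprB -normrN.
  rewrite (_ : - (_ - _ - _) = K_ n t - K_ n s - (t - s) *: k t); last by lmodule.
  apply: polygon_increment => //; rewrite ?(ltW e0) ?(ltW as_)//.
  move=> r /andP[sr rt]; apply: Hd; move: ts; rewrite !ltr_norml => ?; lra.
rewrite gtr0_norm ?subr_gt0//.
apply: polygon_increment => //; rewrite ?(ltW e0) ?(ltW at_) ?(ltW st)//.
move=> r /andP[sr rt]; apply: Hd; move: ts; rewrite !ltr_norml => ?; lra.
Unshelve. all: by end_near. Qed.

End primitive.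

(** * Semigroups and mild solutions *)

Ltac solve_ge0 := by repeat first [by [] | exact: ltW | exact: expR_ge0 |
  apply: mulr_ge0 | apply: addr_ge0 | rewrite invr_ge0 | apply: exprn_ge0].

Lemma continuous_linear_norm_bound (R : realType) (V W : normedModType R) (f : V -> W) :
  linear f -> {for 0, continuous f} ->
  exists2 C : R, 0 < C & forall x, `|f x| <= C * `|x|.
Proof.
move=> lf cf; pose g : {linear V -> W} := HB.pack f (GRing.isLinear.Build _ _ _ _ _ lf).
have /linear_boundedP H : bounded_near g (nbhs 0) by apply: continuous_linear_bounded.
have [C [C0 HC]] : exists C : R, 0 < C /\ forall x, `|f x| <= C * `|x|.
  near (+oo%R : set_system R) => C; exists C; split; near: C; last exact: H.
  exact: nbhs_pinfty_gt.
by exists C.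
Unshelve. all: by end_near. Qed.

Section semigroup.
Context (R : realType) (V : completeNormedModType R) (S : R -> V -> V).
Hypothesis S_semigroup : C0_semigroup S.
Implicit Types (s t : R) (x y : V).

Lemma semigroup_linear t : 0 <= t -> linear (S t).
Proof. by move=> t0; case: S_semigroup => /(_ _ t0)[]. Qed.

Lemma semigroup_at0 x : S 0 x = x.
Proof. by case: S_semigroup => _ ->. Qed.

Lemma semigroupD s t x : 0 <= s -> 0 <= t -> S (s + t) x = S s (S t x).
Proof. by move=> s0 t0; case: S_semigroup => _ _ ->. Qed.

Lemma semigroup_continuous t : 0 <= t -> continuous (S t).
Proof. by move=> t0; case: S_semigroup => /(_ _ t0)[]. Qed.

Lemma semigroup_cvg0 x : S t x @[t --> 0^'+] --> x.
Proof. by case: S_semigroup. Qed.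

Lemma semigroupB t x y : 0 <= t -> S t (x - y) = S t x - S t y.
Proof.
by move=> t0; rewrite addrC -scaleN1r (semigroup_linear t0) scaleN1r addrC.
Qed.

Lemma semigroup_of0 t : 0 <= t -> S t 0 = 0.
Proof. by move=> t0; rewrite -[X in S t X](subrr 0) semigroupB// subrr. Qed.

Lemma semigroupZ t (a : R) x : 0 <= t -> S t (a *: x) = a *: S t x.
Proof.
by move=> t0; rewrite -[a *: x]addr0 (semigroup_linear t0) semigroup_of0// addr0.
Qed.

Lemma semigroup_op_bounded t : 0 <= t -> exists2 C, 0 < C & forall x, `|S t x| <= C * `|x|.
Proof.
move=> t0; apply: continuous_linear_norm_bound; first exact: semigroup_linear.
exact: semigroup_continuous.
Qed.

(* By Banach-Steinhaus, strong continuity at 0 bounds S near 0. *)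
Lemma semigroup_bounded_near0 : exists d M : R, [/\ 0 < d, 1 <= M &
  forall t x, 0 <= t <= d -> `|S t x| <= M * `|x|].
Proof.
apply: contrapT => notb.
have /choice[f Hf] n : exists p : R * V, [/\ 0 <= p.1, p.1 <= n.+1%:R^-1 &
    `|S p.1 p.2| > n.+1%:R * `|p.2|].
  apply: contrapT => Hn; apply: notb; exists n.+1%:R^-1, n.+1%:R; split.
  - by rewrite invr_gt0.
  - by rewrite ler1n.
  move=> t x /andP[t0 tn]; rewrite leNgt; apply/negP => H.
  by apply: Hn; exists (t, x).
pose F := [set S (f n).1 | n in [set: nat]].
have UB : uniform_bounded F.
  apply: Banach_Steinhauss => [_ [n _ <-]|x].
    have [t0 _ _] := Hf n; split; last exact: semigroup_linear.
    have [C C0 HC] := semigroup_op_bounded t0 => r; exists (C * r) => x xr.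
    by rewrite (le_trans (HC _))// ler_wpM2l// ltW.
  have /cvgrPdist_le /(_ _ ltr01) := @semigroup_cvg0 x.
  rewrite near_withinE => -[/= d d0 Hd].
  pose N := Num.truncn d^-1.
  exists (Num.max (`|x| + 1) (\sum_(n < N) `|S (f n).1 x|)) => _ [n _ <-].
  rewrite le_max; have [nN|Nn] := ltnP n N.
    by apply/orP; right; rewrite (bigD1 (Ordinal nN))//= lerDl sumr_ge0.
  apply/orP; left; have [t0 tn _] := Hf n.
  have [->|tn0] := eqVneq (f n).1 0; first by rewrite semigroup_at0 lerDl.
  rewrite -(subrK x (S _ x)) addrC (le_trans (ler_normD _ _))// lerD2l distrC.
  apply: Hd; rewrite /= ?[0 < _]lt_neqAle ?t0 1?eq_sym ?tn0// sub0r normrN ger0_norm//.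
  rewrite (le_lt_trans tn)// -[d]invrK ltf_pV2 ?posrE ?invr_gt0//.
  by rewrite (lt_le_trans (truncnS_gt _))// ler_nat ltnS.
have [M HM] := UB 1.
have [t0 _ ] := Hf (Num.truncn M); set n := Num.truncn M.
have [->|x0] := eqVneq (f n).2 0; first by rewrite semigroup_of0// normr0 mulr0 ltxx.
have : `|S (f n).1 (`|(f n).2|^-1 *: (f n).2)| <= M.
  apply: HM; first by exists n.
  by rewrite normrZ normfV normr_id mulVf ?normr_eq0.
rewrite semigroupZ// normrZ normfV normr_id ler_pdivrMl ?normr_gt0// mulrC => H1 H2.
have := lt_le_trans H2 H1; rewrite ltr_pM2r ?normr_gt0// => /lt_trans /(_ (truncnS_gt _)).
by rewrite ltxx.
Qed.

(** Iterating the bound [M] on [[0, d]] gives [M ^+ n] on [[0, n * d]]. *)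
Lemma semigroup_bounded (T : R) : exists2 M : R, 1 <= M &
  forall t x, 0 <= t <= T -> `|S t x| <= M * `|x|.
Proof.
have [d [M [d0 M1 HM]]] := semigroup_bounded_near0.
have M0 : 0 <= M := le_trans ler01 M1.
suff H n t x : 0 <= t <= n%:R * d -> `|S t x| <= M ^+ n * `|x|.
  exists (M ^+ (Num.truncn (T / d)).+1); first by rewrite exprn_ege1.
  move=> t x /andP[t0 tT]; apply: H; rewrite t0 (le_trans tT)// -ler_pdivrMr// ltW//.
  exact: truncnS_gt.
elim: n t x => [|n IHn] t x.
  rewrite mul0r => /andP[t0 t0']; rewrite expr0 mul1r (@le_anti _ _ t 0) ?t0 ?t0'//.
  by rewrite semigroup_at0.
rewrite -natr1 mulrDl mul1r => /andP[t0 tn].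
have [td|dt] := leP t d.
  rewrite (le_trans (HM _ _ _)) ?t0// ler_wpM2r// exprS ler_peMr// exprn_ege1//.
have dt0 : 0 <= t - d by rewrite subr_ge0 ltW.
rewrite -(subrK d t) addrC semigroupD ?(ltW d0)// exprS -mulrA.
rewrite (le_trans (HM _ _ _)) ?(ltW d0) ?lexx// ler_wpM2l//.
by apply: IHn; rewrite dt0 lerBlDr.
Qed.

(** Reflection in [t] makes orbits continuous on the whole line, so that integrands such as
    [r |-> S (t - r) (k r)] are continuous everywhere and [primitive] applies to them. *)
Definition semigroup_ext t x := S `|t| x.

Local Notation E := semigroup_ext.

(** Factor out the semigroup at the smaller time: it costs [M], and what is left is an increment
    from time 0. *)
Lemma semigroup_increment (T M : R) : (forall t x, 0 <= t <= T -> `|S t x| <= M * `|x|) ->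
  forall s t x, `|s| <= T -> `|t| <= T ->
  `|E t x - E s x| <= M * `|E (`|t| - `|s|) x - x|.
Proof.
move=> HM s t x; rewrite /E; wlog st : s t / `|s| <= `|t|.
  move=> H sT tT; have [/H|/ltW /H] := leP `|s| `|t|; first exact.
  by move=> K; rewrite distrC (_ : `| `|t| - `|s| | = `| `|s| - `|t| |) ?K// distrC.
move=> sT tT; have ts0 : 0 <= `|t| - `|s| by rewrite subr_ge0.
rewrite (ger0_norm ts0) -[X in S X x - _](subrK `|s|) (addrC (_ - _) `|s|) semigroupD//.
by rewrite -semigroupB// HM// normr_ge0.
Qed.

Lemma semigroup_ext_joint_continuous (k : R -> V) (f : R -> R) t :
  {for t, continuous f} -> {for t, continuous k} ->
  {for t, continuous (fun s => E (f s) (k s))}.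
Proof.
move=> cf ck; have [M M1 HM] := semigroup_bounded (`|f t| + 1).
have M0 : 0 < M by rewrite (lt_le_trans ltr01).
apply/cvgrPdist_le => e e0.
have e1 : 0 < e / 2 / M by rewrite !divr_gt0.
have /cvgrPdist_le /(_ _ e1) := @semigroup_cvg0 (k t).
rewrite near_withinE => -[/= d d0 Hd].
near=> s.
have fs : `|f t - f s| < Num.min d 1.
  near: s; move/cvgrPdist_lt : cf; apply; by rewrite lt_min d0 ltr01.
move: fs; rewrite lt_min => /andP[fsd fs1].
have fsT : `|f s| <= `|f t| + 1.
  rewrite -(subrK (f t) (f s)) addrC (le_trans (ler_normD _ _))// lerD2l.
  by rewrite distrC ltW.
rewrite (_ : _ - _ = (E (f t) (k t) - E (f s) (k t)) + (E (f s) (k t) - E (f s) (k s))); last by lmodule.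
rewrite (le_trans (ler_normD _ _))// [e]splitr lerD//.
  rewrite (le_trans (semigroup_increment HM _ _ _))//; first by rewrite lerDl.
  rewrite mulrC -ler_pdivlMr// distrC.
  rewrite /E; have [->|neq] := eqVneq `|f t| `|f s|.
    by rewrite subrr normr0 semigroup_at0 subrr normr0 ltW.
  apply: Hd; rewrite /= ?normr_gt0 ?subr_eq0// sub0r normrN normr_id.
  exact: le_lt_trans (ler_dist_dist _ _) fsd.
rewrite /E -semigroupB// (le_trans (HM _ _ _))// ?normr_ge0//.
rewrite mulrC -ler_pdivlMr//.
by near: s; move/cvgrPdist_le : ck; apply.
Unshelve. all: by end_near. Qed.

Lemma semigroup_ext_continuous x : continuous (fun t => E t x).
Proof.
by move=> t; apply: (@semigroup_ext_joint_continuous (cst x) id);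
  [exact: cvg_id|exact: cvg_cst].
Qed.

End semigroup.

(** * Integrals of continuous vector-valued functions *)

Section vector_integral.
Context (R : realType) (V : completeNormedModType R).
Implicit Types (k K : R -> V) (s t r : R).

(** Starting at -1 makes the derivative two-sided at 0, where the integrals begin. The default
    [cst 0] is never taken for continuous [k]. *)
Definition primitive k : R -> V :=
  xget (cst 0) [set K | forall t, -1 < t -> has_der K t (k t)].

Lemma primitiveP k t : continuous k -> 0 <= t -> has_der (primitive k) t (k t).
Proof.
move=> ck t0; have [K HK] := primitive_exists (-1) ck.
rewrite /primitive; case: xgetP => [K' _ H|/(_ K)]; last by [].
by apply: H; rewrite (lt_le_trans _ t0)// ltrN10.
Qed.

(** The integral of [k] from [s] to [t]. Its calculus rests on [vintE]: an increment is determined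
    by the derivative, so any other primitive computes it. *)
Definition vint k s t := primitive k t - primitive k s.

Lemma vintE k K s t : continuous k -> 0 <= s <= t ->
  (forall r, s <= r <= t -> has_der K r (k r)) -> vint k s t = K t - K s.
Proof.
move=> ck /andP[s0 st] dK; apply: has_der_inc_unique dK => // r /andP[sr _].
by apply: primitiveP => //; rewrite (le_trans s0).
Qed.

Lemma vint_cat k s t u : vint k s u = vint k s t + vint k t u.
Proof. by rewrite /vint; lmodule. Qed.

Lemma vint_shift k k' s t c : continuous k -> continuous k' -> 0 <= s <= t -> 0 <= c ->
  (forall r, s <= r <= t -> k' r = k (r + c)) ->
  vint k (s + c) (t + c) = vint k' s t.
Proof.
move=> ck ck' st c0 kk'; rewrite (@vintE k' (fun r => primitive k (r + c)))//.
move=> r srt; rewrite kk'//; apply: has_der_shift; apply: primitiveP => //.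
by case/andP: srt => sr _; case/andP: st => s0 _; rewrite addr_ge0// (le_trans s0).
Qed.

Lemma vintB k k' s t : continuous k -> continuous k' -> 0 <= s <= t ->
  vint (fun r => k r - k' r) s t = vint k s t - vint k' s t.
Proof.
move=> ck ck' /[dup] st /andP[s0 _].
rewrite (@vintE _ (fun r => primitive k r - primitive k' r))//.
- by rewrite /vint; lmodule.
- by move=> r; apply: cvgB; [exact: ck|exact: ck'].
by move=> r /andP[sr _]; apply: has_derB; apply: primitiveP; rewrite ?(le_trans s0).
Qed.

Lemma vint_linear (L : V -> V) (M : R) k k' s t : linear L ->
  (forall x, `|L x| <= M * `|x|) -> continuous k -> continuous k' -> 0 <= s <= t ->
  (forall r, s <= r <= t -> k' r = L (k r)) -> L (vint k s t) = vint k' s t.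
Proof.
move=> linL LM ck ck' /[dup] st /andP[s0 _] kk'.
rewrite (@vintE k' (L \o primitive k))//.
  by rewrite /vint /= addrC -scaleN1r linL scaleN1r addrC.
move=> r srt; rewrite kk'//; apply: has_der_linear linL LM _.
by case/andP: srt => sr _; apply: primitiveP; rewrite ?(le_trans s0).
Qed.

Lemma vint_norm_le k (p p' : R -> R) s t : continuous k -> 0 <= s <= t ->
  (forall r, s <= r <= t -> has_der p r (p' r)) ->
  (forall r, s <= r <= t -> `|k r| <= p' r) -> `|vint k s t| <= p t - p s.
Proof.
move=> ck /andP[s0 st]; apply: mean_value_norm => // r /andP[sr _].
by apply: primitiveP; rewrite ?(le_trans s0).
Qed.

Lemma vint_dist_le k s t v c : continuous k -> 0 <= s <= t ->
  (forall r, s <= r <= t -> `|k r - v| <= c) -> `|vint k s t - (t - s) *: v| <= c * (t - s).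
Proof.
move=> ck /andP[s0 st] kv.
rewrite (_ : _ - _ = (primitive k t - (t - s) *: v) - (primitive k s - (s - s) *: v)); last first.
  by rewrite /vint; lmodule.
rewrite mulrBr.
apply: (@mean_value_norm _ _ (fun r => primitive k r - (r - s) *: v)
  (fun r => k r - v) (fun r => c * r) (fun=> c)) => // r /andP[sr rt].
- by apply: has_derB; [apply: primitiveP; rewrite ?(le_trans s0)|exact: has_derZ].
- apply/has_derP; apply: is_derive_eq.
  by rewrite [LHS]mulr1.
Qed.

End vector_integral.

(** * The Duhamel integral *)

Section duhamel.
Context (R : realType) (V : completeNormedModType R) (S : R -> V -> V).
Hypothesis S_semigroup : C0_semigroup S.
Implicit Types (k K : R -> V) (s t r : R).
Local Notation E := (semigroup_ext S).

Definition duhamel k t := vint (fun r => E (t - r) (k r)) 0 t.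

Lemma duhamel_integrand_continuous k t : continuous k -> continuous (fun r => E (t - r) (k r)).
Proof.
move=> ck r.
apply: (@semigroup_ext_joint_continuous _ _ _ S_semigroup k (fun r => t - r)) => //; last exact: ck.
by apply: cvgB; [exact: cvg_cst|exact: cvg_id].
Qed.
Local Notation cI := duhamel_integrand_continuous.

Lemma continuous_translate k c : continuous k -> continuous (fun r => k (r + c)).
Proof.
move=> ck r; apply: (@continuous_comp _ _ _ (fun r => r + c) k); last exact: ck.
by apply: cvgD; [exact: cvg_id|exact: cvg_cst].
Qed.

Lemma duhamel_tail k s t : continuous k -> 0 <= s -> 0 <= t ->
  vint (fun r => E (t + s - r) (k r)) s (t + s) = duhamel (fun r => k (r + s)) t.
Proof.
move=> ck s0 t0; rewrite -[X in vint _ X _](add0r s); apply: vint_shift => //.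
- exact: cI.
- by apply: cI; exact: continuous_translate.
- by rewrite lexx.
by move=> r _; congr (E _ _); rewrite opprD addrACA subrr addr0.
Qed.

(** Cut the integral at [s]: by the semigroup law [S t] comes out of the first piece, and the second
    piece is a translate. *)
Lemma duhamel_restart k s t : continuous k -> 0 <= s -> 0 <= t ->
  duhamel k (t + s) = S t (duhamel k s) + duhamel (fun r => k (r + s)) t.
Proof.
move=> ck s0 t0; rewrite [LHS](vint_cat _ _ s) duhamel_tail//; congr (_ + _).
have [M M1 HM] := semigroup_op_bounded S_semigroup t0.
symmetry; apply: (vint_linear (semigroup_linear S_semigroup t0) HM).
- exact: cI.
- exact: cI.
- by rewrite lexx.
move=> r /andP[r0 rs]; rewrite /semigroup_ext -semigroupD// !ger0_norm//.
- by rewrite addrA.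
- by rewrite subr_ge0.
- by rewrite -addrA addr_ge0// subr_ge0.
Qed.

Lemma duhamelB k k' t : continuous k -> continuous k' -> 0 <= t ->
  duhamel k t - duhamel k' t = duhamel (fun r => k r - k' r) t.
Proof.
move=> ck ck' t0; rewrite /duhamel -vintB ?lexx//; [|exact: cI|exact: cI].
apply: vintE => [| |r /andP[r0 rt]].
- by move=> r; apply: cvgB; exact: cI.
- by rewrite lexx.
rewrite /semigroup_ext -semigroupB//.
by apply: primitiveP => //; apply: cI => s; apply: cvgB; [exact: ck|exact: ck'].
Qed.

Lemma duhamel_norm_le k T M (p p' : R -> R) t :
  (forall t x, 0 <= t <= T -> `|S t x| <= M * `|x|) -> 0 <= M ->
  continuous k -> 0 <= t <= T ->
  (forall r, 0 <= r <= t -> has_der p r (p' r)) ->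
  (forall r, 0 <= r <= t -> `|k r| <= p' r) -> `|duhamel k t| <= M * (p t - p 0).
Proof.
move=> HM M0 ck /andP[t0 tT] dp kp; rewrite mulrBr.
apply: (@vint_norm_le _ _ _ (fun r => M * p r) (fun r => M * p' r)).
- exact: cI.
- by rewrite lexx.
- move=> r rt; apply/has_derP; apply: is_deriveZ; apply/has_derP; exact: dp.
move=> r /andP[r0 rt]; rewrite /semigroup_ext ger0_norm ?subr_ge0//.
rewrite (le_trans (HM _ _ _)) ?ler_wpM2l ?kp ?r0//.
by rewrite subr_ge0 rt /= lerBlDr (le_trans tT)// lerDl.
Qed.

End duhamel.

(** * Mild solutions by Picard iteration *)

Section picard.
Context (R : realType) (V : completeNormedModType R) (S : R -> V -> V).
Hypothesis S_semigroup : C0_semigroup S.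
Local Notation E := (semigroup_ext S).
Variables (T M b cg L Kf : R) (B : V -> V) (f : R -> V) (g : V).
Hypotheses (T_ge0 : 0 <= T) (M_ge1 : 1 <= M) (b_gt0 : 0 < b) (cg_ge0 : 0 <= cg)
  (HM : forall t x, 0 <= t <= T -> `|S t x| <= M * `|x|)
  (B_linear : linear B) (HB : forall x, `|B x| <= b * `|x|)
  (f_bound : forall t, `|f t| <= Kf)
  (f_lipschitz : forall s t, `|f s - f t| <= L * `|s - t|)
  (g_orbit : forall h, 0 <= h <= T -> `|S h g - g| <= cg * h).
Implicit Types (s t r h : R) (u v : R -> V).

Let M_gt0 : 0 < M. Proof. exact: lt_le_trans ltr01 M_ge1. Qed.

Let BB x y : B (x - y) = B x - B y.
Proof. by rewrite addrC -scaleN1r B_linear scaleN1r addrC. Qed.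

(** Chosen so that [M * b / growth_rate = 1 / 2]: integrating [M * b * expR (growth_rate * r)] up to
    [t] gives at most half of [expR (growth_rate * t)]. *)
Definition growth_rate := 2 * M * b.
Local Notation lam := growth_rate.

Let lam_gt0 : 0 < lam. Proof. by rewrite !mulr_gt0. Qed.

(** Both constants are twice the contribution of the data; the other half is the Duhamel term of the
    unknown, so each bound reproduces itself under [picard_map]. [sup_const] involves neither [L]
    nor [cg]. *)
Definition sup_const := 2 * M * (`|g| + T * Kf).
Definition lip_const := 2 * M * (cg + L * T + b * sup_const * expR (lam * T) + Kf).

Let Kf_ge0 : 0 <= Kf. Proof. exact: le_trans (normr_ge0 _) (f_bound 0). Qed.

Let L_ge0 : 0 <= L.
Proof.
by have := le_trans (normr_ge0 _) (f_lipschitz 1 0); rewrite subr0 normr1 mulr1.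
Qed.

Let C0_ge0 : 0 <= sup_const.
Proof. by rewrite /sup_const !mulr_ge0 ?addr_ge0 ?mulr_ge0 ?(ltW M_gt0). Qed.

(** Projection onto [[0, T]]. Precomposing with it extends a function by its end values, preserves
    Lipschitz bounds and gives continuity on the whole line. *)
Definition clamp t := Num.max 0 (Num.min t T).

Lemma clampP t : 0 <= clamp t <= T.
Proof. by rewrite /clamp le_max lexx /= ge_max T_ge0 /= ge_min lexx orbT. Qed.

Lemma clamp_id t : 0 <= t <= T -> clamp t = t.
Proof. by move=> /andP[t0 tT]; rewrite /clamp min_l// max_r. Qed.

Lemma clamp_contract s t : `|clamp s - clamp t| <= `|s - t|.
Proof.
wlog st : s t / s <= t.
  by move=> H; have [/H//|/ltW /H] := leP s t; rewrite distrC [X in _ <= X]distrC.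
have cst : clamp s <= clamp t.
  by rewrite /clamp ge_max !le_max lexx /= le_min !ge_min lexx st !orbT.
rewrite ler0_norm ?ler0_norm ?subr_le0// !opprB.
rewrite /clamp /Num.max /Num.min; do ![case: ifPn]; rewrite -?leNgt; lra.
Qed.

Definition picard_map u t : V :=
  S (clamp t) g + duhamel S (fun r => B (u r) + f r) (clamp t).

(** The invariant of the iteration. Both bounds carry the exponential weight and have constants
    independent of the iterate, so they pass to the limit. *)
Record picard_class u : Prop := PicardClass {
  picard_clamp : forall t, u t = u (clamp t) ;
  picard_norm : forall t, 0 <= t <= T -> `|u t| <= sup_const * expR (lam * t) ;
  picard_lip : forall t h, 0 <= t -> 0 <= h -> t + h <= T ->
    `|u (t + h) - u t| <= lip_const * h * expR (lam * t) }.

Let C1_ge0 : 0 <= lip_const.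
Proof.
rewrite /lip_const; solve_ge0.
Qed.

Let expR_le_T t : t <= T -> expR (lam * t) <= expR (lam * T).
Proof. by move=> tT; rewrite ler_expR ler_pM2l. Qed.

Lemma picard_class_lipschitz u : picard_class u ->
  exists C, forall s t, `|u s - u t| <= C * `|s - t|.
Proof.
move=> [uc _ ul]; exists (lip_const * expR (lam * T)) => s t.
rewrite (uc s) (uc t) (@le_trans _ _ (lip_const * expR (lam * T) * `|clamp s - clamp t|))//; last first.
  by rewrite ler_wpM2l ?clamp_contract// mulr_ge0// expR_ge0.
move: (clamp s) (clampP s) (clamp t) (clampP t) => {}s sT {}t tT.
wlog st : s t sT tT / s <= t.
  by move=> H; have [/H|/ltW /H] := leP s t; [apply|rewrite distrC [X in _ <= _ * X]distrC; apply].
have ts0 : 0 <= t - s by rewrite subr_ge0.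
have /andP[s0 _] := sT; have /andP[_ tT'] := tT.
have := ul s (t - s) s0 ts0; rewrite addrC subrK => /(_ tT').
rewrite distrC (distrC s) (ger0_norm ts0) => /le_trans; apply.
by rewrite mulrAC ler_wpM2r// ler_wpM2l// expR_le_T// (le_trans st).
Qed.

Lemma picard_forcing_continuous u : picard_class u -> continuous (fun r => B (u r) + f r).
Proof.
move=> /picard_class_lipschitz[C HC].
apply: (@lipschitz_fun_continuous _ _ _ _ (b * C + L)) => x y.
rewrite (_ : _ - _ = B (u x - u y) + (f x - f y)); last by rewrite BB; lmodule.
rewrite (le_trans (ler_normD _ _))// mulrDl lerD// (le_trans (HB _))//.
by rewrite -mulrA ler_wpM2l// ltW.
Qed.

Lemma has_der_exp (a l c t : R) :
  has_der (fun r => a * expR (l * r) + c * r) t (a * l * expR (l * t) + c).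
Proof.
apply/has_derP; apply: is_derive_eq.
rewrite -[LHS]/(a * (expR (l * t) * (l * 1)) + c * 1); ring.
Qed.

(** For the Lipschitz bound, the increment from [t] to [t + h] is split into three parts: [S t]
    applied to [S h g - g], the Duhamel integrand over an initial interval of length [h], and the
    Duhamel integral of the increment of the forcing. Only the last involves the Lipschitz bound of
    [u], and it uses up half of the constant. *)
Lemma picard_map_class u : picard_class u -> picard_class (picard_map u).
Proof.
move=> Pu; have ck := picard_forcing_continuous Pu.
have lamE : M * (b * sup_const / lam) = sup_const / 2.
  by rewrite /growth_rate; field; rewrite !gt_eqF.
have kle r : 0 <= r <= T -> `|B (u r) + f r| <= b * sup_const * expR (lam * r) + Kf.
  move=> rT; rewrite (le_trans (ler_normD _ _))// lerD// (le_trans (HB _))//.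
  by rewrite -mulrA ler_wpM2l ?(ltW b_gt0)// picard_norm.
split=> [t|t /[dup] tT0 /andP[t0 tT]|t h t0 h0 thT].
- by rewrite /picard_map [clamp (clamp t)]clamp_id// clampP.
- rewrite /picard_map clamp_id//.
  have := @duhamel_norm_le _ _ S S_semigroup _ T M (fun r => b * sup_const / lam * expR (lam * r) + Kf * r)
    (fun r => b * sup_const * expR (lam * r) + Kf) t HM (ltW M_gt0) ck tT0.
  have Hd r : 0 <= r <= t -> has_der (fun r : R => b * sup_const / lam * expR (lam * r) + Kf * r) r
      (b * sup_const * expR (lam * r) + Kf).
    by move=> _; have := has_der_exp (b * sup_const / lam) lam Kf r; rewrite divfK// gt_eqF.
  move=> /(_ Hd) H.
  rewrite (le_trans (ler_normD _ _))// (le_trans (lerD (HM _ tT0) (H _)))//.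
    by move=> r /andP[r0 rt]; apply: kle; rewrite r0 (le_trans rt).
  rewrite !mulr0 expR0 mulr1 addr0.
  have e1 : 1 <= expR (lam * t) by rewrite -expR0 ler_expR mulr_ge0// ltW.
  have Kt : M * Kf * t <= M * Kf * T by rewrite ler_wpM2l// mulr_ge0// ltW.
  set q := b * _ / _ in lamE *.
  have -> : M * (q * expR (lam * t) + Kf * t - q) =
      M * q * expR (lam * t) + M * Kf * t - M * q by ring.
  rewrite lamE; have : 0 <= sup_const * expR (lam * t) by rewrite mulr_ge0// expR_ge0.
  move: Kt; rewrite {3}/sup_const; lra.
rewrite /picard_map !clamp_id ?thT ?addr_ge0 ?t0//; last first.
  by rewrite (le_trans _ thT)// lerDl.
have tT : t <= T by rewrite (le_trans _ thT)// lerDl.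
have hT : h <= T by rewrite (le_trans _ thT)// lerDr.
set k := fun r => _ in ck *.
have -> : duhamel S k (t + h) = vint (fun r => E (t + h - r) (k r)) 0 h + duhamel S (fun r => k (r + h)) t.
  by rewrite /duhamel (vint_cat _ _ h) (duhamel_tail S_semigroup).
rewrite (semigroupD S_semigroup)//.
rewrite (_ : _ - _ = S t (S h g - g) + vint (fun r => E (t + h - r) (k r)) 0 h +
   (duhamel S (fun r => k (r + h)) t - duhamel S k t)); last first.
  by rewrite (semigroupB S_semigroup)//; lmodule.
have ckh := continuous_translate (c := h) ck.
rewrite (duhamelB S_semigroup)//.
have b1 : `|S t (S h g - g)| <= M * (cg * h).
  by rewrite (le_trans (HM _ _)) ?t0// ler_wpM2l ?(ltW M_gt0)// g_orbit// h0.
have b2 : `|vint (fun r => E (t + h - r) (k r)) 0 h| <=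
    M * (b * sup_const * expR (lam * T) + Kf) * h.
  have := @vint_dist_le _ _ (fun r => E (t + h - r) (k r)) 0 h 0
    (M * (b * sup_const * expR (lam * T) + Kf)).
  rewrite scaler0 !subr0; apply; first exact: duhamel_integrand_continuous.
    by rewrite lexx.
  move=> r /andP[r0 rh]; have trh : 0 <= t + h - r by rewrite subr_ge0 (le_trans rh)// lerDr.
  have rT := le_trans rh hT.
  rewrite subr0 /semigroup_ext (ger0_norm trh) (le_trans (HM _ _)) ?trh ?ler_wpM2l ?(ltW M_gt0)//.
    by rewrite (le_trans _ thT)// gerBl.
  rewrite (le_trans (kle _ _)) ?r0// lerD2r ler_wpM2l ?expR_le_T// mulr_ge0// (ltW b_gt0)//.
have b3 : `|duhamel S (fun r => k (r + h) - k r) t| <=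
    M * ((b * lip_const * h / lam * expR (lam * t) + L * h * t) - (b * lip_const * h / lam * expR (lam * 0) + L * h * 0)).
  apply: (@duhamel_norm_le _ _ S S_semigroup _ T M (fun r => b * lip_const * h / lam * expR (lam * r) + L * h * r)
    (fun r => b * lip_const * h * expR (lam * r) + L * h)) => //.
  - exact: ltW.
  - by move=> r; apply: cvgB; [exact: ckh|exact: ck].
  - by rewrite t0.
  - by move=> r _; have := has_der_exp (b * lip_const * h / lam) lam (L * h) r; rewrite divfK// gt_eqF.
  move=> r /andP[r0 rt]; rewrite (_ : _ - _ = B (u (r + h) - u r) + (f (r + h) - f r)); last first.
    by rewrite BB /k; lmodule.
  rewrite (le_trans (ler_normD _ _))// lerD//; last first.
    by rewrite (le_trans (f_lipschitz _ _))// addrAC subrr add0r ger0_norm.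
  rewrite (le_trans (HB _))// (_ : b * _ * _ * _ = b * (lip_const * h * expR (lam * r))); last by ring.
  rewrite ler_wpM2l ?(ltW b_gt0)// picard_lip//.
  by rewrite (le_trans _ thT)// lerD2r.
rewrite (le_trans (ler_normD _ _))// (le_trans (lerD (le_trans (ler_normD _ _) (lerD b1 b2)) b3))//.
rewrite !mulr0 expR0 mulr1 addr0.
have lamE1 : M * (b * lip_const * h / lam) = lip_const * h / 2.
  by rewrite /growth_rate; field; rewrite !gt_eqF.
set q := b * _ * _ / _ in lamE1 *.
have -> : M * (q * expR (lam * t) + L * h * t - q) =
    M * q * expR (lam * t) + M * L * h * t - M * q by ring.
rewrite lamE1; have : 0 <= lip_const * h * expR (lam * t) by solve_ge0.
have : M * L * h * t <= M * L * h * T by rewrite ler_wpM2l// !mulr_ge0// ltW.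
have : lip_const * h = 2 * (M * (cg * h) + M * L * h * T + M * (b * sup_const * expR (lam * T) + Kf) * h).
  by rewrite /lip_const; ring.
lra.
Qed.

Lemma picard_map_contraction u v c : picard_class u -> picard_class v -> 0 <= c ->
  (forall t, 0 <= t <= T -> `|u t - v t| <= c * expR (lam * t)) ->
  forall t, 0 <= t <= T -> `|picard_map u t - picard_map v t| <= c / 2 * expR (lam * t).
Proof.
move=> Pu Pv c0 uv t /[dup] tT /andP[t0 tT'].
have cu := picard_forcing_continuous Pu; have cv := picard_forcing_continuous Pv.
rewrite /picard_map clamp_id// opprD addrACA subrr add0r (duhamelB S_semigroup)//.
have lamE : M * (b * c / lam) = c / 2.
  by rewrite /growth_rate; field; rewrite !gt_eqF.
apply: (@le_trans _ _ (M * (b * c / lam * expR (lam * t) - b * c / lam * expR (lam * 0)))); last first.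
  rewrite mulr0 expR0 mulr1; set q := b * c / lam in lamE *.
  rewrite mulrBr mulrA lamE gerBl divr_ge0//.
apply: (@duhamel_norm_le _ _ S S_semigroup _ T M (fun r => b * c / lam * expR (lam * r))
    (fun r => b * c * expR (lam * r))) => //.
- exact: ltW.
- by move=> r; apply: cvgB; [exact: cu|exact: cv].
- move=> r _; have := has_der_exp (b * c / lam) lam 0 r.
  rewrite divfK ?gt_eqF// addr0.
  by under eq_fun do rewrite mul0r addr0.
move=> r /andP[r0 rt]; rewrite (_ : _ - _ = B (u r - v r)); last by rewrite BB; lmodule.
rewrite (le_trans (HB _))// -mulrA ler_wpM2l ?(ltW b_gt0)// uv//.
by rewrite r0 (le_trans rt).
Qed.

Definition picard_iter n := iter n picard_map (fun=> 0).

Lemma picard_iter_class n : picard_class (picard_iter n).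
Proof.
elim: n => [|n IHn]; last exact: picard_map_class.
split=> //= t; first by rewrite normr0 mulr_ge0// expR_ge0.
by move=> h t0 h0 _; rewrite subrr normr0 mulr_ge0 ?expR_ge0// mulr_ge0.
Qed.

Lemma picard_iter_increment n t : 0 <= t <= T ->
  `|picard_iter n.+1 t - picard_iter n t| <= sup_const / 2 ^+ n * expR (lam * t).
Proof.
elim: n t => [|n IHn] t tT.
  by rewrite expr0 divr1 /picard_iter [iter 0 _ _]/= subr0; apply: (picard_norm (picard_iter_class 1)).
have := picard_map_contraction (picard_iter_class n.+1) (picard_iter_class n) _ IHn tT.
by rewrite divr_ge0// exprSr invfM mulrA; apply.
Qed.

Lemma picard_iter_dist n m t : 0 <= t <= T ->
  `|picard_iter (n + m) t - picard_iter n t| <= 2 * sup_const / 2 ^+ n * expR (lam * t).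
Proof.
(* The partial geometric sum [2 - 2 / 2 ^+ m] is what the induction on [m] can carry; the stated
   bound is its limit. *)
move=> tT; apply: (@le_trans _ _ ((2 - 2 / 2 ^+ m) * sup_const / 2 ^+ n * expR (lam * t))); last first.
  rewrite -!mulrA; apply: ler_wpM2r; first solve_ge0.
  by rewrite gerBl; solve_ge0.
elim: m => [|m IHm].
  by rewrite addn0 subrr normr0 expr0 divr1 subrr !mul0r.
rewrite addnS -(subrK (picard_iter (n + m) t) (picard_iter _.+1 t)) -addrA.
rewrite (le_trans (ler_normD _ _))// (le_trans (lerD (picard_iter_increment _ tT) IHm))//.
rewrite le_eqVlt; apply/orP; left; apply/eqP.
rewrite exprD exprS; field; by rewrite !expf_neq0.
Qed.

Lemma mild_solution_exists : exists2 u, picard_class u &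
  forall t, 0 <= t <= T -> u t = S t g + duhamel S (fun r => B (u r) + f r) t.
Proof.
have pow0 (c : R) : 0 <= c -> forall e, 0 < e -> exists N, forall n, (N <= n)%N -> c / 2 ^+ n <= e.
  move=> c0 e e0; exists (Num.truncn (c / e)) => n Nn.
  rewrite ler_pdivrMr ?exprn_gt0// mulrC -ler_pdivrMr// ltW//.
  rewrite (lt_le_trans (truncnS_gt _))// -natrX ler_nat.
  by rewrite (leq_trans _ (ltn_expl n (ltnSn 1)))// ltnS.
set C := 2 * sup_const * expR (lam * T).
have C0 : 0 <= C by rewrite /C; solve_ge0.
have cvgT t : exists l : V, picard_iter n (clamp t) @[n --> \oo] --> l.
  apply: cauchy_seq_cvg => e e0.
  have e20 : 0 < e / 2 by rewrite divr_gt0.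
  have [N HN] := pow0 C C0 _ e20; exists N => n m Nn Nm.
  have NC p : (N <= p)%N -> `|picard_iter p (clamp t) - picard_iter N (clamp t)| <= e / 2.
    move=> Np; have := picard_iter_dist N (p - N) (clampP t); rewrite subnKC//.
    move=> /le_trans; apply; apply: le_trans (HN _ (leqnn N)).
    rewrite /C [X in _ <= X]mulrAC ler_wpM2l//; first solve_ge0.
    by rewrite expR_le_T//; case/andP: (clampP t).
  rewrite -(subrK (picard_iter N (clamp t)) (picard_iter n _)) -addrA [e]splitr.
  by rewrite (le_trans (ler_normD _ _))// lerD ?NC// distrC NC.
have [u Hu] := choice cvgT.
have u_dist n t : 0 <= t <= T -> `|u t - picard_iter n t| <= 2 * sup_const / 2 ^+ n * expR (lam * t).
  move=> tT; have := Hu t; rewrite clamp_id// => /ler_norm_lim; apply.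
  by exists n => // m /= nm; have := picard_iter_dist n (m - n) tT; rewrite subnKC.
have Pu : picard_class u.
  split=> [t|t tT|t h t0 h0 thT].
  - have := Hu (clamp t); rewrite [clamp (clamp t)]clamp_id ?clampP// => H.
    exact: (cvg_unique _ (Hu t) H).
  - have := Hu t; rewrite clamp_id// => H; rewrite -[u t]subr0.
    apply: (ler_norm_lim H); near=> n; rewrite subr0.
    exact: (picard_norm (picard_iter_class n)).
  - have := Hu t; have := Hu (t + h); rewrite !clamp_id ?addr_ge0 ?thT ?t0//; last first.
      by rewrite (le_trans _ thT)// lerDl.
    move=> H1 H2; rewrite -[_ - _]subr0; apply: (ler_norm_lim (cvgB H1 H2)); near=> n; rewrite subr0.
    exact: (picard_lip (picard_iter_class n)).
exists u => // t tT; apply/eqP; rewrite -subr_eq0 -normr_le0.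
apply/ler_addgt0Pr => e e0; rewrite add0r.
have -> : S t g + duhamel S (fun r => B (u r) + f r) t = picard_map u t.
  by rewrite /picard_map clamp_id.
have [N HN] := pow0 (2 * C) (mulr_ge0 (ler0n _ 2) C0) _ e0.
have cN : 0 <= 2 * sup_const / 2 ^+ N by solve_ge0.
have H1 := picard_map_contraction (picard_iter_class N) Pu cN _ tT.
have {}H1 : `|picard_iter N.+1 t - picard_map u t| <= 2 * sup_const / 2 ^+ N / 2 * expR (lam * t).
  by apply: H1 => s sT; rewrite distrC; exact: u_dist.
have H2 := u_dist N.+1 t tT.
rewrite -(subrK (picard_iter N.+1 t) (u t)) -addrA (le_trans (ler_normD _ _))//.
rewrite (le_trans (lerD H2 H1))// (le_trans _ (HN _ (leqnn N)))//.
rewrite exprS invfM /C.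
have : expR (lam * t) <= expR (lam * T) by rewrite expR_le_T//; case/andP: tT.
have : 0 < (2 ^+ N : R)^-1 by rewrite invr_gt0 exprn_gt0.
set p := (2 ^+ N)^-1 => p0 ee.
have -> : 2 * sup_const * (2^-1 * p) * expR (lam * t) + 2 * sup_const * p / 2 * expR (lam * t) =
  2 * sup_const * p * expR (lam * t) by field.
have -> : 2 * (2 * sup_const * expR (lam * T)) * p = 2 * sup_const * p * expR (lam * T) + 2 * sup_const * p * expR (lam * T) by ring.
rewrite ler_wpDr ?ler_wpM2l//; solve_ge0.
Unshelve. all: by end_near. Qed.

(** The bound on [|u t|] depends on the data only through [|g|] and [Kf]. The constants [L] and [cg]
    are confined to the Lipschitz constant [C], of which no explicit value is kept. *)
Theorem mild_solution : exists u, [/\ exists2 C, 0 <= C & forall s t, `|u s - u t| <= C * `|s - t|,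
  forall t, 0 <= t <= T -> `|u t| <= 2 * M * (`|g| + T * Kf) * expR (2 * M * b * T) &
  forall t, 0 <= t <= T -> u t = S t g + duhamel S (fun r => B (u r) + f r) t].
Proof.
have [u Pu Hu] := mild_solution_exists; have [C HC] := picard_class_lipschitz Pu.
exists u; split=> // [|t tT].
  exists `|C| => // s t; rewrite (le_trans (HC _ _))// ler_wpM2r//; exact: ler_norm.
rewrite (le_trans (picard_norm Pu tT))// ler_wpM2l// expR_le_T//.
by case/andP: tT.
Qed.

End picard.

(** * Classical solutions in Hilbert spaces *)

Section nested_convex.
Context (R : realType) (V : completeNormedModType R).
Hypothesis parallelogram : forall x y : V,
  `|x + y| ^+ 2 + `|x - y| ^+ 2 = 2 * (`|x| ^+ 2 + `|y| ^+ 2).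

(* Almost minimal-norm elements form a Cauchy sequence by the parallelogram
   law: this replaces weak compactness of bounded sets. *)
Lemma nested_convex_cvg (C : nat -> set V) (Q : R) :
  (forall n x y, C n x -> C n y -> C n (2^-1 *: (x + y))) ->
  (forall n m, (n <= m)%N -> C m `<=` C n) ->
  (forall n, C n !=set0) -> (forall n x, C n x -> `|x| <= Q) ->
  exists (y : nat -> V) (l : V), (forall n, C n (y n)) /\ y n @[n --> \oo] --> l.
Proof.
move=> Cmid Cdec Cne CQ.
pose N2 n := [set `|x| ^+ 2 | x in C n].
have N2ne n : N2 n !=set0 by have [x Cx] := Cne n; exists (`|x| ^+ 2), x.
have N2lb n : has_lbound (N2 n) by exists 0 => _ [x _ <-]; rewrite exprn_ge0.
have hinf n : has_inf (N2 n) by split.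
pose d n := inf (N2 n).
have dle n x : C n x -> d n <= `|x| ^+ 2 by move=> Cx; apply: ge_inf => //; exists x.
have dQ n : d n <= Q ^+ 2.
  have [x Cx] := Cne n; rewrite (le_trans (dle _ _ Cx))// ler_pXn2r ?nnegrE ?(CQ n)//.
  exact: le_trans (normr_ge0 x) (CQ _ _ Cx).
have dmono n m : (n <= m)%N -> d n <= d m.
  move=> nm; apply: lb_le_inf => // _ [x Cx <-]; apply: dle.
  exact: Cdec nm _ Cx.
have /choice[y Hy] n : exists y, C n y /\ `|y| ^+ 2 <= d n + n.+1%:R^-1.
  have e0 : 0 < (n.+1%:R : R)^-1 by rewrite invr_gt0.
  have [_ [x Cx <-] /ltW xd] := inf_adherent e0 (hinf n).
  by exists x.
have hsd : has_sup (range d).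
  by split; [exists (d 0%N), 0%N|exists (Q ^+ 2) => _ [n _ <-]].
(* The midpoint of [y n] and [y m] lies in [C n], so its squared norm is at least [d n]; the
   parallelogram law turns this into a bound on the distance. *)
have close n m : (n <= m)%N -> `|y n - y m| ^+ 2 <= 2 * (d m - d n) + 2 * n.+1%:R^-1 + 2 * m.+1%:R^-1.
  move=> nm; have [Cn yn] := Hy n; have [Cm ym] := Hy m.
  have := dle n _ (Cmid _ _ _ Cn (Cdec _ _ nm _ Cm)).
  rewrite normrZ gtr0_norm ?invr_gt0// exprMn.
  have -> : (2^-1 : R) ^+ 2 = 4^-1 by field.
  have := parallelogram (y n) (y m).
  move: yn ym; move: (n.+1%:R^-1) (m.+1%:R^-1) => a b; lra.
have [l yl] : exists l : V, y n @[n --> \oo] --> l.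
  apply: cauchy_seq_cvg => e e0.
  (* Each of the three terms of [close] is at most [2 * e1]. *)
  pose e1 := e ^+ 2 / 6; have e10 : 0 < e1 by rewrite divr_gt0// exprn_gt0.
  have [_ [N _ <-] HN] := sup_adherent e10 hsd.
  have small n : (N <= n)%N -> (Num.truncn e1^-1 <= n)%N -> d n <= sup (range d) /\ sup (range d) - e1 < d n /\ n.+1%:R^-1 <= e1.
    move=> Nn tn; split; first by apply: (ub_le_sup (proj2 hsd)); exists n.
    split; first exact: lt_le_trans HN (dmono _ _ Nn).
    rewrite -[e1]invrK lef_pV2 ?posrE ?invr_gt0// ltW//.
    by rewrite (lt_le_trans (truncnS_gt _))// ler_nat.
  have main n m : (n <= m)%N -> (N <= n)%N -> (Num.truncn e1^-1 <= n)%N -> `|y n - y m| <= e.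
    move=> nm Nn tn; have [an [bn cn]] := small n Nn tn.
    have [am [bm cm]] := small m (leq_trans Nn nm) (leq_trans tn nm).
    rewrite -(@ler_pXn2r _ 2) ?nnegrE ?(ltW e0)// (le_trans (close _ _ nm))//.
    have : e ^+ 2 = 6 * e1 by rewrite /e1; field.
    move: cn cm; move: (n.+1%:R^-1) (m.+1%:R^-1) => a b; lra.
  exists (maxn N (Num.truncn e1^-1)) => n m; rewrite !geq_max => /andP[a1 a2] /andP[b1 b2].
  by have [nm|/ltnW mn] := leqP n m; [|rewrite distrC]; apply: main.
by exists y, l; split=> // n; case: (Hy n).
Qed.

End nested_convex.

(** * Generators: domain, time averages and Lipschitz orbits *)

Section generator.
Context (R : realType) (V : completeNormedModType R) (S : R -> V -> V) (A : linop V).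
Hypotheses (S_semigroup : C0_semigroup S) (A_generates : generates A S).
Local Notation E := (semigroup_ext S).
Implicit Types (s t r h : R) (v x : V).

Lemma generator_right_der x e : dom A x -> 0 < e ->
  \forall h \near (0:R)^'+, `|S h x - x - h *: A x| <= e * h.
Proof.
move=> Ax e0; have /A_generates : dom A x /\ A x = A x by [].
move=> /cvgrPdist_le /(_ _ e0); apply: filter_app; near=> h.
have h0 : 0 < h by near: h; exact: nbhs_right_gt.
rewrite -(ler_pM2l h0) -{1}(gtr0_norm h0) -normrZ scalerBr scalerA divff ?gt_eqF// scale1r.
by rewrite distrC mulrC.
Unshelve. all: by end_near. Qed.

Lemma generator_of_right_der x y :
  (forall e, 0 < e -> \forall h \near (0:R)^'+, `|S h x - x - h *: y| <= e * h) ->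
  dom A x /\ y = A x.
Proof.
move=> H; apply/A_generates/cvgrPdist_le => e e0.
have := H _ e0; apply: filter_app; near=> h.
have h0 : 0 < h by near: h; exact: nbhs_right_gt.
rewrite -(ler_pM2l h0 _ e) -[X in _ -> X * _ <= _](gtr0_norm h0) -normrZ scalerBr scalerA divff ?gt_eqF// scale1r.
by rewrite distrC mulrC.
Unshelve. all: by end_near. Qed.

(** Applying [S r] to a time average moves the interval of integration by [r]. The difference
    quotient thus involves only two short end pieces, near [h] and near 0, whose means tend to
    [S h v] and [v]. *)
Lemma semigroup_mean_generator v h : 0 < h ->
  let z := h^-1 *: vint (fun s => E s v) 0 h in
  dom A z /\ h^-1 *: (S h v - v) = A z.
Proof.
move=> h0 z; apply: generator_of_right_der => e e0.
have cE : continuous (fun s => E s v) by exact: semigroup_ext_continuous.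
pose e1 := e * h / 2; have e10 : 0 < e1 by rewrite divr_gt0// mulr_gt0.
have h_ge0 := ltW h0.
have := has_der_right (primitiveP cE (lexx 0)) e10.
have := has_der_right (primitiveP cE h_ge0) e10.
apply: filter_app2; near=> r; rewrite add0r.
have r0 : 0 < r by near: r; exact: nbhs_right_gt.
have r_ge0 := ltW r0.
have -> : E 0 v = v by rewrite /semigroup_ext normr0 semigroup_at0.
have -> : E h v = S h v by rewrite /semigroup_ext ger0_norm.
set P := primitive _ => H1 H2.
have -> : S r z = h^-1 *: vint (fun s => E s v) r (h + r).
  rewrite /z semigroupZ//; congr (_ *: _).
  have [C C0 HC] := semigroup_op_bounded S_semigroup r_ge0.
  have cEr : continuous (fun s => E (s + r) v) by exact: (@continuous_translate _ _ (E^~ v) r cE).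
  rewrite (@vint_linear _ _ _ C _ (fun s => E (s + r) v) 0 h (semigroup_linear S_semigroup r_ge0))//.
  - by rewrite -[X in _ = vint _ X _](add0r r) (@vint_shift _ _ _ (fun s => E (s + r) v))// lexx.
  - by rewrite lexx.
  - move=> s /andP[s0 _]; rewrite /semigroup_ext !ger0_norm ?addr_ge0// addrC.
    by rewrite semigroupD.
rewrite /z /vint -/P.
rewrite (_ : _ - _ = h^-1 *: ((P (h + r) - P h - r *: S h v) - (P r - P 0 - r *: v))); last by lmodule.
rewrite normrZ ger0_norm ?invr_ge0// ler_pdivrMl//.
by rewrite (le_trans (ler_normB _ _))// (le_trans (lerD H1 H2))// /e1; lra.
Unshelve. all: by end_near. Qed.

Hypothesis parallelogram : forall x y : V,
  `|x + y| ^+ 2 + `|x - y| ^+ 2 = 2 * (`|x| ^+ 2 + `|y| ^+ 2).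
Hypothesis A_closed : closed_op A.

(** The set [C n] collects the values [A z] of norm at most [Q] with [z] within [1 / (n + 1)] of
    [v]. It is stable under midpoints by linearity, and nonempty since [A] maps a time average of
    the orbit to a difference quotient. A norm-convergent choice [y n = A (z n)] with [z n] tending
    to [v] then puts [v] in the domain, because the graph is closed. *)
Lemma favard_class_dom v (Q d : R) : 0 < d ->
  (forall h, 0 < h <= d -> `|S h v - v| <= Q * h) -> dom A v.
Proof.
move=> d0 HQ.
pose C n := [set y | `|y| <= Q /\ exists z, [/\ dom A z, A z = y & `|z - v| <= n.+1%:R^-1]].
have [|n m nm y [yQ [z [Az zy zv]]]|n|n x [//]|y [l [Cy yl]]] := @nested_convex_cvg _ _ parallelogram C Q.
- move=> n x y [xQ [zx [domx Ax zxv]]] [yQ [zy [domy Ay zyv]]]; split.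
    rewrite normrZ gtr0_norm ?invr_gt0// ler_pdivrMl// (le_trans (ler_normD _ _))//; lra.
  have AD : dom A (zx + zy) by rewrite -[zx]scale1r; exact: domP.
  have AD' : dom A (2^-1 *: (zx + zy)) by rewrite -[2^-1 *: _]addr0; apply: domP => //; exact: dom0.
  have A0 : A 0 = 0.
    have := @opP _ _ A 1 0 0 (dom0 A) (dom0 A); rewrite !scale1r addr0 => /eqP.
    by rewrite -subr_eq0 opprD addrA subrr sub0r oppr_eq0 => /eqP.
  exists (2^-1 *: (zx + zy)); split=> //.
    rewrite -[2^-1 *: (zx + zy)]addr0 opP//; last exact: dom0.
    by rewrite A0 addr0 -[zx]scale1r opP// scale1r Ax Ay.
  rewrite (_ : _ - _ = 2^-1 *: ((zx - v) + (zy - v))); last first.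
    rewrite -[v in LHS](_ : 2^-1 *: (2 *: v) = v); first by lmodule.
    by rewrite scalerA mulVf ?scale1r.
  rewrite normrZ gtr0_norm ?invr_gt0// ler_pdivrMl// (le_trans (ler_normD _ _))//.
  by rewrite mulr_natl mulr2n lerD.
- split=> //; exists z; split=> //; rewrite (le_trans zv)// lef_pV2 ?posrE// ler_nat ltnS//.
- have cE : {for 0, continuous (fun s => E s v)} by exact: semigroup_ext_continuous.
  have e0 : 0 < (n.+1%:R : R)^-1 by rewrite invr_gt0.
  have /cvgrPdist_le /(_ _ e0) /nbhs_ballP [/= d' d'0 Hd'] := cE.
  pose h := Num.min d (d' / 2).
  have h0 : 0 < h by rewrite lt_min d0 divr_gt0.
  exists (h^-1 *: (S h v - v)); split.
    rewrite normrZ gtr0_norm ?invr_gt0// ler_pdivrMl// mulrC HQ// h0 ge_min lexx//.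
  have [domz Az] := semigroup_mean_generator v h0.
  exists (h^-1 *: vint (fun s => E s v) 0 h); split=> //.
  have := @vint_dist_le _ _ (fun s => E s v) 0 h v n.+1%:R^-1.
  rewrite subr0 => H; rewrite -(ler_pM2r h0) mulrC -{1}(gtr0_norm h0) -normrZ.
  rewrite scalerBr scalerA divff ?gt_eqF// scale1r.
  apply: H; [exact: semigroup_ext_continuous|by rewrite lexx ltW|].
  move=> r /andP[r0 rh]; rewrite distrC -[X in `|X - _|](semigroup_at0 S_semigroup).
  rewrite -[X in S X](normr0 R) Hd'// -ball_normE /= sub0r normrN ger0_norm//.
  rewrite (le_lt_trans rh)// gt_min ltr_pdivrMr// ltr_pMr// ltr1n orbT//.
have /choice[z Hz] n : exists z, [/\ dom A z, A z = y n & `|z - v| <= n.+1%:R^-1].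
  by have [_] := Cy n.
have zv : z n @[n --> \oo] --> v.
  apply/cvgrPdist_le => e e0; near=> n; have [_ _] := Hz n.
  rewrite distrC => /le_trans; apply; near: n.
  exists (Num.truncn e^-1) => // n /= tn.
  rewrite -[e]invrK lef_pV2 ?posrE ?invr_gt0// ltW//.
  by rewrite (lt_le_trans (truncnS_gt _))// ler_nat.
have /= := @closed_cvg _ _ _ _ (fun n => (z n, y n)) _ A_closed _ (v, l).
move=> /(_ \oo _)[]//.
  by near=> n; have [? ? _] := Hz n.
exact: (cvg_pair zv yl).
Unshelve. all: by end_near. Qed.

End generator.

(** * From mild to continuously differentiable solutions *)

Section classical_solution.
Context (R : realType) (V : completeNormedModType R) (S : R -> V -> V) (A : linop V).
Hypotheses (S_semigroup : C0_semigroup S) (A_generates : generates A S).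
Hypothesis parallelogram : forall x y : V,
  `|x + y| ^+ 2 + `|x - y| ^+ 2 = 2 * (`|x| ^+ 2 + `|y| ^+ 2).
Hypothesis A_closed : closed_op A.
Local Notation E := (semigroup_ext S).
Implicit Types (s t r h : R) (v x : V).
Variables (T M b L Kf : R) (B : V -> V) (f : R -> V) (g : V).
Hypotheses (T_gt0 : 0 < T) (M_ge1 : 1 <= M) (b_gt0 : 0 < b)
  (HM : forall t x, 0 <= t <= T + 1 -> `|S t x| <= M * `|x|)
  (B_linear : linear B) (HB : forall x, `|B x| <= b * `|x|)
  (f_bound : forall t, `|f t| <= Kf)
  (f_lipschitz : forall s t, `|f s - f t| <= L * `|s - t|)
  (domg : dom A g).

(** One extra unit of time, so that right increments of the solution are available at [T] itself. *)
Let T1 := T + 1.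
Let T1_ge0 : 0 <= T1. Proof. by rewrite addr_ge0// ltW. Qed.
Let M_ge0 : 0 <= M. Proof. exact: le_trans ler01 M_ge1. Qed.

Let BB x y : B (x - y) = B x - B y.
Proof. by rewrite addrC -scaleN1r B_linear scaleN1r addrC. Qed.

(** For [h < d] the right derivative at 0 gives the slope [|A g| + 1]; for [h >= d] the crude bound
    [(M + 1) * |g|] is divided by [d]. *)
Lemma dom_orbit_lipschitz : exists2 cg, 0 <= cg &
  forall h, 0 <= h <= T1 -> `|S h g - g| <= cg * h.
Proof.
have := generator_right_der A_generates domg ltr01.
rewrite near_withinE => -[/= d d0 Hd].
pose c := `|A g| + 1 + (M + 1) * `|g| / d.
have c0 : 0 <= (M + 1) * `|g| / d by rewrite divr_ge0 ?(ltW d0)// mulr_ge0// addr_ge0.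
exists c; first by rewrite !addr_ge0.
move=> h /andP[h0 hT]; have [dh|hd] := leP d h.
  rewrite (@le_trans _ _ ((M + 1) * `|g|))//.
    rewrite (le_trans (ler_normB _ _))// mulrDl mul1r lerD2r HM// h0//.
  rewrite (@le_trans _ _ ((M + 1) * `|g| / d * h))//.
    by rewrite mulrAC ler_pdivlMr// ler_wpM2l// mulr_ge0// addr_ge0.
  by rewrite ler_wpM2r// lerDr addr_ge0.
have [->|hn0] := eqVneq h 0; first by rewrite semigroup_at0// subrr normr0 mulr0.
have h_gt0 : 0 < h by rewrite lt_neqAle eq_sym hn0.
have := Hd h; rewrite /= sub0r normrN (ger0_norm h0) => /(_ hd h_gt0) H.
rewrite -(subrK (h *: A g) (S h g - g)) (le_trans (ler_normD _ _))// normrZ (ger0_norm h0).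
rewrite (le_trans (lerD H (lexx _)))// [h * _]mulrC -mulrDl ler_wpM2r// /c.
by rewrite [1 + _]addrC lerDl.
Qed.

Theorem inhomogeneous_classical_solution : exists u w : R -> V,
  [/\ u 0 = g,
      exists C, forall s t, `|u s - u t| <= C * `|s - t|,
      forall t, 0 <= t <= T -> [/\ dom A (u t), w t = A (u t) + (B (u t) + f t) &
        `|u t| <= 2 * M * (`|g| + T1 * Kf) * expR (2 * M * b * T1)],
      continuous w & forall t, 0 < t < T -> has_der u t (w t)].
Proof.
have [cg cg0 Hcg] := dom_orbit_lipschitz.
have [u [[Lu Lu0 Hul] Hun Hu]] := mild_solution S_semigroup T1_ge0 M_ge1 b_gt0 cg0 HM
  B_linear HB f_bound f_lipschitz Hcg.
pose k r := B (u r) + f r; pose Lk := b * Lu + L.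
have Lk0 : 0 <= Lk.
  rewrite addr_ge0 ?mulr_ge0 ?(ltW b_gt0)//.
  by have := le_trans (normr_ge0 _) (f_lipschitz 1 0); rewrite subr0 normr1 mulr1.
have kL s t : `|k s - k t| <= Lk * `|s - t|.
  rewrite (_ : k s - k t = B (u s - u t) + (f s - f t)); last by rewrite BB /k; lmodule.
  rewrite (le_trans (ler_normD _ _))// mulrDl lerD// (le_trans (HB _))//.
  by rewrite -mulrA ler_wpM2l// ltW.
have ck : continuous k := lipschitz_fun_continuous kL.
(* A mild solution restarted at time [t] is again mild, with translated forcing. *)
have restart t h : 0 <= t -> 0 <= h -> t + h <= T1 ->
    u (t + h) = S h (u t) + duhamel S (fun r => k (r + t)) h.
  move=> t0 h0 thT; have tT : t <= T1 by rewrite (le_trans _ thT)// lerDl.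
  rewrite !Hu ?addr_ge0 ?t0// (addrC t h) -/k duhamel_restart//.
  have -> : S h (S t g + duhamel S k t) = S h (S t g) + S h (duhamel S k t).
    by have := semigroup_linear S_semigroup h0 1 (S t g) (duhamel S k t); rewrite !scale1r.
  by rewrite (semigroupD S_semigroup)// addrA.
have T_ltT1 : T < T1 by rewrite /T1 ltrDl.
(* Over a short time, [u] departs from the free orbit of [u t] by [h *: k t] up to a small multiple
   of [h]. Together with a bound on increments of [u] this controls the free orbit, and together
   with the generator it gives the right derivative of [u]. *)
have drift t e : 0 <= t <= T -> 0 < e ->
    \forall h \near (0 : R)^'+, `|u (t + h) - S h (u t) - h *: k t| <= e * h.
  move=> /andP[t0 tT] e0.
  have e20 : 0 < e / 2 by rewrite divr_gt0.
  have c0 : 0 < M * Lk + 1 by rewrite ltr_wpDl// mulr_ge0.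
  have cE : {for 0, continuous (fun s => E s (k t))} by exact: semigroup_ext_continuous.
  have /cvgrPdist_le /(_ _ e20) /nbhs_ballP [/= d d0 Hd] := cE.
  near=> h.
  have h0 : 0 < h by near: h; exact: nbhs_right_gt.
  have hd : h < d by near: h; exact: nbhs_right_lt.
  have h1 : h < 1 by near: h; exact: nbhs_right_lt.
  have he : M * Lk * h <= e / 2.
    rewrite (@le_trans _ _ ((M * Lk + 1) * h))//; first by rewrite ler_wpM2r ?lerDl// ltW.
    rewrite mulrC -ler_pdivlMr//; apply: ltW; near: h; apply: nbhs_right_lt.
    by rewrite divr_gt0.
  rewrite restart ?(ltW h0)//; last by rewrite /T1 lerD// ltW.
  rewrite (addrC (S h _)) addrK.
  have := @vint_dist_le _ _ (fun r => E (h - r) (k (r + t))) 0 h (k t) e.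
  rewrite subr0; apply.
  - by apply: duhamel_integrand_continuous => //; exact: continuous_translate.
  - by rewrite lexx ltW.
  move=> r /andP[r0 rh]; have hr0 : 0 <= h - r by rewrite subr_ge0.
  have hrh : h - r <= h by rewrite gerBl.
  rewrite (_ : _ - _ = (E (h - r) (k (r + t)) - E (h - r) (k t)) + (E (h - r) (k t) - k t)); last by lmodule.
  rewrite (le_trans (ler_normD _ _))// [e]splitr lerD//.
    rewrite /semigroup_ext (ger0_norm hr0) -semigroupB//.
    rewrite (le_trans (HM _ _)) ?hr0 ?(le_trans hrh) ?(le_trans (ltW h1))//=.
      by rewrite lerDr ltW.
    rewrite (le_trans _ he)// -mulrA ler_wpM2l// (le_trans (kL _ _))//.
    by rewrite addrK ger0_norm// ler_wpM2l.
  rewrite distrC -[X in `|X - _|](semigroup_at0 S_semigroup).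
  rewrite -[X in S X](normr0 R) Hd// -ball_normE /= sub0r normrN ger0_norm//.
  exact: le_lt_trans hrh hd.
have domu t : 0 <= t <= T -> dom A (u t).
  move=> tT; have := drift t _ tT ltr01.
  rewrite near_withinE => -[/= d d0 Hd].
  have d20 : 0 < d / 2 by rewrite divr_gt0.
  (* The three summands bound the increment of [u], the error in [drift] taken with [e = 1], and the
     forcing term. *)
  apply: (favard_class_dom S_semigroup A_generates parallelogram A_closed (Q := Lu + 1 + `|k t|) d20).
  move=> h /andP[h0 hd].
  have := Hd h; rewrite /= sub0r normrN (gtr0_norm h0) => /(_ _ h0) H.
  have {}H : `|u (t + h) - S h (u t) - h *: k t| <= 1 * h.
    by apply: H; rewrite (le_lt_trans hd)// ltr_pdivrMr// ltr_pMr// ltr1n.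
  have H2 : `|u (t + h) - u t| <= Lu * h.
    by rewrite (le_trans (Hul _ _))// addrAC subrr add0r gtr0_norm.
  rewrite (_ : _ - _ = (u (t + h) - u t) - (u (t + h) - S h (u t) - h *: k t) - h *: k t); last by lmodule.
  rewrite (le_trans (ler_normB _ _))// !mulrDl.
  rewrite normrZ (gtr0_norm h0) [h * _]mulrC lerD2r.
  by rewrite (le_trans (ler_normB _ _))// lerD.
pose w t := A (u t) + k t.
have rder t e : 0 <= t <= T -> 0 < e ->
    \forall h \near (0 : R)^'+, `|u (t + h) - u t - h *: w t| <= e * h.
  move=> tT e0; have e20 : 0 < e / 2 by rewrite divr_gt0.
  have := drift t _ tT e20; have := generator_right_der A_generates (domu _ tT) e20.
  apply: filterS2 => h H1 H2.
  rewrite (_ : _ - _ - _ = (S h (u t) - u t - h *: A (u t)) + (u (t + h) - S h (u t) - h *: k t)); last first.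
    by rewrite /w; lmodule.
  by rewrite (le_trans (ler_normD _ _))// [e]splitr mulrDl lerD.
(* Write both [u (t + h)] and [u t] as restarts after a delay [t - s], from [s + h] and from [s].
   Their difference divided by [h] compares the right difference quotients at [t] and at [s], and
   the two forcings differ by at most [Lk * h]. *)
have wS s t : 0 <= s -> s <= t -> t <= T -> `|w t - S (t - s) (w s)| <= M * Lk * (t - s).
  move=> s0 st tT; have ts0 : 0 <= t - s by rewrite subr_ge0.
  have tsT1 : t - s <= T1 by rewrite (le_trans _ (ltW T_ltT1))// lerBlDr (le_trans tT)// lerDl.
  have sT := le_trans st tT; have t0 := le_trans s0 st.
  apply/ler_addgt0Pr => e e0.
  have e20 : 0 < e / 2 by rewrite divr_gt0.
  have e2M0 : 0 < e / 2 / M by rewrite divr_gt0// (lt_le_trans ltr01).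
  have tT' : 0 <= t <= T by rewrite t0.
  have sT' : 0 <= s <= T by rewrite s0.
  near (0 : R)^'+ => h.
  have h0 : 0 < h by near: h; exact: nbhs_right_gt.
  have h1 : h < 1 by near: h; exact: nbhs_right_lt.
  have Ht : `|u (t + h) - u t - h *: w t| <= e / 2 * h by near: h; exact: rder.
  have Hs : `|u (s + h) - u s - h *: w s| <= e / 2 / M * h by near: h; exact: rder.
  have thT1 : t + h <= T1 by rewrite /T1 lerD// ltW.
  have E1 : u (t + h) = S (t - s) (u (s + h)) + duhamel S (fun r => k (r + (s + h))) (t - s).
    have sht : s + h + (t - s) = t + h by ring.
    by rewrite -sht; apply: restart; rewrite ?sht// addr_ge0// ltW.
  have E2 : u t = S (t - s) (u s) + duhamel S (fun r => k (r + s)) (t - s).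
    have sts : s + (t - s) = t by ring.
    by rewrite -restart// sts// (le_trans tT)// ltW.
  have Hd : `|duhamel S (fun r => k (r + (s + h))) (t - s) - duhamel S (fun r => k (r + s)) (t - s)|
      <= M * (Lk * h * (t - s)).
    have ctr c : continuous (fun r => k (r + c)) by exact: continuous_translate.
    rewrite duhamelB// (le_trans (duhamel_norm_le S_semigroup (p := fun r => Lk * h * r) (p' := fun=> Lk * h)
      HM M_ge0 _ _ _ _))//.
    - by move=> r; apply: cvgB; exact: ctr.
    - by rewrite ts0.
    - by move=> r _; apply/has_derP; apply: is_derive_eq; rewrite [LHS]mulr1.
    - move=> r _; rewrite (le_trans (kL _ _))// ler_wpM2l//.
      by rewrite opprD addrACA subrr add0r addrAC subrr add0r gtr0_norm.
    - by rewrite mulr0 subr0.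
  rewrite -(ler_pM2l h0) -{1}(gtr0_norm h0) -normrZ.

  rewrite (_ : h *: _ = - (u (t + h) - u t - h *: w t) + (S (t - s) (u (s + h) - u s - h *: w s)) +
     (duhamel S (fun r => k (r + (s + h))) (t - s) - duhamel S (fun r => k (r + s)) (t - s))); last first.
    by rewrite !(semigroupB S_semigroup)// (semigroupZ S_semigroup)// [in RHS]E1 [in RHS]E2; lmodule.
  rewrite (le_trans (ler_normD _ _))// (le_trans (lerD (ler_normD _ _) Hd))// normrN.
  have HS : `|S (t - s) (u (s + h) - u s - h *: w s)| <= e / 2 * h.
    rewrite (le_trans (HM _ _)) ?ts0//.
    rewrite (le_trans (ler_wpM2l M_ge0 Hs))// mulrA [M * _]mulrC divfK// gt_eqF// (lt_le_trans ltr01)//.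
  rewrite (le_trans (lerD (lerD Ht HS) (lexx _)))// le_eqVlt; apply/orP; left; apply/eqP.
  by field.
pose C := M * Lk.
have C0 : 0 <= C by rewrite mulr_ge0.
have wcont t : 0 <= t <= T -> forall e, 0 < e -> exists2 d, 0 < d &
    forall s, 0 <= s <= T -> `|t - s| < d -> `|w t - w s| <= e.
  move=> /andP[t0 tT] e e0.
  (* The three errors below are [C * eta], [e / 2] and [C * (2 * eta)]; the factor 6 keeps the first
     and the third within [e / 2]. *)
  pose eta := e / (6 * (C + 1)).
  have C10 : 0 < C + 1 by rewrite ltr_wpDl.
  have eta0 : 0 < eta by rewrite divr_gt0// mulr_gt0.
  have etaE : 6 * (C * eta + eta) = e by rewrite /eta; field; rewrite gt_eqF.
  (* Since [wS] only compares a time with an earlier one, both [t] and [s] are compared with a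
     common earlier time [s0], the orbit of [w s0] being continuous. This makes the continuity
     two-sided. *)
  pose s0 := Num.max 0 (t - eta).
  have s00 : 0 <= s0 by rewrite le_max lexx.
  have s0t : s0 <= t by rewrite ge_max t0 /= gerBl ltW.
  have s0eta : t - eta <= s0 by rewrite le_max lexx orbT.
  have cE : {for t - s0, continuous (fun s => E s (w s0))} by exact: semigroup_ext_continuous.
  have e20 : 0 < e / 2 by rewrite divr_gt0.
  have /cvgrPdist_le /(_ _ e20) /nbhs_ballP [/= d d0 Hd] := cE.
  exists (Num.min d eta); first by rewrite lt_min d0.
  move=> s /andP[s_ge0 sT]; rewrite lt_min => /andP[tsd tse].
  have s0s : s0 <= s.
    by rewrite ge_max s_ge0 /= ltW//; move: tse; rewrite ltr_norml => /andP[_]; rewrite ltrBlDr addrC -ltrBlDr.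
  have H1 := wS _ _ s00 s0t tT.
  have H2 := wS _ _ s00 s0s sT.
  have H3 : `|S (t - s0) (w s0) - S (s - s0) (w s0)| <= e / 2.
    have := Hd (s - s0); rewrite /semigroup_ext !ger0_norm ?subr_ge0//; apply.
    by rewrite -ball_normE /= opprB addrA subrK.
  have {}H1 : `|w t - S (t - s0) (w s0)| <= C * eta.
    by rewrite (le_trans H1)// ler_wpM2l// lerBlDr addrC -lerBlDr.
  have {}H2 : `|w s - S (s - s0) (w s0)| <= C * (2 * eta).
    rewrite (le_trans H2)// ler_wpM2l//.
    by move: tse; rewrite ltr_norml => /andP[? _]; lra.
  rewrite (_ : _ - _ = (w t - S (t - s0) (w s0)) + (S (t - s0) (w s0) - S (s - s0) (w s0)) - (w s - S (s - s0) (w s0))); last by lmodule.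
  rewrite (le_trans (ler_normB _ _))// (le_trans (lerD (ler_normD _ _) H2))//.
  rewrite (le_trans (lerD (lerD H1 H3) (lexx _)))//.
  have : 0 <= C * eta by rewrite mulr_ge0// ltW.
  lra.
(* Extended by its end values, [w] is continuous on the whole line and has a primitive. *)
pose wc t := w (clamp T t).
have T_ge0 := ltW T_gt0.
have cwc : continuous wc.
  move=> t; apply/cvgrPdist_le => e e0.
  have [d d0 Hd] := wcont _ (clampP T_ge0 t) _ e0.
  have := near_dist_lt t d0; apply: filterS => s st; apply: Hd; first exact: clampP.
  exact: le_lt_trans (clamp_contract _ _ _) st.
have cu : continuous u := lipschitz_fun_continuous Hul.
(* [u] and the primitive of [wc] are continuous with the same right derivative, so their difference
   is constant by [mean_value_right]. The two-sided derivative of the primitive then passes to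
   [u]. *)
have uP t : 0 <= t <= T -> u t = u 0 + primitive wc t - primitive wc 0.
  move=> /andP[t0 tT]; apply/eqP; rewrite -subr_eq0 -normr_le0.
  have := @mean_value_right _ _ (fun s => u s - primitive wc s) (cst 0) 0 t t0.
  rewrite (_ : _ - _ - (_ - _) = u t - (u 0 + primitive wc t - primitive wc 0)) ?subrr; last by lmodule.
  apply=> [s /andP[s0 _]|s /andP[s0 st] e e0].
    split; last exact: cvg_cst.
    by apply: cvgB; [exact: cu|exact: has_der_continuous (primitiveP cwc s0)].
  have sT : 0 <= s <= T by rewrite s0 (le_trans (ltW st)).
  have e20 : 0 < e / 2 by rewrite divr_gt0.
  have := has_der_right (primitiveP cwc s0) e20; have := rder _ _ sT e20.
  have -> : wc s = w s by rewrite /wc clamp_id.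
  apply: filterS2 => h H1 H2; rewrite add0r.
  rewrite (_ : _ - _ - _ = (u (s + h) - u s - h *: w s) - (primitive wc (s + h) - primitive wc s - h *: w s)); last by lmodule.
  by rewrite (le_trans (ler_normB _ _))// [e]splitr mulrDl lerD.
exists u, wc; split=> //.
- rewrite Hu ?lexx// semigroup_at0// -[RHS]addr0; congr (_ + _).
  by rewrite /duhamel /vint subrr.
- by exists Lu.
- move=> t tT; split; [exact: domu|by rewrite /wc clamp_id|].
  by case/andP: tT => t0 tT; apply: Hun; rewrite t0 (le_trans tT)// ltW.
move=> t /andP[t0 tT] e e0.
have := primitiveP cwc (ltW t0) e0; apply: filter_app; near=> s.
have s0 : 0 < s by near: s; exact: lt_nbhsr.
have sT : s < T by near: s; exact: lt_nbhsl.
rewrite (uP s) ?(ltW s0) ?(ltW sT)// (uP t) ?(ltW t0) ?(ltW tT)//.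
by rewrite (_ : u 0 + _ - _ - _ = primitive wc s - primitive wc t); last by lmodule.
Unshelve. all: by end_near. Qed.

End classical_solution.

(** * The space L2 *)

Section L2_space.
Context d (T : measurableType d) (R : realType) (mu : {measure set T -> \bar R}).
Local Notation L := (LspaceType mu (lee1n 2)).
Implicit Types (u v : L) (f g : T -> R).

Lemma Lnorm2_sq f : ('N[mu]_2[EFin \o f] `^ 2 = \int[mu]_x (f x ^+ 2)%:E)%E.
Proof.
rewrite powR_Lnorm//; apply: eq_integral => x _ /=.
by rewrite -[LHS]/((`|f x| `^ 2)%:E) powR_mulrn// real_normK// num_real.
Qed.

Lemma measurable_sq f : measurable_fun setT f ->
  measurable_fun setT (fun x => (f x ^+ 2)%:E).
Proof. by move=> mf; apply/measurable_EFinP; exact: measurable_funX. Qed.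

Lemma Lfun2P f : measurable_fun setT f -> (\int[mu]_x (f x ^+ 2)%:E < +oo)%E ->
  f \in Lfun mu 2.
Proof.
move=> mf fi; rewrite inE; apply/andP; split; rewrite inE//=.
by apply: (@lty_poweRy _ _ 2) => //; rewrite Lnorm2_sq.
Qed.

Lemma Lspace_norm_sq u : (`|u| ^+ 2)%:E = (\int[mu]_x (u x ^+ 2)%:E)%E.
Proof.
rewrite -Lnorm2_sq -Lspace_normE poweR_EFin powR_mulrn//.
exact: (normr_ge0 u).
Qed.

Lemma integral_sq_ae_eq f g : measurable_fun setT f -> measurable_fun setT g ->
  f = g %[ae mu] -> (\int[mu]_x (f x ^+ 2)%:E = \int[mu]_x (g x ^+ 2)%:E)%E.
Proof.
move=> mf mg fg; apply: ge0_ae_eq_integral => //; [exact: measurable_sq|exact: measurable_sq| | |].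
- by move=> x _; rewrite lee_fin sqr_ge0.
- by move=> x _; rewrite lee_fin sqr_ge0.
- by move: fg; apply: filterS => x fg xT; rewrite fg.
Qed.

Lemma Lclass_ae f : f \in Lfun mu 2 -> (Lclass mu (lee1n 2) f : T -> R) = f %[ae mu].
Proof.
by rewrite /Lclass; case: pselect => // fL _; exact: Lclass_ofE.
Qed.

Lemma Lclass_norm_sq f : f \in Lfun mu 2 ->
  (`|Lclass mu (lee1n 2) f| ^+ 2)%:E = (\int[mu]_x (f x ^+ 2)%:E)%E.
Proof.
move=> fL; rewrite Lspace_norm_sq; apply: integral_sq_ae_eq; last exact: Lclass_ae.
  exact: measurable_Lspace.
exact: measurable_Lfun fL.
Qed.

Lemma Lspace_addE u v : (u + v : T -> R) = (fun x => u x + v x) %[ae mu].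
Proof. exact: LaddE. Qed.

Lemma Lspace_scaleE a u : (a *: u : T -> R) = (fun x => a * u x) %[ae mu].
Proof. exact: LscaleE. Qed.

Lemma Lspace_subE u v : (u - v : T -> R) = (fun x => u x - v x) %[ae mu].
Proof.
have -> : u - v = u + (-1) *: v by rewrite scaleN1r.
have := Lspace_scaleE (-1) v; have := Lspace_addE u (-1 *: v).
by apply: filterS2 => x h1 h2 xT; rewrite h1// h2// mulN1r.
Qed.

Lemma L2_parallelogram u v :
  `|u + v| ^+ 2 + `|u - v| ^+ 2 = 2 * (`|u| ^+ 2 + `|v| ^+ 2).
Proof.
have mu_ := measurable_Lspace u; have mv := measurable_Lspace v.
suff : ((`|u + v| ^+ 2)%:E + (`|u - v| ^+ 2)%:E =
    2%:E * ((`|u| ^+ 2)%:E + (`|v| ^+ 2)%:E))%E by rewrite -!EFinD -EFinM => -[].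
rewrite !Lspace_norm_sq.
rewrite (integral_sq_ae_eq _ _ (Lspace_addE u v)); [|exact: measurable_Lspace|exact: measurable_funD].
rewrite (integral_sq_ae_eq _ _ (Lspace_subE u v)); [|exact: measurable_Lspace|exact: measurable_funB].
have ms f : measurable_fun setT f -> measurable_fun setT (fun x => (f x ^+ 2)%:E) by exact: measurable_sq.
have D f g : measurable_fun setT f -> measurable_fun setT g ->
    (\int[mu]_x (f x ^+ 2)%:E + \int[mu]_x (g x ^+ 2)%:E =
     \int[mu]_x ((f x ^+ 2)%:E + (g x ^+ 2)%:E))%E.
  by move=> mf mg; rewrite ge0_integralD//;
    [by move=> x _; rewrite lee_fin sqr_ge0|exact: ms|by move=> x _; rewrite lee_fin sqr_ge0|exact: ms].
rewrite !D//; [|exact: measurable_funD|exact: measurable_funB].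
rewrite -ge0_integralZl//; last first.
- by move=> x _; rewrite adde_ge0// lee_fin sqr_ge0.
- by apply: emeasurable_funD; exact: ms.
apply: eq_integral => x _; rewrite -!EFinD -EFinM; congr (_%:E).
ring.
Qed.

Lemma Lfun2_mul (r f : T -> R) (c : R) : measurable_fun setT r -> (forall x, `|r x| <= c) ->
  f \in Lfun mu 2 -> (fun x => r x * f x) \in Lfun mu 2.
Proof.
move=> mr rc fL; have mf := measurable_Lfun fL.
have mrf : measurable_fun setT (fun x => r x * f x) by exact: measurable_funM.
apply: Lfun2P => //; apply: (@le_lt_trans _ _ (\int[mu]_x ((c ^+ 2)%:E * (f x ^+ 2)%:E))%E).
  apply: ge0_le_integral => //.
  - by move=> x _; rewrite lee_fin sqr_ge0.
  - exact: measurable_sq.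
  - by under eq_fun do rewrite -EFinM; apply/measurable_EFinP; apply: measurable_funM => //; exact: measurable_funX.
  move=> x _; rewrite -EFinM lee_fin exprMn ler_wpM2r ?sqr_ge0//.
  by rewrite -(real_normK (num_real (r x))) ler_pXn2r ?nnegrE// (le_trans _ (rc x)).
rewrite ge0_integralZl ?lee_fin ?sqr_ge0//; last 2 first.
- exact: measurable_sq.
- by move=> x _; rewrite lee_fin sqr_ge0.
rewrite lte_mul_pinfty ?lee_fin ?sqr_ge0//.
by rewrite -(Lclass_norm_sq fL) ltry.
Qed.

Section multiplier.
Variables (r : T -> R) (c : R).
Hypotheses (mr : measurable_fun setT r) (c_ge0 : 0 <= c) (rc : forall x, `|r x| <= c).
Local Notation M u := (Lclass mu (lee1n 2) (fun x => r x * u x)).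

Lemma multiplier_ae u : (M u : T -> R) = (fun x => r x * u x) %[ae mu].
Proof. by apply: Lclass_ae; apply: Lfun2_mul mr rc _; exact: Lspace_Lfun. Qed.

Lemma multiplier_linear : linear (fun u => M u).
Proof.
move=> a u v; apply: eq_Lspace.
apply: filterS3 (filterI (multiplier_ae (a *: u + v)) (Lspace_addE (a *: u) v))
  (filterI (Lspace_scaleE a u) (Lspace_addE (a *: M u) (M v)))
  (filterI (Lspace_scaleE a (M u)) (filterI (multiplier_ae u) (multiplier_ae v))).
move=> x [h1 h2] [h3 h4] [h5 [h6 h7]] xT.
by rewrite h1// h2// h3// h4// h5// h6// h7//; ring.
Qed.

Lemma multiplier_norm u : `|M u| <= c * `|u|.
Proof.
rewrite -(@ler_pXn2r _ 2) ?nnegrE ?mulr_ge0// exprMn -lee_fin [leRHS]EFinM.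
have mu_ := measurable_Lspace u.
have ML : (fun x => r x * u x) \in Lfun mu 2 by apply: Lfun2_mul mr rc _; exact: Lspace_Lfun.
rewrite Lclass_norm_sq// Lspace_norm_sq -ge0_integralZl ?lee_fin ?sqr_ge0//; last 2 first.
- exact: measurable_sq.
- by move=> x _; rewrite lee_fin sqr_ge0.
apply: ge0_le_integral => //.
- by move=> x _; rewrite lee_fin sqr_ge0.
- by apply: measurable_sq; exact: measurable_funM.
- under eq_fun do rewrite -EFinM; apply/measurable_EFinP; apply: measurable_funM => //.
  exact: measurable_funX.
move=> x _; rewrite -EFinM lee_fin exprMn ler_wpM2r ?sqr_ge0//.
by rewrite -(real_normK (num_real (r x))) ler_pXn2r ?nnegrE.
Qed.
End multiplier.

End L2_space.

(** * Riesz-Fischer: completeness of L2 *)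

Section riesz_fischer.
Context d (T : measurableType d) (R : realType) (mu : {measure set T -> \bar R}).
Local Notation L := (LspaceType mu (lee1n 2)).
Implicit Types (u v : L) (f g : T -> R).

Lemma integral_sq_fatou (h : nat -> T -> R) f (c : R) :
  (forall n, measurable_fun setT (h n)) -> (forall x, h n x @[n --> \oo] --> f x) ->
  (forall n, \int[mu]_x (h n x ^+ 2)%:E <= c%:E)%E ->
  measurable_fun setT f /\ (\int[mu]_x (f x ^+ 2)%:E <= c%:E)%E.
Proof.
move=> mh hf hc; split.
  by apply: (@measurable_fun_cvg _ _ _ _ h) => // x _; exact: hf.
have := @fatou _ _ _ mu setT measurableT (fun n x => (h n x ^+ 2)%:E).
move=> /(_ (fun n => measurable_sq (mh n))) H.
have -> : (\int[mu]_x (f x ^+ 2)%:E = \int[mu]_x limn_einf (fun n => (h n x ^+ 2)%:E))%E.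
  apply: eq_integral => x _; apply/esym.
  have hx : (h n x ^+ 2)%:E @[n --> \oo] --> (f x ^+ 2)%:E.
    by apply: cvg_EFin; [near=> n|rewrite expr2; apply: cvgM; exact: hf].
  exact: (cvg_limn_einf_sup hx).1.
apply: (le_trans (H _)); first by move=> n x _; rewrite lee_fin sqr_ge0.
rewrite limn_einf_lim; apply: lime_le; first exact: is_cvg_einfs.
near=> n; apply: le_trans (hc n); apply: ereal_inf_lbound.
by exists n => //=.
Unshelve. all: by end_near. Qed.

Lemma Lclass_abs_norm u : exists v : L, (v : T -> R) = (fun x => `|u x|) %[ae mu] /\ `|v| = `|u|.
Proof.
have uL : (fun x => `|u x|) \in Lfun mu 2.
  apply: Lfun2P; first by apply: measurableT_comp => //; exact: measurable_Lspace.
  rewrite (eq_integral (fun x => (u x ^+ 2)%:E)).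
    by rewrite -Lspace_norm_sq ltry.
  by move=> x _; rewrite real_normK// num_real.
exists (Lclass mu (lee1n 2) (fun x => `|u x|)); split; first exact: Lclass_ae.
apply/eqP; rewrite -(@eqrXn2 _ 2)//; apply/eqP/EFin_inj.
rewrite Lclass_norm_sq// Lspace_norm_sq; apply: eq_integral => x _.
by rewrite real_normK// num_real.
Qed.

(** The pointwise sum is realized as an element of L2, where the triangle inequality bounds its norm
    by the partial geometric sum [2 - 2 * 2^-1 ^+ m]. *)
Lemma abs_increments_norm (u : nat -> L) m : (forall n, `|u n.+1 - u n| <= 2^-1 ^+ n) ->
  (\int[mu]_x ((\sum_(k < m) `|u k.+1 x - u k x|) ^+ 2)%:E <= (2 ^+ 2)%:E)%E.
Proof.
move=> uf.
suff [v [vE vn]] : exists v : L, (v : T -> R) = (fun x => \sum_(k < m) `|u k.+1 x - u k x|) %[ae mu] /\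
    `|v| <= 2 - 2 * 2^-1 ^+ m.
  rewrite -(integral_sq_ae_eq _ _ vE); [|exact: measurable_Lspace|].
    rewrite -Lspace_norm_sq lee_fin ler_pXn2r ?nnegrE// (le_trans vn)// gerBl.
    by rewrite mulr_ge0// exprn_ge0.
  apply: measurable_sum => k; apply: measurableT_comp => //.
  by apply: measurable_funB; exact: measurable_Lspace.
elim: m => [|m [v [vE vn]]].
  exists 0; split; last by rewrite normr0 expr0 mulr1 subrr.
  by have := @L0E _ T R mu 2 (lee1n 2); apply: filterS => x h xT; rewrite h// big_ord0.
have [w [wE wn]] := Lclass_abs_norm (u m.+1 - u m).
exists (v + w); split.
  apply: filterS3 (filterI vE wE) (Lspace_addE v w) (Lspace_subE (u m.+1) (u m)).
  by move=> x [h1 h2] h3 h4 xT; rewrite h3// h1// h2// h4// big_ord_recr.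
rewrite (le_trans (ler_normD _ _))// wn (le_trans (lerD vn (uf m)))// exprS.
by move: (2^-1 ^+ m) => c; lra.
Qed.

(** By monotone convergence the sum of all absolute increments has a finite square integral, hence
    is finite almost everywhere, and there the sequence converges absolutely. Fatou's lemma bounds
    the distance from the limit to each term. *)
Lemma fast_cauchy_cvg (u : nat -> L) : (forall n, `|u n.+1 - u n| <= 2^-1 ^+ n) ->
  exists l : L, forall n, `|l - u n| <= 2 * 2^-1 ^+ n.
Proof.
move=> uf.
pose g m x := \sum_(k < m) `|u k.+1 x - u k x|.
have mu_ n : measurable_fun setT (u n : T -> R) by exact: measurable_Lspace.
have mg m : measurable_fun setT (g m).
  apply: measurable_sum => k; apply: measurableT_comp => //; exact: measurable_funB.
have g_mono x m n : (m <= n)%N -> g m x <= g n x.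
  move=> mn; rewrite /g -!(big_mkord xpredT (fun k => `|u k.+1 x - u k x|)).
  by rewrite (@big_cat_nat _ _ _ m 0 n)//= lerDl sumr_ge0.
have g0 m x : 0 <= g m x by exact: sumr_ge0.
pose G x := limn (fun m => (g m x ^+ 2)%:E).
have ndG x : {homo (fun m => (g m x ^+ 2)%:E) : m n / (m <= n)%N >-> (m <= n)%E}.
  by move=> m n mn; rewrite lee_fin ler_pXn2r ?nnegrE// g_mono.
have IG : (\int[mu]_x G x <= (2 ^+ 2)%:E)%E.
  rewrite monotone_convergence//.
  - apply: lime_le.
      apply: ereal_nondecreasing_is_cvgn => m n mn; apply: ge0_le_integral => //.
      + by move=> x _; rewrite lee_fin sqr_ge0.
      + exact: measurable_sq.
      + exact: measurable_sq.
      + by move=> x _; exact: ndG.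
    by near=> n; exact: abs_increments_norm.
  - by move=> n; exact: measurable_sq.
  - by move=> n x _; rewrite lee_fin sqr_ge0.
have mG : measurable_fun setT G.
  apply: (@emeasurable_fun_cvg _ _ _ _ (fun m x => (g m x ^+ 2)%:E)) => [m|x _].
    exact: measurable_sq.
  exact: ereal_nondecreasing_is_cvgn.
have G0 x : (0 <= G x)%E.
  apply: lime_ge; first exact: ereal_nondecreasing_is_cvgn.
  by near=> n; rewrite lee_fin sqr_ge0.
have gG m x : ((g m x ^+ 2)%:E <= G x)%E.
  apply: lime_ge; first exact: ereal_nondecreasing_is_cvgn.
  by exists m => // n mn; exact: ndG.
pose Z := [set x | (G x < +oo)%E].
have mZ : measurable Z.
  by rewrite -[Z]setTI; exact: emeasurable_fun_infty_o.
have aeZ : \forall x \ae mu, Z x.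
  have iG : mu.-integrable setT G.
    apply/integrableP; split=> //; apply: le_lt_trans (ltry (2 ^+ 2)).
    by under eq_integral do rewrite gee0_abs//.
  by have := integrable_ae measurableT iG; apply: filterS => x /(_ I); rewrite ge0_fin_numE.
(* Set to 0 off the set [Z] of finite sums, the functions converge at every point and keep their
   classes. *)
pose h n x := u n x * \1_Z x.
have mh n : measurable_fun setT (h n) by apply: measurable_funM => //; exact: measurable_indic.
have hu n : h n = u n %[ae mu].
  by move: aeZ; apply: filterS => x Zx _; rewrite /h indicE mem_set// mulr1.
have /choice[f Hf] x : exists l : R, h n x @[n --> \oo] --> l.
  have [Zx|nZx] := pselect (Z x); last first.
    exists 0; rewrite /h indicE memNset//=.
    by under eq_fun do rewrite mulr0; exact: cvg_cst.
  have [c gc] : exists c : R, forall m, g m x <= c.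
    exists (fine (G x) + 1) => m.
    have : ((g m x ^+ 2)%:E <= (fine (G x))%:E)%E by rewrite fineK ?ge0_fin_numE.
    rewrite lee_fin; have := sqr_ge0 (g m x - 1); have := g0 m x.
    move: (g m x) (fine (G x)) => a b; nra.
  apply/cvg_ex; rewrite /h indicE mem_set//=.
  have -> : (fun n => u n x * 1) = (fun n => u 0 x + series (fun k => u k.+1 x - u k x) n).
    apply/funext => n; rewrite /series /= telescope_sumr// mulr1.
    by rewrite addrC subrK.
  apply: is_cvgD; first exact: is_cvg_cst.
  apply: normed_cvg; apply: nondecreasing_is_cvgn.
    by move=> m p mp; rewrite /normed_series_of !seriesEord; exact: g_mono.
  by exists c => _ [m _ <-]; rewrite /normed_series_of seriesEord; exact: gc.
have tail k : measurable_fun setT (fun x => f x - h k x) /\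
    (\int[mu]_x ((f x - h k x) ^+ 2)%:E <= ((2 * 2^-1 ^+ k) ^+ 2)%:E)%E.
  apply: (@integral_sq_fatou (fun m x => h (m + k)%N x - h k x)) => [m|x|m].
  - exact: measurable_funB.
  - apply: cvgB; last exact: cvg_cst.
    by rewrite (cvg_shiftn k (fun m => h m x)); exact: Hf.
  rewrite (integral_sq_ae_eq _ _ (_ : _ = (fun x => u (m + k)%N x - u k x) %[ae mu])); last 3 first.
  - exact: measurable_funB.
  - exact: measurable_funB.
  - by apply: filterS2 (hu (m + k)%N) (hu k) => x h1 h2 xT; rewrite h1// h2.
  rewrite -(integral_sq_ae_eq _ _ (Lspace_subE (u (m + k)%N) (u k))); last 2 first.
  - exact: measurable_Lspace.
  - exact: measurable_funB.
  rewrite -Lspace_norm_sq lee_fin ler_pXn2r ?nnegrE ?mulr_ge0 ?exprn_ge0//.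
  apply: (@le_trans _ _ ((2 - 2 * 2^-1 ^+ m) * 2^-1 ^+ k)); last first.
    by rewrite ler_wpM2r ?exprn_ge0// gerBl mulr_ge0// exprn_ge0.
  elim: m => [|m IHm]; first by rewrite add0n subrr normr0 expr0 mulr1 subrr mul0r.
  rewrite addSn -(subrK (u (m + k)%N) (u _.+1)) -addrA (le_trans (ler_normD _ _))//.
  rewrite (le_trans (lerD (uf _) IHm))// exprD exprS.
  by move: (2^-1 ^+ m) (2^-1 ^+ k) => a b; lra.
have tailL k : (fun x => f x - h k x) \in Lfun mu 2.
  have [mt it] := tail k; apply: Lfun2P => //; exact: le_lt_trans it (ltry _).
have mf : measurable_fun setT f.
  by apply: (@measurable_fun_cvg _ _ _ _ h) => // x _; exact: Hf.
(* The limit [f] enters L2 through [f - h 0], which is square integrable by [tail] at [k = 0]. *)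
pose l := Lclass mu (lee1n 2) (fun x => f x - h 0 x) + u 0%N.
have lE : (l : T -> R) = f %[ae mu].
  apply: filterS3 (Lspace_addE (Lclass mu (lee1n 2) (fun x => f x - h 0 x)) (u 0%N)) (Lclass_ae (tailL 0%N)) (hu 0%N).
  by move=> x h1 h2 h3 xT; rewrite h1// h2// h3// subrK.
exists l => k; rewrite -(@ler_pXn2r _ 2) ?nnegrE ?mulr_ge0 ?exprn_ge0// -lee_fin Lspace_norm_sq.
have [mt it] := tail k; apply: le_trans it.
rewrite (integral_sq_ae_eq _ mt (_ : _ = (fun x => f x - h k x) %[ae mu]))//.
  exact: measurable_Lspace.
by apply: filterS3 (Lspace_subE l (u k)) lE (hu k) => x h1 h2 h3 xT; rewrite h1// h2// h3.
Unshelve. all: by end_near. Qed.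

Lemma L2_complete (F : set_system L) : ProperFilter F -> cauchy F -> cvg F.
Proof.
move=> FF /cauchyP cF.
(* With radii [2^-(n+2)], two successive balls meet and their centres are less than [2^-n] apart. *)
have e0 n : 0 < 2^-1 * 2^-1 ^+ n.+1 :> R by rewrite mulr_gt0// exprn_gt0.
have /choice[u Hu] n : exists x, F (ball x (2^-1 * 2^-1 ^+ n.+1 : R)) by exact: cF.
have near_u n x : ball (u n) (2^-1 * 2^-1 ^+ n.+1 : R) x -> `|u n - x| < 2^-1 * 2^-1 ^+ n.+1.
  by rewrite -ball_normE.
have [|l Hl] := @fast_cauchy_cvg u.
  move=> n; have [x [x1 x2]] := filter_ex (filterI (Hu n) (Hu n.+1)).
  have := near_u _ _ x1; have := near_u _ _ x2 => h1 h2.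
  rewrite -(subrK x (u n.+1)) -addrA (le_trans (ler_normD _ _))//.
  rewrite (distrC x); move: h1 h2; rewrite !exprS.
  have : 0 <= (2^-1 : R) ^+ n by rewrite exprn_ge0.
  move: (2^-1 ^+ n) => c; lra.
apply/cvg_ex; exists l; apply/cvgrPdist_le => e e1.
pose n := Num.truncn (3 / e).
have ne : 3 * 2^-1 ^+ n <= e.
  rewrite exprVn ler_pdivrMr ?exprn_gt0// mulrC -ler_pdivrMr// ltW//.
  rewrite (lt_le_trans (truncnS_gt _))// -natrX ler_nat.
  exact: ltn_expl.
apply: filterS (Hu n) => x /near_u ux.
rewrite -(subrK (u n) l) -addrA (le_trans (ler_normD _ _))//.
have := Hl n; move: ux ne; rewrite exprS.
have : 0 <= (2^-1 : R) ^+ n by rewrite exprn_ge0.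
by move: (2^-1 ^+ n) => c; lra.
Qed.

HB.instance Definition _ := Uniform_isComplete.Build L L2_complete.

End riesz_fischer.

(** * Lebesgue measure on row vectors *)

Section measurable_rV.
Context (R : realType) (n : nat).
Local Notation E := 'rV[R]_n.

Lemma ball_rV_coord (x : E) (r : R) y : 0 < r ->
  ball x r y <-> forall i, `|x ord0 i - y ord0 i| < r.
Proof.
move=> r0; split=> [[_ H] i|H]; first by have := H ord0 i; rewrite -ball_normE.
by split=> // i j; rewrite (ord1 i) -ball_normE; exact: H.
Qed.

Lemma measurable_ball_rV (x : E) (r : R) : measurable (ball x r).
Proof.
have [r0|r0] := ltP 0 r; last first.
  rewrite (_ : ball x r = set0); first exact: measurable0.
  by rewrite -subset0 => y [/lt_le_trans /(_ r0)]; rewrite ltxx.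
rewrite (_ : ball x r = \bigcap_(i in [set: 'I_n]) [set y : E | `|x ord0 i - y ord0 i| < r]); last first.
  apply/seteqP; split=> y /=; first by move=> /(ball_rV_coord _ _ r0) H i _; exact: H.
  by move=> H; apply/ball_rV_coord => // i; exact: (H i I).
apply: fin_bigcap_measurable => // i _.
rewrite (_ : [set y : E | _] = (fun y : E => y ord0 i) @^-1` ball (x ord0 i) r); last first.
  by apply/seteqP; split => y /=; rewrite -ball_normE.
rewrite -[X in measurable X]setTI; apply: measurable_coord_rV => //.
exact: measurable_ball.
Qed.

(** The sigma-algebra on rows is generated by the coordinates, so open sets have to be recovered as
    countable unions of balls, with rational centres and radii [1 / (k + 1)]; balls not contained in
    [U] are replaced with the empty set. *)
Lemma open_measurable_rV (U : set E) : open U -> measurable U.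
Proof.
move=> oU.
pose q (p : 'rV[rat]_n * nat) : E := \row_i ratr (p.1 ord0 i).
pose W p := if `[< ball (q p) p.2.+1%:R^-1 `<=` U >] then ball (q p) (p.2.+1%:R^-1 : R) else set0.
rewrite (_ : U = \bigcup_p W p).
  apply: countable_bigcupT_measurable => [|p]; first exact: countableP.
  by rewrite /W; case: ifPn => _; [exact: measurable_ball_rV|exact: measurable0].
apply/seteqP; split=> [x Ux|x [p _]]; last first.
  by rewrite /W; case: ifPn => // /asboolP; apply.
have /nbhs_ballP[/= e e0 He] : nbhs x U by exact: open_nbhs_nbhs.
pose k := Num.truncn (2 / e).
have k0 : 0 < (k.+1%:R : R)^-1 by rewrite invr_gt0.
have ke : 2 * k.+1%:R^-1 < e.
  rewrite ltr_pdivrMr// mulrC -ltr_pdivrMr//; exact: truncnS_gt.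
have /choice[a Ha] (i : 'I_n) : exists a : rat, `|ratr a - x ord0 i| < k.+1%:R^-1.
  move: k0; move: (k.+1%:R^-1) => s s0.
  have : x ord0 i - s < x ord0 i + s by lra.
  move=> /rat_in_itvoo[a]; rewrite in_itv/= => /andP[a1 a2]; exists a.
  by rewrite ltr_norml; apply/andP; split; lra.
exists (\row_i a i, k) => //; rewrite /W ifT.
  by apply/ball_rV_coord => // i; rewrite !mxE.
apply/asboolP => y /= /ball_rV_coord-/(_ k0) H; apply: He; apply/ball_rV_coord => // i.
have := H i; rewrite !mxE => h1; have := Ha i; rewrite distrC => h2.
rewrite -(subrK (ratr (a i)) (x ord0 i)) -addrA (le_lt_trans (ler_normD _ _))//.
by rewrite (lt_trans _ ke)// mulr_natl mulr2n ltrD.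
Qed.

Lemma continuous_measurable_rV (f : E -> R) : continuous f -> measurable_fun setT f.
Proof.
move=> cf; apply: (measurability _ (RGenOInfty.measurableE R)) => //.
move=> _ [_ [a ->] <-]; rewrite setTI; apply: open_measurable_rV.
by apply: open_comp => [x _|]; [exact: cf|exact: interval_open].
Qed.

Lemma closed_measurable_rV (K : set E) : closed K -> measurable K.
Proof.
by move=> cK; rewrite -(setCK K); apply: measurableC; apply: open_measurable_rV; exact: closed_openC.
Qed.

End measurable_rV.

(** * Affine changes of variables *)

Section affine.
Context (R : realType).
Local Notation mu1 := (@lebesgue_measure R).
Local Notation leb := (lebesgue_rV R).

Lemma measurable_affine (c b : R) : measurable_fun setT (fun x : measurableTypeR R => c * x + b : measurableTypeR R).
Proof. by apply: measurable_funD => //; apply: measurable_funM. Qed.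

(** The rescaled image measure agrees with Lebesgue measure on half-open intervals, and these
    determine it. *)
Lemma lebesgue_affine (c b : R) (A : set (measurableTypeR R)) : 0 < c -> measurable A ->
  (c%:E * mu1 ((fun x => (c * x + b)%R) @^-1` A) = mu1 A)%E.
Proof.
move=> c0 mA.
pose phi : {mfun measurableTypeR R >-> measurableTypeR R} := HB.pack
  (fun x : measurableTypeR R => c * x + b : measurableTypeR R)
  (isMeasurableFun.Build _ _ _ _ _ (measurable_affine c b)).
suff H Y : ocitv Y -> mu1 Y = mscale (NngNum (ltW c0)) (pushforward mu1 phi) Y.
  exact/esym/(lebesgue_measure_unique (H (measurable_affine c b)) mA).
move=> {}X /ocitvP[->|[[u v] /= uv ->]]; first by rewrite !measure0.
rewrite -[RHS]/(c%:E * mu1 ((fun x => c * x + b)%R @^-1` `]u, v]%classic))%E.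
rewrite (_ : _ @^-1` _ = `](u - b) / c, (v - b) / c]%classic); last first.
  apply/seteqP; split=> x /=; rewrite !in_itv /= ltr_pdivrMr// ler_pdivlMr// ltrBlDr lerBrDr mulrC => //.
rewrite !lebesgue_measure_itv /= !lte_fin uv ltr_pM2r ?invr_gt0// ltrD2r uv.
rewrite -!EFinD -EFinM; congr (_%:E).
by field; rewrite gt_eqF.
Qed.

Lemma ge0_integral_affine1 (c b : R) (f : measurableTypeR R -> \bar R) : 0 < c ->
  measurable_fun setT f -> (forall x, 0 <= f x)%E ->
  (c%:E * \int[mu1]_x f (c * x + b)%R = \int[mu1]_x f x)%E.
Proof.
move=> c0 mf f0.
pose phi : {mfun measurableTypeR R >-> measurableTypeR R} := HB.pack
  (fun x : measurableTypeR R => c * x + b : measurableTypeR R)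
  (isMeasurableFun.Build _ _ _ _ _ (measurable_affine c b)).
rewrite [RHS](eq_measure_integral (mscale (NngNum (ltW c0)) (pushforward mu1 phi))); last first.
  by move=> A mA _; exact/esym/(lebesgue_affine b c0 mA).
rewrite ge0_integral_mscale// (ge0_integral_pushforward (measurable_affine c b))//.
Qed.

Lemma ge0_integral_rVS n (f : 'rV[R]_n.+1 -> \bar R) : measurable_fun setT f ->
  (forall x, 0 <= f x)%E ->
  (\int[leb n.+1]_x f x = \int[mu1]_a \int[leb n]_v f (cons_rV (a, v)))%E.
Proof.
move=> mf f0.
rewrite -[LHS]/(\int[pushforward (mu1 \x leb n)%E (@cons_rV R n)]_x f x)%E.
rewrite (ge0_integral_pushforward (@measurable_cons_rV R n))//.
rewrite preimage_setT fubini_tonelli1//.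
  by apply: measurableT_comp => //; exact: measurable_cons_rV.
by move=> x /=; exact: f0.
Qed.

Lemma measurable_integral_rV n (f : 'rV[R]_n.+1 -> \bar R) : measurable_fun setT f ->
  (forall x, 0 <= f x)%E ->
  measurable_fun setT (fun a : measurableTypeR R => \int[leb n]_v f (cons_rV (a, v)))%E.
Proof.
move=> mf f0; apply: (@measurable_fun_fubini_tonelli_F _ _ _ _ _ (leb n) (f \o @cons_rV R n)).
  by apply: measurableT_comp => //; exact: measurable_cons_rV.
by move=> x; exact: f0.
Qed.

Lemma measurable_affine_rV n (c : R) (b : 'rV[R]_n) : measurable_fun setT (fun x : 'rV[R]_n => c *: x + b).
Proof.
apply: measurable_fun_rV => i; under eq_fun do rewrite !mxE.
apply: measurable_funD => //; apply: measurable_funM => //; exact: measurable_coord_rV.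
Qed.

(** Induction on the dimension by Tonelli: the first coordinate contributes one factor [c], the
    remaining ones [c ^+ n]. *)
Lemma ge0_integral_affine n (c : R) (b : 'rV[R]_n) (f : 'rV[R]_n -> \bar R) : 0 < c ->
  measurable_fun setT f -> (forall x, 0 <= f x)%E ->
  ((c ^+ n)%:E * \int[leb n]_x f (c *: x + b)%R = \int[leb n]_x f x)%E.
Proof.
move=> c0; elim: n b f => [|n IHn] b f mf f0.
  rewrite expr0 mul1e; apply: eq_integral => x _; congr f.
  by rewrite (thinmx0 x) (thinmx0 (_ + _)).
have mg : measurable_fun setT (fun x : 'rV[R]_n.+1 => f (c *: x + b)).
  by apply: measurableT_comp => //; exact: measurable_affine_rV.
rewrite !ge0_integral_rVS//.
pose b' : 'rV[R]_n := \row_j b ord0 (lift ord0 j).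
pose H (a : measurableTypeR R) := (\int[leb n]_v f (cons_rV (a, v)))%E.
have mH : measurable_fun setT H by exact: measurable_integral_rV.
have H0 a : (0 <= H a)%E by apply: integral_ge0 => x _.
rewrite exprSr EFinM -muleA.
rewrite -[RHS](ge0_integral_affine1 (b ord0 ord0) c0 mH H0).
rewrite muleCA; congr (_ * _)%E.
have mHc : measurable_fun setT (fun a : measurableTypeR R => (\int[leb n]_v f (c *: cons_rV (a, v) + b)%R)%E).
  exact: (@measurable_integral_rV _ (fun x : 'rV[R]_n.+1 => f (c *: x + b))).
rewrite -ge0_integralZl//; last 2 first.
- by move=> a _; apply: integral_ge0.
- by rewrite lee_fin exprn_ge0// ltW.
apply: eq_integral => a _.
have -> : (\int[leb n]_v f (c *: cons_rV (a, v) + b)%R =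
    \int[leb n]_v f (cons_rV ((c * a + b ord0 ord0)%R, (c *: v + b')%R)))%E.
  apply: eq_integral => v _; congr f; apply/rowP => i; rewrite !mxE.
  by case: unliftP => [j ->|->] /=; rewrite ?mxE.
rewrite (IHn b' (fun v => f (cons_rV ((c * a + b ord0 ord0)%R, v))))//.
apply: (measurableT_comp mf); apply: (measurableT_comp (@measurable_cons_rV R n)).
by apply: measurable_fun_pair.
Qed.

Lemma lebesgue_box n (M : R) : 0 <= M ->
  leb n [set x | forall i, (`|x ord0 i| <= M)%R] = ((2 * M) ^+ n)%:E.
Proof.
move=> M0; elim: n => [|n IHn].
  by rewrite [LHS]diracE mem_set ?expr0// => -[].
rewrite -[LHS]/((mu1 \x leb n) (@cons_rV R n @^-1` _))%E.
rewrite (_ : _ @^-1` _ = [set x | `|x| <= M] `*` [set x : 'rV[R]_n | forall i, `|x ord0 i| <= M]); last first.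
  apply/seteqP; split=> -[a v] /= H.
    split=> [|i]; first by have := H ord0; rewrite mxE unlift_none.
    by have := H (lift ord0 i); rewrite mxE liftK.
  by case: H => H1 H2 i; rewrite mxE; case: (unlift ord0 i).
have IE : [set x : measurableTypeR R | `|x| <= M] = `[- M, M]%classic.
  by apply/seteqP; split=> x /=; rewrite in_itv /= ler_norml.
have mI : measurable [set x : measurableTypeR R | `|x| <= M].
  by rewrite IE; exact: measurable_itv.
have mB : measurable [set x : 'rV[R]_n | forall i, `|x ord0 i| <= M].
  rewrite (_ : [set x | _] = \bigcap_(i in [set: 'I_n]) [set x : 'rV[R]_n | `|x ord0 i| <= M]); last first.
    by apply/seteqP; split=> x /= H i; [move=> _|]; apply: H.
  apply: fin_bigcap_measurable => // i _.
  rewrite (_ : [set x | _] = (fun x : 'rV[R]_n => x ord0 i) @^-1` [set x : measurableTypeR R | `|x| <= M])//.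
  by rewrite -[X in measurable X]setTI; apply: measurable_coord_rV.
rewrite product_measure1E// exprS EFinM IHn; congr (_ * _)%E.
suff: mu1 `[- M, M]%classic = (2 * M)%:E by rewrite -IE.
rewrite lebesgue_measure_itv /= lte_fin.
have [->|/eqP Mn0] := eqVneq M 0; first by rewrite oppr0 ltxx mulr0.
have M_gt0 : 0 < M by rewrite lt_neqAle eq_sym; apply/andP; split=> //; exact/eqP.
by rewrite ifT ?gtrN// -EFinD opprK mulr_natl mulr2n.
Qed.

End affine.

(** * Smooth functions *)

Section smooth_functions.
Context (R : realType) (d : nat).
Local Notation E := 'rV[R]_d.
Local Notation e_ i := (delta_mx ord0 i : E).
Implicit Types (f g : E -> R) (x y : E).

Lemma is_derive_line x v f l :
  is_derive x v f l <-> is_derive (0 : R) 1 (fun t => f (t *: v + x)) l.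
Proof.
have H : (fun h : R => h^-1 *: ((f \o shift x) (h *: v) - f x)) =
    (fun h => h^-1 *: (((fun t : R => f (t *: v + x)) \o shift 0) (h *: 1) - f (0 *: v + x))).
  by apply/funext => h /=; rewrite addr0 [h *: 1]mulr1 scale0r add0r.
by split=> -[dl <-]; (split; [move: dl|]; rewrite /derivable /derive H).
Qed.

(** Recursion on the derivative taken first, whereas [pderive] exposes the one taken last. Closure
    rules are proved by induction on this finite order and transferred to [smooth] by [smoothP]. *)
Fixpoint ck n f : Prop := continuous f /\
  if n is m.+1 then forall i, (forall x, derivable f x (e_ i)) /\ ck m (fun x => 'D_(e_ i) f x)
  else True.

Lemma ck_continuous n f : ck n f -> continuous f.
Proof. by case: n => [|n] []. Qed.
Arguments ck_continuous : clear implicits.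
Arguments ck_continuous {n f} _ x _ _.

Lemma ckW n f : ck n.+1 f -> ck n f.
Proof.
elim: n f => [|n IHn] f [cf df]; split=> // i.
by have [dfi ckf] := df i; split=> //; exact: IHn.
Qed.

Lemma ckS n f (g : 'I_d -> E -> R) : continuous f ->
  (forall i x, is_derive x (e_ i) f (g i x)) -> (forall i, ck n (g i)) -> ck n.+1 f.
Proof.
move=> cf fg cg; split=> // i; split=> [x|].
  by have [] := fg i x.
by rewrite (_ : (fun x => _) = g i)//; apply/funext => x; have [] := fg i x.
Qed.

Lemma ck_derive n f i x : ck n.+1 f -> is_derive x (e_ i) f ('D_(e_ i) f x).
Proof. by move=> [_ /(_ i)[df _]]; exact: derivableP. Qed.

Lemma ck_cst n c : ck n (cst c).
Proof.
elim: n c => [|n IHn] c; first by split=> //; exact: cst_continuous.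
by apply: (@ckS n _ (fun _ => cst 0)) => //; exact: cst_continuous.
Qed.

Lemma ckD n f g : ck n f -> ck n g -> ck n (fun x => f x + g x).
Proof.
elim: n f g => [|n IHn] f g cf cg.
  by split=> // x; exact: cvgD (ck_continuous cf x) (ck_continuous cg x).
apply: (@ckS n _ (fun i x => 'D_(e_ i) f x + 'D_(e_ i) g x)) => [x|i x|i].
- exact: cvgD (ck_continuous cf x) (ck_continuous cg x).
- exact: is_deriveD (ck_derive i x cf) (ck_derive i x cg).
- by apply: IHn; [case: cf => _ /(_ i)[]|case: cg => _ /(_ i)[]].
Qed.

Lemma ckM n f g : ck n f -> ck n g -> ck n (fun x => f x * g x).
Proof.
elim: n f g => [|n IHn] f g cf cg.
  by split=> // x; exact: cvgM (ck_continuous cf x) (ck_continuous cg x).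
apply: (@ckS n _ (fun i x => f x * 'D_(e_ i) g x + g x * 'D_(e_ i) f x)) => [x|i x|i].
- exact: cvgM (ck_continuous cf x) (ck_continuous cg x).
- exact: is_deriveM (ck_derive i x cf) (ck_derive i x cg).
- apply: ckD; apply: IHn; first exact: ckW.
  + by case: cg => _ /(_ i)[].
  + exact: ckW.
  + by case: cf => _ /(_ i)[].
Qed.

Lemma is_derive_affine f (a : R) b x v l : is_derive (a *: x + b) v f l ->
  is_derive x v (fun z => f (a *: z + b)) (a * l).
Proof.
move=> /is_derive_line fl; apply/is_derive_line.
rewrite (_ : (fun t => _) = (fun t => f (t *: v + (a *: x + b))) \o (fun t : R => a * t)); last first.
  by apply/funext => t /=; congr f; lmodule.
rewrite mulrC; apply: is_derive1_comp; first by rewrite mulr0.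
apply: is_derive_eq; by rewrite [LHS]mulr1.
Qed.

Lemma affine_continuous (a : R) b : continuous (fun x : E => a *: x + b).
Proof.
move=> x; apply: continuousD; last exact: cst_continuous.
exact: (@scaler_continuous R E a x).
Qed.

Lemma ck_affine n f (a : R) b : ck n f -> ck n (fun x => f (a *: x + b)).
Proof.
have cc f' : continuous f' -> continuous (fun x => f' (a *: x + b)).
  by move=> cf x; apply: (@continuous_comp _ _ _ (fun x : E => a *: x + b) f');
    [exact: affine_continuous|exact: cf].
elim: n f => [|n IHn] f cf.
  by split=> //; apply: cc; exact: ck_continuous cf.
apply: (@ckS n _ (fun i x => a * 'D_(e_ i) f (a *: x + b))) => [|i x|i].
- by apply: cc; exact: ck_continuous cf.
- exact: is_derive_affine (ck_derive i (a *: x + b) cf).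
- apply: (@ckM n (cst a)); first exact: ck_cst.
  by apply: (IHn (fun x => 'D_(e_ i) f x)); case: cf => _ /(_ i)[].
Qed.

Lemma coord_continuous_rV j : continuous (fun x : E => x ord0 j).
Proof. exact: coord_continuous. Qed.

Lemma ck_coord n j : ck n (fun x : E => x ord0 j).
Proof.
case: n => [|n]; first by split=> //; exact: coord_continuous_rV.
apply: (@ckS n _ (fun i => cst ((e_ i) ord0 j))) => [|i x|i]; [exact: coord_continuous_rV| |exact: ck_cst].
apply/is_derive_line; under eq_fun do rewrite !mxE.
apply: is_derive_eq; rewrite /cst mxE.
by rewrite scale0r add0r addr0 [LHS]mulr1.
Qed.

Lemma ck_sum n (I : Type) (r : seq I) (F : I -> E -> R) :
  (forall i, ck n (F i)) -> ck n (fun x => \sum_(i <- r) F i x).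
Proof.
move=> cF; elim: r => [|i r IHr].
  by under eq_fun do rewrite big_nil; exact: ck_cst.
by under eq_fun do rewrite big_cons; exact: ckD.
Qed.

Lemma pderive_rcons s i f : pderive (rcons s i) f = pderive s (fun x => 'D_(e_ i) f x).
Proof. by rewrite /pderive foldr_rcons. Qed.

Lemma smoothP f : smooth f <-> forall n, ck n f.
Proof.
split=> [sf n|cf s].
  elim: n f sf => [|n IHn] f sf.
    by have [] := sf [::].
  have [cf df] := sf [::]; split=> // i; split=> [x|]; first exact: df.
  by apply: IHn => s; rewrite -pderive_rcons; exact: sf.
elim/last_ind: s f cf => [|s i IHs] f cf.
  by split=> [|i x]; [exact: ck_continuous (cf 0%N)|have [_ /(_ i)[]] := cf 1%N].
by rewrite pderive_rcons; apply: IHs => n; have [_ /(_ i)[]] := cf n.+1.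
Qed.

End smooth_functions.

(** * The flat function exp (- 1 / t) *)

Section flat_function.
Context (R : realType).
Implicit Types (t u : R).

(* Derivatives of t |-> exp (- 1 / t) are combinations of these. *)
Definition bexp k t : R := if 0 < t then t^-1 ^+ k * expR (- t^-1) else 0.

(** This is [u ^+ n <= n! * expR u] for [u = t^-1] and [n = k + 2]. A bound quadratic in [t] yields
    the zero derivative at 0. *)
Lemma bexp_le_sq k t : 0 <= bexp k t <= (k.+2)`!%:R * t ^+ 2.
Proof.
rewrite /bexp; case: ifP => [t0|_]; last by rewrite lexx mulr_ge0 ?sqr_ge0.
have u0 : 0 < t^-1 by rewrite invr_gt0.
apply/andP; split; first by rewrite mulr_ge0 ?expR_ge0// exprn_ge0// ltW.
have H := expR_ge1Dxn k.+1 (ltW u0).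
have f0 : 0 < (k.+2)`!%:R :> R by rewrite ltr0n fact_gt0.
have {}H : t^-1 ^+ k.+2 <= (k.+2)`!%:R * expR t^-1.
  by rewrite -ler_pdivrMl// mulrC (le_trans _ H)// lerDr.
have -> : t^-1 ^+ k * expR (- t^-1) = t^-1 ^+ k.+2 * expR (- t^-1) * t ^+ 2.
  by rewrite !exprS; field; rewrite gt_eqF.
rewrite ler_wpM2r ?sqr_ge0// expRN ler_pdivrMr ?expR_gt0//.
Qed.

Lemma is_derive_bexp k t :
  is_derive t 1 (bexp k) (bexp k.+2 t - k%:R * bexp k.+1 t).
Proof.
have [t0|t0|t0] := ltgtP 0 t; last rewrite -t0.
- apply: (@near_eq_is_derive _ _ _ (fun s : R => s^-1 ^+ k * expR (- s^-1))).
    by have := lt_nbhsr t0; apply: filterS => s s0; rewrite /bexp s0.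
  have dV : is_derive t 1 (fun s : R => s^-1) (- t ^- 2).
    have := @is_deriveV R id t 1 1 _ (is_derive_id t 1).
    by move/(_ (lt0r_neq0 t0)); rewrite [_ *: _]mulr1.
  have dX := @is_deriveX _ _ _ k _ _ _ dV.
  have dE : is_derive t 1 (fun s : R => expR (- s^-1)) (expR (- t^-1) * t ^- 2).
    have := @is_derive1_comp R expR (fun s => - s^-1) t _ _ (is_derive_expR _) (is_deriveN dV).
    by rewrite opprK.
  rewrite (_ : (fun s => _) = (fun s => s^-1) ^+ k * (fun s : R => expR (- s^-1))); last first.
    by apply/funext => s; rewrite /= -[RHS]/(_ * _) exprfctE.
  have dM := is_deriveM dX dE; apply: (is_derive_eq dM).
  rewrite /bexp t0 /GRing.scale /= -exprVn.
  by rewrite exprfctE /=; case: k dX dM => [|k] _ _ /=; rewrite ?expr0 ?exprS; ring.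
- apply: (@near_eq_is_derive _ _ _ (cst 0)).
    by have := lt_nbhsl t0; apply: filterS => s s0; rewrite /bexp ltNge (ltW s0).
  by rewrite /bexp ltNge (ltW t0) /= mulr0 subr0; exact: is_derive_cst.
- rewrite {2 3}/bexp ltxx mulr0 subr0; apply/has_derP => e e0.
  set C : R := (k.+2)`!%:R.
  have C0 : 0 < C by rewrite ltr0n fact_gt0.
  have eC : 0 < e / C by rewrite divr_gt0.
  have := near_dist_lt (0 : R) eC; apply: filterS => s; rewrite sub0r normrN => sC.
  rewrite {2}/bexp ltxx subr0 scaler0 subr0.
  have /andP[b0 b1] := bexp_le_sq k s.
  rewrite ger0_norm// (le_trans b1)// -/C -real_normK ?num_real// expr2 mulrA.
  by rewrite subr0 ler_wpM2r// mulrC -ler_pdivlMr// ltW.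
Qed.

Lemma bexp_continuous k : continuous (bexp k).
Proof.
move=> t; have [/derivable1_diffP/differentiable_continuous] := is_derive_bexp k t.
exact.
Qed.

Lemma bexp_gt0 k t : 0 < t -> 0 < bexp k t.
Proof. by move=> t0; rewrite /bexp t0 mulr_gt0 ?expR_gt0// exprn_gt0// invr_gt0. Qed.

Lemma bexp_le0 k t : t <= 0 -> bexp k t = 0.
Proof. by rewrite /bexp leNgt => /negbTE ->. Qed.

Lemma ck_bexp d n k (g : 'rV[R]_d -> R) : ck n g -> ck n (fun x => bexp k (g x)).
Proof.
have cc k' g' : continuous g' -> continuous (fun x : 'rV[R]_d => bexp k' (g' x)).
  by move=> cg x; apply: (@continuous_comp _ _ _ g' (bexp k'));
    [exact: cg|exact: bexp_continuous].
elim: n k g => [|n IHn] k g cg.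
  by split=> //; apply: cc; exact: ck_continuous cg.
apply: (@ckS _ _ n _ (fun i x => (bexp k.+2 (g x) + (- k%:R) * bexp k.+1 (g x)) * 'D_(delta_mx ord0 i) g x)).
- by apply: cc; exact: ck_continuous cg.
- move=> i x; apply/is_derive_line.
  have /is_derive_line dg := ck_derive i x cg.
  have := @is_derive1_comp R (bexp k) (fun t => g (t *: delta_mx ord0 i + x)) 0 _ _ (is_derive_bexp k _) dg.
  by rewrite scale0r add0r mulNr.
- move=> i; apply: ckM; last by case: cg => _ /(_ i)[].
  have cg' := ckW cg.
  apply: ckD; first exact: IHn.
  by apply: (@ckM _ _ n (cst (- k%:R))); [exact: ck_cst|exact: IHn].
Qed.

End flat_function.

(** * Test functions *)

Section test_functions.
Context (R : realType) (d : nat).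
Local Notation E := 'rV[R]_d.
Local Notation e_ i := (delta_mx ord0 i : E).
Implicit Types (f g : E -> R) (x y : E) (M : R) (s : seq 'I_d).

(** Balls stand in for compact supports: radii are easy to follow through sums, translations and
    dilations, and closed balls are compact in finite dimension. *)
Definition vanish_outside M f := forall x, M < `|x| -> f x = 0.

Lemma closed_norm_le M : closed [set x : E | `|x| <= M].
Proof.
rewrite (_ : [set x | _] = (fun x : E => `|x|) @^-1` [set t | t <= M])//.
by apply: closed_comp => [x _|]; [exact: norm_continuous|exact: closed_le].
Qed.

Lemma compact_norm_le M : compact [set x : E | `|x| <= M].
Proof.
apply: bounded_closed_compact; last exact: closed_norm_le.
by exists M; split; [exact: num_real|move=> r Mr x /le_trans; apply; exact: ltW].
Qed.

Lemma supp_sub M f : vanish_outside M f -> supp f `<=` [set x | `|x| <= M].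
Proof.
move=> fM; rewrite (closure_id [set x : E | `|x| <= M]).1; last exact: closed_norm_le.
by apply: closure_subset => x /= fx; rewrite leNgt; apply/negP => /fM f0; rewrite f0 eqxx in fx.
Qed.

Lemma test_functionP f : test_function f <-> smooth f /\ exists2 M, 0 <= M & vanish_outside M f.
Proof.
split=> -[sf cf]; split=> //.
  have [M M0 KM] := compact_norm_bounded cf; exists M => // x Mx.
  apply/eqP; apply: contraTT Mx => fx; rewrite -leNgt; apply: KM.
  exact: subset_closure.
have [M M0 fM] := cf.
exact: (subclosed_compact (@closed_closure _ _) (@compact_norm_le M) (supp_sub fM)).
Qed.

Lemma smooth_ck f n : smooth f -> ck n f. Proof. by move=> /smoothP. Qed.

Lemma smooth_derive f i : smooth f -> smooth (fun x => 'D_(e_ i) f x).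
Proof. by move=> /smoothP cf; apply/smoothP => n; case: (cf n.+1) => _ /(_ i)[]. Qed.

Lemma smoothM f g : smooth f -> smooth g -> smooth (fun x => f x * g x).
Proof. by move=> /smoothP cf /smoothP cg; apply/smoothP => n; exact: ckM. Qed.

Lemma smoothD f g : smooth f -> smooth g -> smooth (fun x => f x + g x).
Proof. by move=> /smoothP cf /smoothP cg; apply/smoothP => n; exact: ckD. Qed.

Lemma smooth_cst c : smooth (cst c : E -> R).
Proof. by apply/smoothP => n; exact: ck_cst. Qed.

Lemma smooth_affine f (a : R) b : smooth f -> smooth (fun x => f (a *: x + b)).
Proof. by move=> /smoothP cf; apply/smoothP => n; exact: ck_affine. Qed.

Lemma smooth_is_derive f i x : smooth f -> is_derive x (e_ i) f ('D_(e_ i) f x).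
Proof. by move=> /(@smooth_ck f 1) cf; exact: ck_derive cf. Qed.

Lemma smooth_continuous f : smooth f -> continuous f.
Proof. by move=> sf; case: (sf [::]). Qed.

Lemma smooth_pderive f s : smooth f -> smooth (pderive s f).
Proof. by move=> sf; elim: s => [|i s IHs]; [exact: sf|exact: (@smooth_derive (pderive s f))]. Qed.

Lemma vanish_derive M f i : vanish_outside M f -> vanish_outside M (fun x => 'D_(e_ i) f x).
Proof.
move=> fM x Mx; rewrite -[RHS](derive_cst (0 : R) x (e_ i)).
apply: near_eq_derive.
have o : open [set y : E | M < `|y|].
  rewrite (_ : [set y | _] = (fun x : E => `|x|) @^-1` [set t | M < t])//.
  by apply: open_comp => [y _|]; [exact: norm_continuous|exact: open_gt].
by have := open_nbhs_nbhs (conj o Mx); apply: filterS => y /fM.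
Qed.

Lemma vanishW M M' f : M <= M' -> vanish_outside M f -> vanish_outside M' f.
Proof. by move=> MM fM x /(le_lt_trans MM)/fM. Qed.

Lemma vanish_comb M (a : R) f g : vanish_outside M f -> vanish_outside M g ->
  vanish_outside M (fun x => a * f x + g x).
Proof. by move=> fM gM x Mx; rewrite fM// gM// mulr0 addr0. Qed.

Lemma vanish_affine M f (a : R) b : a != 0 -> vanish_outside M f ->
  vanish_outside (`|a|^-1 * (M + `|b|)) (fun x => f (a *: x + b)).
Proof.
move=> a0 fM x; rewrite ltr_pdivrMl ?normr_gt0// => H; apply: fM.
move: H; rewrite -normrZ => H.
have := ler_normD (a *: x + b) (- b); rewrite addrK normrN => H'.
lra.
Qed.

Lemma testD f g (a : R) : test_function f -> test_function g -> test_function (fun x => a * f x + g x).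
Proof.
move=> /test_functionP[sf [M M0 fM]] /test_functionP[sg [N N0 gN]]; apply/test_functionP; split.
  exact: (smoothD (smoothM (smooth_cst a) sf) sg).
exists (Num.max M N); first by rewrite le_max M0.
by apply: vanish_comb; [apply: vanishW fM|apply: vanishW gN]; rewrite le_max lexx ?orbT.
Qed.

Lemma test_affine f (a : R) b : a != 0 -> test_function f -> test_function (fun x => f (a *: x + b)).
Proof.
move=> a0 /test_functionP[sf [M M0 fM]]; apply/test_functionP; split; first exact: smooth_affine.
exists (`|a|^-1 * (M + `|b|)); last exact: vanish_affine.
by rewrite mulr_ge0 ?invr_ge0// addr_ge0.
Qed.

Lemma testM f g : smooth f -> test_function g -> test_function (fun x => f x * g x).
Proof.
move=> sf /test_functionP[sg [M M0 gM]]; apply/test_functionP; split; first exact: smoothM.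
by exists M => // x Mx; rewrite gM// mulr0.
Qed.

Lemma test_derive f i : test_function f -> test_function (fun x => 'D_(e_ i) f x).
Proof.
move=> /test_functionP[sf [M M0 fM]]; apply/test_functionP; split; first exact: smooth_derive.
by exists M => //; exact: vanish_derive.
Qed.

Lemma test_pderive f s : test_function f -> test_function (pderive s f).
Proof. by move=> tf; elim: s => // i s IHs; exact: (test_derive i IHs). Qed.

Lemma continuous_vanish_bounded M f : continuous f -> vanish_outside M f ->
  exists2 C, 0 <= C & forall x, `|f x| <= C.
Proof.
move=> cf fM; have cK : compact (f @` [set x : E | `|x| <= M]).
  apply: continuous_compact (@compact_norm_le M).
  by apply: continuous_subspaceT => x; exact: cf.
have [C C0 H] := compact_norm_bounded cK; exists C => // x.
have [xM|/fM ->] := leP `|x| M; last by rewrite normr0.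
by apply: H; exists x.
Qed.

Lemma continuous_vanish_uniform M f : continuous f -> vanish_outside M f ->
  forall e, 0 < e -> exists2 c, 0 < c & forall x y, `|x - y| < c -> `|f x - f y| <= e.
Proof.
move=> cf fM e e0; have cf' : forall x : E, `|x| <= M + 1 -> {for x, continuous f} by move=> x _; exact: cf.
have [c c0 H] := heine_cantor (@compact_norm_le (M + 1)) cf' e0.
exists (Num.min c 1); first by rewrite lt_min c0 ltr01.
move=> x y; rewrite lt_min => /andP[xyc xy1].
have [xM|xM] := leP `|x| (M + 1); first exact: H.
have yM : M < `|y| by have := ler_distD 0 x y; have := ler_normB y (y - x); rewrite opprB addrC subrK (distrC y); lra.
by rewrite fM ?fM ?subrr ?normr0 ?ltW// (lt_trans _ xM)// ltrDl.
Qed.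

(** Upper bounds replace [Cnorm], whose supremum is informative only once a bound is known;
    [pderiv_boundCnorm] and [Cnorm_bound] translate between the two. *)
Definition pderiv_bound (N : nat) f (B : R) :=
  forall s x, (size s <= N)%N -> `|pderive s f x| <= B.

Lemma pderiv_bound_exists f N : test_function f -> exists2 B, 0 <= B & pderiv_bound N f B.
Proof.
elim: N f => [|N IHN] f tf.
  have [sf [M M0 fM]] := (test_functionP f).1 tf.
  have [C C0 fC] := continuous_vanish_bounded (smooth_continuous sf) fM.
  by exists C => // s x; rewrite leqn0 => /nilP ->; exact: fC.
have [B0 B00 fB] := IHN _ tf.
have /choice [B HB] : forall i, exists B, 0 <= B /\ pderiv_bound N (fun x => 'D_(e_ i) f x) B.
  by move=> i; have [B ? ?] := IHN _ (test_derive i tf); exists B.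
have sB i : B i <= \sum_j B j.
  by rewrite (bigD1 i)//= lerDl sumr_ge0// => j _; case: (HB j).
exists (B0 + \sum_i B i); first by rewrite addr_ge0// sumr_ge0// => i _; case: (HB i).
move=> s x; case/lastP: s => [|s i].
  by move=> _; rewrite (le_trans (fB [::] x _))// lerDl sumr_ge0// => i _; case: (HB i).
rewrite size_rcons ltnS => sN; rewrite pderive_rcons.
by have [_ /(_ s x sN)/le_trans] := HB i; apply; rewrite (le_trans (sB i))// lerDr.
Qed.

Lemma pderiv_uniform f N : test_function f -> forall e, 0 < e -> exists2 c, 0 < c &
  forall s x y, (size s <= N)%N -> `|x - y| < c -> `|pderive s f x - pderive s f y| <= e.
Proof.
elim: N f => [|N IHN] f tf e e0.
  have [sf [M M0 fM]] := (test_functionP f).1 tf.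
  have [c c0 fc] := continuous_vanish_uniform (smooth_continuous sf) fM e0.
  by exists c => // s x y; rewrite leqn0 => /nilP ->; exact: fc.
have [c0 c00 fc] := IHN _ tf e e0.
have /choice [c Hc] : forall i, exists c, 0 < c /\ forall s x y, (size s <= N)%N -> `|x - y| < c ->
   `|pderive s (fun x => 'D_(e_ i) f x) x - pderive s (fun x => 'D_(e_ i) f x) y| <= e.
  by move=> i; have [c ? ?] := IHN _ (test_derive i tf) e e0; exists c.
exists (\big[Num.min/c0]_i c i).
  by elim/big_ind: _ => // [a b a0 b0|i _]; [rewrite lt_min a0|case: (Hc i)].
move=> s x y; case/lastP: s => [_|s i].
  by move=> H; apply: fc => //; apply: lt_le_trans H _; exact: bigmin_le_id.
rewrite size_rcons ltnS => sN H; rewrite pderive_rcons.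
by have [_] := Hc i; apply=> //; apply: lt_le_trans H _; exact: bigmin_le_cond.
Qed.

Lemma derive_comb f g (a : R) i x : smooth f -> smooth g ->
  'D_(e_ i) (fun z => a * f z + g z) x = a * 'D_(e_ i) f x + 'D_(e_ i) g x.
Proof.
move=> sf sg; have [] := is_deriveD (is_deriveZ a (smooth_is_derive i x sf)) (smooth_is_derive i x sg).
by move=> _ ->.
Qed.

Lemma pderive_affine f (a : R) b s : smooth f ->
  pderive s (fun z => f (a *: z + b)) = (fun x => a ^+ size s * pderive s f (a *: x + b)).
Proof.
move=> sf; elim: s => [|i s IHs]; first by apply/funext => x; rewrite /= mul1r.
apply/funext => x; rewrite /= IHs.
have sp := smooth_pderive s sf.
have [_ ->] := is_deriveZ (a ^+ size s) (is_derive_affine (smooth_is_derive i (a *: x + b) sp)).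
by rewrite [LHS]mulrA exprSr.
Qed.

Lemma pderive_comb f g (a : R) s : smooth f -> smooth g ->
  pderive s (fun z => a * f z + g z) = (fun x => a * pderive s f x + pderive s g x).
Proof.
move=> sf sg; elim: s => // i s IHs; apply/funext => x.
rewrite /= IHs derive_comb; [by []| |]; exact: smooth_pderive.
Qed.

Lemma pderiv_bound_comb N f g (a B C : R) : smooth f -> smooth g ->
  pderiv_bound N f B -> pderiv_bound N g C -> pderiv_bound N (fun z => a * f z + g z) (`|a| * B + C).
Proof.
move=> sf sg fB gC s x sN; rewrite pderive_comb// (le_trans (ler_normD _ _))//.
by rewrite normrM lerD//; [rewrite ler_wpM2l// fB|exact: gC].
Qed.

Lemma pderiv_bound_derive N f B i : pderiv_bound N.+1 f B ->
  pderiv_bound N (fun x => 'D_(e_ i) f x) B.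
Proof. by move=> fB s x sN; rewrite -pderive_rcons; apply: fB; rewrite size_rcons. Qed.

(** By the Leibniz rule every derivation at most doubles the number of products, whence [2 ^+ N]. *)
Lemma pderiv_boundM N f g B C : smooth f -> smooth g ->
  pderiv_bound N f B -> pderiv_bound N g C -> pderiv_bound N (fun z => f z * g z) (2 ^+ N * (B * C)).
Proof.
elim: N f g B C => [|N IHN] f g B C sf sg fB gC s x.
  rewrite leqn0 => /nilP -> /=; rewrite mul1r normrM.
  by apply: ler_pM => //; [exact: (fB [::])|exact: (gC [::])].
have BC0 : 0 <= B * C.
  by apply: mulr_ge0; [apply: le_trans (fB [::] x _)|apply: le_trans (gC [::] x _)].
case/lastP: s => [_|s i].
  rewrite /= normrM (le_trans (ler_pM _ _ (fB [::] x _) (gC [::] x _)))//.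
  by rewrite ler_peMl// exprn_ege1// ler1n.
rewrite size_rcons ltnS => sN; rewrite pderive_rcons.
rewrite (_ : (fun x => _) = (fun x => 1 * (f x * 'D_(e_ i) g x) + g x * 'D_(e_ i) f x)); last first.
  apply/funext => z; rewrite mul1r.
  by have [_ ->] := is_deriveM (smooth_is_derive i z sf) (smooth_is_derive i z sg).
have lowB h D : pderiv_bound N.+1 h D -> pderiv_bound N h D.
  by move=> hD t y tN; apply: hD; exact: leqW.
rewrite exprS -mulrA mulr_natl mulr2n -[X in _ <= X + _]mul1r -{2}[1]normr1.
have sDf := smooth_derive i sf; have sDg := smooth_derive i sg.
have b1 := IHN _ _ _ _ sf sDg (lowB _ _ fB) (pderiv_bound_derive i gC).
have b2 := IHN _ _ _ _ sg sDf (lowB _ _ gC) (pderiv_bound_derive i fB).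
rewrite (mulrC C) in b2.
exact: (@pderiv_bound_comb N _ _ 1 _ _ (smoothM sf sDg) (smoothM sg sDf) b1 b2 s x sN).
Qed.

Lemma smooth_is_derive_line f i x (t : R) : smooth f ->
  is_derive t 1 (fun s : R => f (s *: e_ i + x)) ('D_(e_ i) f (t *: e_ i + x)).
Proof.
move=> sf; have /is_derive_line H := smooth_is_derive i (t *: e_ i + x) sf.
rewrite (_ : (fun s : R => _) = (fun s : R => f (s *: e_ i + (t *: e_ i + x))) \o (fun s : R => s - t)); last first.
  by apply/funext => s /=; congr f; lmodule.
rewrite -[X in is_derive _ _ _ X]mulr1; apply: is_derive1_comp; first by rewrite subrr.
by apply: is_derive_eq; rewrite subr0.
Qed.

Lemma is_derive1_continuous (k k' : R -> R) : (forall t : R, is_derive t 1 k (k' t)) -> continuous k.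
Proof. by move=> kk t; have [/derivable1_diffP/differentiable_continuous] := kk t. Qed.

Lemma smooth_MVT f i x h : smooth f -> 0 < h ->
  exists2 c, 0 < c < h & f (h *: e_ i + x) - f x = 'D_(e_ i) f (c *: e_ i + x) * h.
Proof.
move=> sf h0.
have [||c] := @MVT R (fun s : R => f (s *: e_ i + x)) (fun s : R => 'D_(e_ i) f (s *: e_ i + x)) 0 h h0.
- by move=> t _; exact: smooth_is_derive_line.
- by apply: continuous_subspaceT; apply: is_derive1_continuous => t; exact: smooth_is_derive_line.
by rewrite in_itv /= scale0r add0r subr0; exists c.
Qed.

Lemma smooth_second_difference f i j x h : smooth f -> 0 < h ->
  exists s t : R, [/\ 0 < s < h, 0 < t < h &
  f (h *: e_ i + (h *: e_ j + x)) - f (h *: e_ i + x) - (f (h *: e_ j + x) - f x) =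
  'D_(e_ j) (fun y => 'D_(e_ i) f y) (t *: e_ j + (s *: e_ i + x)) * h * h].
Proof.
move=> sf h0.
pose g (s : R) := f (s *: e_ i + (h *: e_ j + x)) - f (s *: e_ i + x).
pose g' (s : R) := 'D_(e_ i) f (s *: e_ i + (h *: e_ j + x)) - 'D_(e_ i) f (s *: e_ i + x).
have dg (t : R) : is_derive t 1 g (g' t).
  exact: is_deriveB (smooth_is_derive_line i _ t sf) (smooth_is_derive_line i _ t sf).
have [|s] := @MVT R g g' 0 h h0 (fun t _ => dg t).
  by apply: continuous_subspaceT; exact: is_derive1_continuous dg.
rewrite in_itv /= subr0 {2}/g !scale0r !add0r => sh ->.
have [t th] := smooth_MVT j (s *: e_ i + x) (smooth_derive i sf) h0.
rewrite (_ : h *: _ + _ = s *: e_ i + (h *: e_ j + x)); last by lmodule.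
by rewrite /g' => ->; exists s, t.
Qed.

Lemma small_combination i j x (h c s t : R) : 0 < s < h -> 0 < t < h -> h + h <= c ->
  ball x c (t *: e_ j + (s *: e_ i + x)).
Proof.
move=> /andP[s0 sh] /andP[t0 th] hc.
have c0 : 0 < c by lra.
apply/ball_rV_coord => // k; rewrite !mxE /=.
case: (k == i); case: (k == j); rewrite /= ?mulr1 ?mulr0 ltr_norml; apply/andP; split; lra.
Qed.

Lemma continuous_ball f x e : continuous f -> 0 < e ->
  exists2 c, 0 < c & forall y, ball x c y -> `|f y - f x| < e.
Proof.
move=> cf e0; have /cvgrPdist_lt/(_ _ e0) := cf x.
by move=> /nbhs_ballP[c c0 H]; exists c => // y /H /=; rewrite distrC.
Qed.

(** Schwarz's theorem. The second difference over a square of side [h] is symmetric in [i] and [j];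
    by the mean value theorem it is [h * h] times either mixed derivative at some point close to
    [x], and both are continuous at [x]. *)
Lemma smooth_derive_comm f i j x : smooth f ->
  'D_(e_ j) (fun y => 'D_(e_ i) f y) x = 'D_(e_ i) (fun y => 'D_(e_ j) f y) x.
Proof.
move=> sf; apply/eqP; rewrite -subr_eq0 -normr_le0; apply/ler_addgt0Pr => e e0; rewrite add0r.
have conclude (k p p' a b : R) : 0 < k -> p * k * k = p' * k * k ->
    `|p - a| < e / 2 -> `|p' - b| < e / 2 -> `|a - b| <= e.
  move=> k0 /(mulIf (lt0r_neq0 k0))/(mulIf (lt0r_neq0 k0)) ->.
  by rewrite !ltr_norml ler_norml => /andP[? ?] /andP[? ?]; apply/andP; split; lra.
have e20 : 0 < e / 2 by rewrite divr_gt0.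
have near_x k l : exists2 c, 0 < c & forall y, ball x c y ->
    `|'D_(e_ l) (fun y => 'D_(e_ k) f y) y - 'D_(e_ l) (fun y => 'D_(e_ k) f y) x| < e / 2.
  exact: continuous_ball (smooth_continuous (smooth_derive l (smooth_derive k sf))) e20.
have [c c0 Hc] := near_x i j.
have [c' c'0 Hc'] := near_x j i.
pose h := Num.min c c' / 2.
have m0 : 0 < Num.min c c' by rewrite lt_min c0.
have h0 : 0 < h by rewrite divr_gt0.
have hh : h + h = Num.min c c' by rewrite /h; lra.
have [s [t [sh th E1]]] := smooth_second_difference i j x sf h0.
have [s' [t' [sh' th' E2]]] := smooth_second_difference j i x sf h0.
have b1 : ball x c (t *: e_ j + (s *: e_ i + x)).
  by apply: small_combination sh th _; rewrite hh ge_min lexx.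
have b2 : ball x c' (t' *: e_ i + (s' *: e_ j + x)).
  by apply: small_combination sh' th' _; rewrite hh ge_min lexx orbT.
have sym : f (h *: e_ j + (h *: e_ i + x)) - f (h *: e_ j + x) - (f (h *: e_ i + x) - f x) =
    f (h *: e_ i + (h *: e_ j + x)) - f (h *: e_ i + x) - (f (h *: e_ j + x) - f x).
  rewrite (_ : h *: e_ j + (h *: e_ i + x) = h *: e_ i + (h *: e_ j + x)); last by lmodule.
  by ring.
exact: (conclude _ _ _ _ _ h0 (etrans (esym E1) (etrans (esym sym) E2)) (Hc _ b1) (Hc' _ b2)).
Qed.

Lemma pderive_derive f i s : smooth f ->
  pderive s (fun x => 'D_(e_ i) f x) = (fun x => 'D_(e_ i) (pderive s f) x).
Proof.
move=> sf; elim: s => // j s IHs; apply/funext => x /=; rewrite IHs.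
by rewrite smooth_derive_comm; [by []|exact: smooth_pderive].
Qed.

Lemma pderiv_boundCnorm N f B : 0 <= B -> pderiv_bound N f B -> 0 <= Cnorm N f <= B.
Proof.
move=> B0 fB; have ub : ubound [set y | exists s (x : E), (size s <= N)%N /\ y = `|pderive s f x|] B.
  by move=> _ [s [x [sN ->]]]; exact: fB.
apply/andP; split.
  apply: le_trans (ub_le_sup _ _); last by exists [::], 0.
    exact: normr_ge0.
  by exists B.
by apply: ge_sup => //; exists `|pderive [::] f 0|, [::], 0.
Qed.

Lemma Cnorm_bound N f : test_function f -> pderiv_bound N f (Cnorm N f).
Proof.
move=> tf; have [B B0 fB] := pderiv_bound_exists N tf.
move=> s x sN; apply: ub_le_sup; last by exists s, x.
by exists B => _ [t [y [tN ->]]]; exact: fB.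
Qed.

End test_functions.

(** * Integrals over row vectors *)

Section integration.
Context (R : realType) (d : nat).
Local Notation E := 'rV[R]_d.
Local Notation leb := (lebesgue_rV R d).
Implicit Types (f g : E -> R) (x y : E) (M C : R).

Lemma norm_rV_le x (r : R) : 0 <= r -> (`|x| <= r <-> forall i, `|x ord0 i| <= r).
Proof.
move=> r0; rewrite /Num.norm /= mx_normrE; split=> [H i|H].
  by apply: le_trans H; apply: (le_bigmax _ (fun ij => `|x ij.1 ij.2|) (ord0, i)).
apply/bigmax_leP; split; first exact: r0.
by move=> [i j] _ /=; rewrite (ord1 i); exact: H.
Qed.

Lemma measurable_norm_le M : measurable [set x : E | `|x| <= M].
Proof. by apply: closed_measurable_rV; exact: closed_norm_le. Qed.

Lemma lebesgue_norm_le M : 0 <= M -> leb [set x : E | `|x| <= M] = ((2 * M) ^+ d)%:E.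
Proof.
move=> M0; rewrite -lebesgue_box//; congr (leb _).
by apply/seteqP; split=> x /=; [move/(norm_rV_le _ M0).1|move/(norm_rV_le _ M0).2].
Qed.

Lemma integrable_bounded f C M : measurable_fun setT f -> (forall x, `|f x| <= C) ->
  0 <= M -> vanish_outside M f -> leb.-integrable setT (EFin \o f).
Proof.
move=> mf fC M0 fM.
have C0 : 0 <= C by exact: le_trans (normr_ge0 _) (fC 0).
apply/integrableP; split; first exact/measurable_EFinP.
apply: (@le_lt_trans _ _ (\int[leb]_x (C%:E * (\1_[set x : E | (`|x| <= M)%R] x)%:E))%E).
  apply: ge0_le_integral => //.
  - by apply: measurableT_comp => //; exact/measurable_EFinP.

  - apply: emeasurable_funM => //; apply/measurable_EFinP.
    by apply: measurable_indic; exact: measurable_norm_le.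
  - move=> x _ /=; rewrite indicE -EFinM lee_fin.
    have [xM|/fM ->] := leP `|x| M; last by rewrite normr0 mulr_ge0.
    by rewrite mem_set// mulr1.
rewrite ge0_integralZl//; last first.
  by apply/measurable_EFinP; apply: measurable_indic; exact: measurable_norm_le.
rewrite integral_indic//; last exact: measurable_norm_le.
by rewrite setIT [X in (_ * X)%E](lebesgue_norm_le M0) -EFinM ltry.
Qed.

Lemma integrable_continuous f M : continuous f -> 0 <= M -> vanish_outside M f ->
  leb.-integrable setT (EFin \o f).
Proof.
move=> cf M0 fM; have [C _ fC] := continuous_vanish_bounded cf fM.
by apply: integrable_bounded fC M0 fM; exact: continuous_measurable_rV.
Qed.

Lemma integrable_test f : test_function f -> leb.-integrable setT (EFin \o f).
Proof.
move=> /test_functionP[sf [M M0 fM]].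
by apply: integrable_continuous M0 fM; exact: smooth_continuous sf.
Qed.

Lemma integrable_mul_bounded f g C : leb.-integrable setT (EFin \o f) ->
  measurable_fun setT g -> (forall x, f x != 0 -> `|g x| <= C) ->
  leb.-integrable setT (EFin \o (fun x => f x * g x)).
Proof.
move=> intf mg gC; have /measurable_EFinP mf := measurable_int _ intf.
apply: (@le_integrable _ _ _ _ _ _ _ (EFin \o (fun x => C * f x))) => //.
- by apply/measurable_EFinP; exact: measurable_funM.
- move=> x _ /=; rewrite lee_fin !normrM mulrC.
  have [->|fx] := eqVneq (f x) 0; first by rewrite normr0 !mulr0.
  by rewrite ler_wpM2r// (le_trans (gC _ fx))// ler_norm.
- exact: (@integrableZl _ _ _ leb setT measurableT C (EFin \o f) intf).
Qed.

Lemma Rintegral_le_norm f g C : leb.-integrable setT (EFin \o f) ->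
  measurable_fun setT g -> (forall x, f x != 0 -> `|g x| <= C) ->
  `|\int[leb]_x (f x * g x)| <= C * \int[leb]_x `|f x|.
Proof.
move=> intf mg gC; have intfg := integrable_mul_bounded intf mg gC.
rewrite (le_trans (le_normr_Rintegral measurableT intfg))//.
have intn := integrable_norm intf.
rewrite -RintegralZl//.
apply: le_Rintegral => //.
- by have := integrable_norm intfg; apply: eq_integrable.
- apply: (@integrableZl _ _ _ leb setT measurableT C (fun x => `|f x|%:E)).
  by have := integrable_norm intf; apply: eq_integrable.
- move=> x _; rewrite normrM mulrC.
  have [->|fx] := eqVneq (f x) 0; first by rewrite normr0 !mulr0.
  by rewrite ler_wpM2r// gC.
Qed.

Lemma Rintegral_affine f (c : R) b : 0 < c -> leb.-integrable setT (EFin \o f) ->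
  c ^+ d * \int[leb]_x f (c *: x + b) = \int[leb]_x f x.
Proof.
move=> c0 intf; have mf := measurable_int _ intf.
pose h := EFin \o f.
have posE : ((c ^+ d)%:E * \int[leb]_x h^\+ (c *: x + b)%R = \int[leb]_x h^\+ x)%E.
  by apply: ge0_integral_affine => //; exact: measurable_funepos.
have negE : ((c ^+ d)%:E * \int[leb]_x h^\- (c *: x + b)%R = \int[leb]_x h^\- x)%E.
  by apply: ge0_integral_affine => //; exact: measurable_funeneg.
have -> : \int[leb]_x f x = fine (\int[leb]_x h^\+ x - \int[leb]_x h^\- x)%E.
  by rewrite /Rintegral integralE.
have -> : \int[leb]_x f (c *: x + b) =
    fine (\int[leb]_x h^\+ (c *: x + b)%R - \int[leb]_x h^\- (c *: x + b)%R)%E.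
  by rewrite /Rintegral integralE; congr (fine (_ - _)%E); apply: eq_integral => x _;
    rewrite ?funeposE ?funenegE.
rewrite -posE -negE.
have fin_of (a : \bar R) : (0 <= a)%E -> ((c ^+ d)%:E * a < +oo)%E -> a \is a fin_num.
  case: a => [r| |]//= _.
  by rewrite gt0_muley ?ltxx// lte_fin exprn_gt0.
have posF : (\int[leb]_x h^\+ (c *: x + b)%R)%E \is a fin_num.
  apply: fin_of; first exact: integral_ge0.
  by rewrite posE; exact: integral_funepos_lt_pinfty intf.
have negF : (\int[leb]_x h^\- (c *: x + b)%R)%E \is a fin_num.
  apply: fin_of; first exact: integral_ge0.
  by rewrite negE; exact: integral_funeneg_lt_pinfty intf.

by rewrite -(fineK posF) -(fineK negF) -EFinB -!EFinM -EFinB /= mulrBr.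
Qed.

End integration.

(** * Convolution of a distribution with a test function *)

Section smooth_convolution.
Context (R : realType) (d : nat).
Local Notation E := 'rV[R]_d.
Local Notation e_ i := (delta_mx ord0 i : E).
Implicit Types (f g psi : E -> R) (x y : E) (M C B : R) (s : seq 'I_d).

Lemma mul_div_succ_le (C e : R) : 0 <= C -> 0 <= e -> C * (e / (C + 1)) <= e.
Proof.
move=> C0 e0; have C1 : 0 < C + 1 by rewrite ltr_wpDl.
by rewrite mulrA ler_pdivrMr// mulrC ler_wpM2l// lerDl.
Qed.

Lemma norm_delta_rV i (c : R) : `|c *: e_ i| <= `|c|.
Proof.
apply/norm_rV_le => // j; rewrite !mxE /= normrM.
by rewrite ler_piMr//; case: (j == i); rewrite ?normr1 ?normr0.
Qed.

Lemma smooth_MVT_signed f i x (h : R) : smooth f ->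
  exists2 c : R, `|c| <= `|h| & f (h *: e_ i + x) - f x = 'D_(e_ i) f (c *: e_ i + x) * h.
Proof.
move=> sf; have [h0|h0|h0] := ltgtP h 0.
- have h0' : 0 < - h by rewrite oppr_gt0.
  have [c /andP[c0 ch] cE] := smooth_MVT i (h *: e_ i + x) sf h0'.
  exists (c + h); first by rewrite ler_norml (ltr0_norm h0); apply/andP; split; lra.
  rewrite (_ : - h *: _ + _ = x) in cE; last by lmodule.
  rewrite (_ : (c + h) *: _ + _ = c *: e_ i + (h *: e_ i + x)); last by lmodule.
  by rewrite -[LHS]opprB cE mulrN opprK.
- have [c /andP[c0 ch] cE] := smooth_MVT i x sf h0.
  by exists c => //; rewrite !ger0_norm// ltW.
- by exists 0; rewrite h0 // scale0r add0r subrr mulr0.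
Qed.

Lemma reflectE psi x : (fun y => psi (x - y)) = (fun y => psi (-1 *: y + x)).
Proof. by apply/funext => y; rewrite scaleN1r addrC. Qed.

Lemma test_reflect psi x : test_function psi -> test_function (fun y => psi (x - y)).
Proof. by rewrite reflectE; apply: test_affine; rewrite oppr_eq0 oner_eq0. Qed.

Lemma pderive_reflect psi x s : smooth psi ->
  pderive s (fun y => psi (x - y)) = (fun y => (-1) ^+ size s * pderive s psi (x - y)).
Proof.
move=> sp; rewrite reflectE pderive_affine; last exact: sp.
by apply/funext => y; rewrite scaleN1r addrC.
Qed.

Lemma pderiv_bound_reflect N psi x B : smooth psi -> pderiv_bound N psi B ->
  pderiv_bound N (fun y => psi (x - y)) B.
Proof.
move=> sp pB s y sN; rewrite pderive_reflect; last exact: sp.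
by rewrite normrM normrX normrN1 expr1n mul1r; exact: pB.
Qed.

Lemma vanish_reflect psi x M : vanish_outside M psi -> vanish_outside (M + `|x|) (fun y => psi (x - y)).
Proof. by move=> pM y My; apply: pM; have := lerB_dist y x; rewrite distrC; lra. Qed.

Variable q : schwartz_distribution R d.

Lemma dist_bound M : exists C (N : nat), 0 <= C /\ forall f B, test_function f ->
  vanish_outside M f -> 0 <= B -> pderiv_bound N f B -> `|q f| <= C * B.
Proof.
have [C [N HC]] := distribution_continuous q (@compact_norm_le R d M).
exists `|C|, N; split=> // f B tf fM B0 fB.
rewrite (le_trans (HC f tf (supp_sub fM)))//.
have /andP[c0 cB] := pderiv_boundCnorm B0 fB.
by rewrite (le_trans (ler_wpM2r c0 (ler_norm C)))// ler_wpM2l.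
Qed.

Lemma conv_bound M : exists C (N : nat), 0 <= C /\ forall g x B, test_function g ->
  vanish_outside M g -> `|x| <= M -> 0 <= B -> pderiv_bound N g B -> `|convolution q g x| <= C * B.
Proof.
have [C [N [C0 H]]] := dist_bound (M + M); exists C, N; split=> // g x B tg gM xM B0 gB.
apply: H => //; first exact: test_reflect.
  by apply: vanishW (vanish_reflect gM); rewrite lerD2l.
by apply: pderiv_bound_reflect => //; have /test_functionP[] := tg.
Qed.

Lemma conv_comb f g (a : R) x : test_function f -> test_function g ->
  convolution q (fun y => a * f y + g y) x = a * convolution q f x + convolution q g x.
Proof.
move=> tf tg; rewrite /convolution; apply: (distribution_linear q a); exact: test_reflect.
Qed.

Lemma test_translate f x : test_function f -> test_function (fun y => f (x + y)).
Proof.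
move=> tf; rewrite (_ : (fun y => _) = (fun y => f (1 *: y + x))).
  exact: test_affine (oner_neq0 _) tf.
by apply/funext => y; rewrite scale1r addrC.
Qed.

Lemma pderive_translate f x s : smooth f ->
  pderive s (fun y => f (x + y)) = (fun y => pderive s f (x + y)).
Proof.
move=> sf; rewrite (_ : (fun y => f _) = (fun y => f (1 *: y + x))).
  by rewrite pderive_affine; [apply/funext => y; rewrite expr1n mul1r scale1r addrC|exact: sf].
by apply/funext => y; rewrite scale1r addrC.
Qed.

Lemma vanish_translate f x M : vanish_outside M f -> vanish_outside (M + `|x|) (fun y => f (x + y)).
Proof. by move=> fM y My; apply: fM; have := ler_normB (x + y) x; rewrite addrC addKr; lra. Qed.

Lemma conv_translate f x y : convolution q f (x + y) = convolution q (fun z => f (x + z)) y.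
Proof. by rewrite /convolution; congr (q _); apply/funext => z; rewrite addrA. Qed.

(** A small translation changes all derivatives of [psi] up to order [N] uniformly little, and the
    translates stay supported in one ball, so a single continuity estimate of [q] applies. *)
Lemma conv_continuous psi : test_function psi -> continuous (convolution q psi).
Proof.
move=> tp x; have [sp [M M0 pM]] := (test_functionP psi).1 tp.
have [C [N [C0 H]]] := conv_bound (M + `|x| + 1).
apply/(@cvgrPdist_le _ _ _ (nbhs x)) => e e0; have C10 : 0 < C + 1 by rewrite ltr_wpDl.
have [c c0 Hc] := pderiv_uniform N tp (divr_gt0 e0 C10).
have m0 : 0 < Num.min c 1 by rewrite lt_min c0 ltr01.
have := near_dist_lt x m0; apply: filterS => y; rewrite lt_min => /andP[xyc xy1].
pose v := y - x.
have -> : convolution q psi y = convolution q (fun z => psi (v + z)) x.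
  by rewrite -conv_translate /v subrK.
have tv := test_translate v tp.
rewrite distrC (_ : _ - _ = convolution q (fun z => -1 * psi z + psi (v + z)) x); last first.
  by rewrite conv_comb//; ring.
have vn : `|v| = `|x - y| by rewrite distrC.
have H' := H (fun z => -1 * psi z + psi (v + z)) x (e / (C + 1)).
apply: le_trans (H' _ _ _ _ _) _.
- exact: testD.
- apply: vanish_comb; first by apply: vanishW pM; rewrite -addrA lerDl addr_ge0.
  by apply: vanishW (vanish_translate pM); rewrite -addrA lerD2l vn (le_trans (ltW xy1))// lerDr.
- by rewrite -addrA addrCA lerDl addr_ge0.
- by rewrite divr_ge0 // ltW.
- move=> s z sN; rewrite pderive_comb; [|exact: sp|by have /test_functionP[] := tv].
  rewrite pderive_translate; last exact: sp.
  rewrite mulN1r addrC; apply: Hc => //.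
  by rewrite addrK vn.
- by apply: mul_div_succ_le => //; exact: ltW.
Qed.

(** The first-order remainder of [psi] in direction [i], differentiated up to order [N], is at most
    a small multiple of [|h|] by the mean value theorem and uniform continuity. Commuting
    derivatives is what lets the theorem be applied to [pderive s psi]. *)
Lemma conv_is_derive psi i x : test_function psi ->
  is_derive x (e_ i) (convolution q psi) (convolution q (fun y => 'D_(e_ i) psi y) x).
Proof.
move=> tp; have [sp [M M0 pM]] := (test_functionP psi).1 tp.
have [C [N [C0 H]]] := conv_bound (M + `|x| + 1).
apply/is_derive_line/has_derP => e e0; have C10 : 0 < C + 1 by rewrite ltr_wpDl.
have tD := test_derive i tp.
have [c c0 Hc] := pderiv_uniform N tD (divr_gt0 e0 C10).
have m0 : 0 < Num.min c 1 by rewrite lt_min c0 ltr01.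
have := near_dist_lt (0 : R) m0; apply: filterS => h; rewrite sub0r normrN lt_min => /andP[hc h1].
rewrite subr0 scale0r add0r.
have tv := test_translate (h *: e_ i) tp.
pose g z := -1 * psi z + psi (h *: e_ i + z).
have tg : test_function g by exact: testD.
rewrite (_ : _ - _ = convolution q (fun z => - h * 'D_(e_ i) psi z + g z) x); last first.
  by rewrite conv_comb// conv_comb// conv_translate -[h *: convolution _ _ _]/(h * _); ring.
have vn : `|h *: e_ i| <= 1 by rewrite (le_trans (norm_delta_rV i h))// ltW.
have H' := H (fun z => - h * 'D_(e_ i) psi z + g z) x (e / (C + 1) * `|h|).
apply: le_trans (H' _ _ _ _ _) _.
- exact: testD.
- have lM : M <= M + `|x| + 1 by rewrite -addrA lerDl addr_ge0.
  apply: vanish_comb; first exact: (vanishW lM (vanish_derive i pM)).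
  apply: vanish_comb; first exact: vanishW lM pM.
  by apply: vanishW (vanish_translate pM); rewrite -addrA lerD2l (le_trans vn)// lerDr.
- by rewrite -addrA addrCA lerDl addr_ge0.
- by rewrite mulr_ge0// divr_ge0// ltW.
- move=> s z sN.
  have sD : smooth (fun y => 'D_(e_ i) psi y) by exact: smooth_derive.
  have sv : smooth (fun z => psi (h *: e_ i + z)) by have /test_functionP[] := tv.
  have sg : smooth g by have /test_functionP[] := tg.
  rewrite (pderive_comb _ _ sD sg) (pderive_comb _ _ sp sv) (pderive_translate _ _ sp).
  have [t th E1] := smooth_MVT_signed i z h (smooth_pderive s sp).
  rewrite mulN1r (addrC (- _)) E1 (pderive_derive _ _ sp) mulNr addrC (mulrC _ h) -mulrBr normrM mulrC.
  rewrite ler_wpM2r//; have := Hc s (t *: e_ i + z) z sN; rewrite (pderive_derive _ _ sp); apply.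
  by rewrite addrK (le_lt_trans (norm_delta_rV i t))// (le_lt_trans th).
- by rewrite mulrA ler_wpM2r//; apply: mul_div_succ_le => //; exact: ltW.
Qed.

Lemma conv_smooth psi : test_function psi -> smooth (convolution q psi).
Proof.
move=> tp; apply/smoothP => n; elim: n psi tp => [|n IHn] psi tp.
  by split=> //; exact: conv_continuous.
apply: (@ckS _ _ n _ (fun i x => convolution q (fun y => 'D_(e_ i) psi y) x)).
- exact: conv_continuous.
- by move=> i x; exact: conv_is_derive.
- by move=> i; apply: IHn; exact: test_derive.
Qed.

Lemma pderive_conv psi s : test_function psi ->
  pderive s (convolution q psi) = convolution q (pderive s psi).
Proof.
move=> tp; elim: s => // i s IHs; apply/funext => x /=; rewrite IHs.
by have [] := conv_is_derive i x (test_pderive s tp).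
Qed.

End smooth_convolution.

(** * Exchanging distributions and integrals *)

Section exchange.
Context (R : realType) (d : nat).
Local Notation E := 'rV[R]_d.
Local Notation e_ i := (delta_mx ord0 i : E).
Local Notation leb := (lebesgue_rV R d).
Implicit Types (f g phi psi : E -> R) (x y : E) (M C B : R) (s : seq 'I_d).

Lemma continuous_bounded_box f M : continuous f -> exists2 C, 0 <= C & forall x, `|x| <= M -> `|f x| <= C.
Proof.
move=> cf; have cK : compact (f @` [set x : E | `|x| <= M]).
  by apply: continuous_compact (@compact_norm_le R d M); apply: continuous_subspaceT => x; exact: cf.
have [C C0 H] := compact_norm_bounded cK; exists C => // x xM.
by apply: H; exists x.
Qed.

Lemma integrable_mul_continuous f g M : leb.-integrable setT (EFin \o f) -> vanish_outside M f ->
  continuous g -> leb.-integrable setT (EFin \o (fun x => f x * g x)).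
Proof.
move=> intf fM cg; have [C C0 gC] := continuous_bounded_box M cg.
apply: (integrable_mul_bounded intf (C := C)) => [|x fx]; first exact: continuous_measurable_rV.
by apply: gC; rewrite leNgt; apply/negP => /fM f0; rewrite f0 eqxx in fx.
Qed.

Lemma integrable_mul_test f g : leb.-integrable setT (EFin \o f) -> test_function g ->
  leb.-integrable setT (EFin \o (fun x => f x * g x)).
Proof.
move=> intf /test_functionP[/smooth_continuous cg [M M0 gM]].
have [C C0 gC] := continuous_vanish_bounded cg gM.
by apply: (integrable_mul_bounded intf (C := C)) => [|x _]; [exact: continuous_measurable_rV|exact: gC].
Qed.

Section integral_distribution.
Variables (g : E -> R) (intg : leb.-integrable setT (EFin \o g)).

Let pair f := \int[leb]_x (g x * f x).

Let pair_linear (a : R) f h : test_function f -> test_function h ->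
  pair (fun x => a * f x + h x) = a * pair f + pair h.
Proof.
move=> tf th; have If := integrable_mul_test intg tf; have Ih := integrable_mul_test intg th.
rewrite /pair -RintegralZl// -RintegralD//; last exact: (@integrableZl _ _ _ leb setT measurableT a _ If).
by apply: eq_Rintegral => x _; ring.
Qed.

Let pair_continuous (K : set E) : compact K ->
  exists C (N : nat), forall f, test_function f -> supp f `<=` K -> `|pair f| <= C * Cnorm N f.
Proof.
move=> _; exists (\int[leb]_x `|g x|), 0%N => f tf _.
rewrite mulrC; apply: Rintegral_le_norm intg _ _.
  by apply: continuous_measurable_rV; have /test_functionP[/smooth_continuous] := tf.
by move=> x _; exact: (@Cnorm_bound R d 0 f tf [::] x).
Qed.

(** An integrable function seen as a distribution. Integrals with a parameter become convolutions,
    whose smoothness and derivatives are already known. *)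
Definition integral_distribution : schwartz_distribution R d :=
  SchwartzDistribution pair_linear pair_continuous.

End integral_distribution.

Section mul_distribution.
Variables (q : schwartz_distribution R d) (chi : E -> R) (tchi : test_function chi).

Let schi : smooth chi. Proof. by have /test_functionP[] := tchi. Qed.

Let mul_linear (a : R) f h : test_function f -> test_function h ->
  dist_mul chi q (fun x => a * f x + h x) = a * dist_mul chi q f + dist_mul chi q h.
Proof.
move=> tf th; rewrite /dist_mul.
rewrite -(distribution_linear q a (testM schi tf) (testM schi th)).
by congr (q _); apply/funext => x; ring.
Qed.

Let mul_continuous (K : set E) : compact K ->
  exists C (N : nat), forall f, test_function f -> supp f `<=` K -> `|dist_mul chi q f| <= C * Cnorm N f.
Proof.
move=> _; have [_ [M M0 chiM]] := (test_functionP chi).1 tchi.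
have [C [N [C0 H]]] := dist_bound q M.
have [B B0 chiB] := pderiv_bound_exists N tchi.
exists (C * (2 ^+ N * B)), N => f tf _.
have sf : smooth f by have /test_functionP[] := tf.
have fB := @Cnorm_bound R d N f tf.
have n0 : 0 <= Cnorm N f by apply: le_trans (fB [::] 0 _).
rewrite -!mulrA; apply: H; first exact: testM.
- by move=> x Mx; rewrite chiM// mul0r.
- by rewrite mulr_ge0 ?exprn_ge0// mulr_ge0.
- exact: pderiv_boundM.
Qed.

Definition mul_distribution : schwartz_distribution R d :=
  SchwartzDistribution mul_linear mul_continuous.

End mul_distribution.

(* A Riemann sum whose nodes depend only on f and on the scale c. *)
Lemma quadrature_cover (X : seq E) f M c : 0 < c -> leb.-integrable setT (EFin \o f) ->
  vanish_outside M f -> {in X, forall x, `|x| <= M} ->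
  (forall x, f x != 0 -> exists2 a, a \in X & `|a - x| < c) ->
  exists2 L : seq (R * E), {in L, forall p, `|p.2| <= M} &
  forall (Q : E -> R) (w : R), continuous Q ->
    (forall x y, `|x| <= M -> `|y| <= M -> `|x - y| < c -> `|Q x - Q y| <= w) ->
    `|\int[leb]_x (f x * Q x) - \sum_(p <- L) p.1 * Q p.2| <= w * \int[leb]_x `|f x|.
Proof.
move=> c0; elim: X f => [|a X IHX] f intf fM XM fX.
  exists [::] => // Q w cQ _; rewrite big_nil subr0.
  have f0 x : f x = 0 by apply/eqP; apply: contraT => /fX[].
  rewrite (_ : \int[leb]_x _ = 0) ?normr0; last first.
    by rewrite (eq_Rintegral _ (g := cst 0))=> [|x _]; rewrite ?Rintegral_cst ?mul0r// f0 mul0r.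
  rewrite (_ : \int[leb]_x _ = 0) ?mulr0//.
  by rewrite (eq_Rintegral _ (g := cst 0))=> [|x _]; rewrite ?Rintegral_cst ?mul0r// f0 normr0.
pose D : set E := ball a c.
have mD : measurable D by exact: measurable_ball_rV.
pose f1 x := f x * \1_D x; pose f2 x := f x * \1_(~` D) x.
have int1 : leb.-integrable setT (EFin \o f1).
  apply: (integrable_mul_bounded intf (C := 1)) => [|x _]; first exact: measurable_indic.
  by rewrite indicE; case: (_ \in _); rewrite ?normr1 ?normr0.
have int2 : leb.-integrable setT (EFin \o f2).
  apply: (integrable_mul_bounded intf (C := 1)) => [|x _].
    by apply: measurable_indic; exact: measurableC.
  by rewrite indicE; case: (_ \in _); rewrite ?normr1 ?normr0.
have f12 x : f x = f1 x + f2 x.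
  rewrite /f1 /f2 !indicE in_setC; case: (_ \in _); rewrite /= ?mulr1 ?mulr0; ring.
have n12 x : `|f x| = `|f1 x| + `|f2 x|.
  rewrite /f1 /f2 !indicE in_setC; case: (_ \in _); rewrite /= ?mulr1 ?mulr0 ?normr0; ring.
have f2M : vanish_outside M f2 by move=> x Mx; rewrite /f2 fM// mul0r.
have f1M : vanish_outside M f1 by move=> x Mx; rewrite /f1 fM// mul0r.
have [|x f2x|L LM HL] := IHX f2 int2 f2M.
- by move=> x xX; apply: XM; rewrite inE xX orbT.
- have fx : f x != 0 by apply: contraNneq f2x => f0; rewrite /f2 f0 mul0r.
  have [b] := fX x fx; rewrite inE => /orP[/eqP -> ac|]; last by exists b.
  move: f2x; rewrite /f2 indicE in_setC mem_set ?mulr0 ?eqxx//.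
  by rewrite /D -ball_normE.
exists ((\int[leb]_x f1 x, a) :: L).
  by move=> p; rewrite inE => /orP[/eqP -> /=|/LM//]; apply: XM; rewrite inE eqxx.
move=> Q w cQ Qw; rewrite big_cons /=.
have i1Q := integrable_mul_continuous int1 f1M cQ.
have i2Q := integrable_mul_continuous int2 f2M cQ.
have -> : \int[leb]_x (f x * Q x) = \int[leb]_x (f1 x * Q x) + \int[leb]_x (f2 x * Q x).
  by rewrite -RintegralD//; apply: eq_Rintegral => x _; rewrite f12 mulrDl.
have -> : \int[leb]_x `|f x| = \int[leb]_x `|f1 x| + \int[leb]_x `|f2 x|.
  rewrite -RintegralD//; first by apply: eq_Rintegral => x _; rewrite n12.
  - exact: integrable_norm int1.
  - exact: integrable_norm int2.
rewrite opprD addrACA mulrDr (le_trans (ler_normD _ _))// lerD//; last exact: HL.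
have iQa : leb.-integrable setT (EFin \o (fun x => f1 x * Q a)).
  by apply: (integrable_mul_continuous int1 f1M (g := cst (Q a))); exact: cst_continuous.
rewrite -RintegralZr// -RintegralB//.
rewrite (eq_Rintegral _ (g := fun x => f1 x * (Q x - Q a))); last by move=> x _; rewrite mulrBr.
apply: Rintegral_le_norm => //.
  apply: measurable_funB; first exact: continuous_measurable_rV.
  exact: measurable_cst.
move=> x f1x; have Dx : x \in D.
  by apply: contraNT f1x => Dx; rewrite /f1 indicE (negbTE Dx) mulr0.
have fx : f x != 0 by apply: contraNneq f1x => f0; rewrite /f1 f0 mul0r.
apply: Qw; first by rewrite leNgt; apply/negP => /fM f0; rewrite f0 eqxx in fx.
  by apply: XM; rewrite inE eqxx.
by move: Dx; rewrite inE /D -ball_normE /= distrC.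
Qed.

Lemma quadrature f M c : 0 < c -> leb.-integrable setT (EFin \o f) -> vanish_outside M f ->
  exists2 L : seq (R * E), {in L, forall p, `|p.2| <= M} &
  forall (Q : E -> R) (w : R), continuous Q ->
    (forall x y, `|x| <= M -> `|y| <= M -> `|x - y| < c -> `|Q x - Q y| <= w) ->
    `|\int[leb]_x (f x * Q x) - \sum_(p <- L) p.1 * Q p.2| <= w * \int[leb]_x `|f x|.
Proof.
move=> c0 intf fM; have := @compact_norm_le R d M; rewrite compact_cover.
move=> /(_ E [set x | `|x| <= M] (fun a => ball a c)) [] //.
- by move=> a _; exact: ball_open.
- by move=> x xM; exists x => //; exact: ballxx.
move=> X XM cov; apply: (@quadrature_cover X f M c) => //.
  by move=> x /XM; rewrite inE.
move=> x fx; have [|a aX] := cov x; last by rewrite -ball_normE; exists a.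
by rewrite /= leNgt; apply/negP => /fM f0; rewrite f0 eqxx in fx.
Qed.

(** The adjoint of convolution by [phi]: [f] is convolved with the reflection of [phi]. *)
Definition smear phi f y := \int[leb]_x (f x * phi (x - y)).

Lemma smear_conv phi f (intf : leb.-integrable setT (EFin \o f)) :
  smear phi f = convolution (integral_distribution intf) (fun z => phi (0 - z)).
Proof.
apply/funext => y; apply: eq_Rintegral => x _; congr (_ * phi _).
by rewrite sub0r opprB.
Qed.

Lemma vanish_smear phi f M M' : vanish_outside M f -> vanish_outside M' phi ->
  vanish_outside (M + M') (smear phi f).
Proof.
move=> fM pM y My; rewrite /smear (eq_Rintegral _ (g := cst 0)) ?Rintegral_cst ?mul0r// => x _.
have [xM|/fM ->] := leP `|x| M; last by rewrite mul0r.
by rewrite (pM (x - y)) ?mulr0//; have := lerB_dist y x; rewrite distrC; lra.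
Qed.

Lemma smooth_smear phi f : leb.-integrable setT (EFin \o f) -> test_function phi ->
  smooth (smear phi f).
Proof. by move=> intf tp; rewrite (smear_conv _ intf); apply: conv_smooth; exact: test_reflect. Qed.

Lemma test_smear phi f : test_function f -> test_function phi -> test_function (smear phi f).
Proof.
move=> tf tp; apply/test_functionP; split; first exact: smooth_smear (integrable_test tf) tp.
have [_ [M M0 fM]] := (test_functionP f).1 tf.
have [_ [M' M'0 pM]] := (test_functionP phi).1 tp.
by exists (M + M'); [exact: addr_ge0|exact: vanish_smear].
Qed.

Lemma pderive_smear phi f s y : leb.-integrable setT (EFin \o f) -> test_function phi ->
  pderive s (smear phi f) y = \int[leb]_x (f x * pderive s (fun z => phi (0 - z)) (y - x)).
Proof.
by move=> intf tp; rewrite (smear_conv _ intf) pderive_conv//; exact: test_reflect.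
Qed.

(** A distribution is linear on two test functions at a time, so the translates are subtracted one
    by one. Support, pairing and derivatives of the remainder [G] are tracked along the way. *)
Lemma sub_translates (q : schwartz_distribution R d) psi g (L : seq (R * E)) M :
  test_function psi -> test_function g -> vanish_outside M g ->
  (forall p, p \in L -> vanish_outside M (fun y => psi (y - p.2))) ->
  exists G, [/\ test_function G, vanish_outside M G,
    q G = q g - \sum_(p <- L) p.1 * q (fun y => psi (y - p.2)) &
    forall s y, pderive s G y = pderive s g y - \sum_(p <- L) p.1 * pderive s psi (y - p.2)].
Proof.
move=> tp tg gM; elim: L => [|[a x] L IHL] LM.
  by exists g; split; [| | |move=> s y]; rewrite ?big_nil ?subr0.
have [|G [tG GM qG DG]] := IHL; first by move=> p pL; apply: LM; rewrite inE pL orbT.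
have E1 : (fun y => psi (y - x)) = (fun y => psi (- x + y)) by apply/funext => y; rewrite addrC.
have tx : test_function (fun y => psi (y - x)) by rewrite E1; exact: test_translate.
have [sp _] := (test_functionP psi).1 tp.
have [sx _] := (test_functionP _).1 tx.
have [sG _] := (test_functionP G).1 tG.
exists (fun y => - a * psi (y - x) + G y); split.
- exact: testD.
- by apply: vanish_comb GM; apply: (LM (a, x)); rewrite inE eqxx.
- by rewrite (distribution_linear q _ tx tG) qG big_cons /=; ring.
- move=> s y; rewrite (pderive_comb _ _ sx sG) DG big_cons /= E1 (pderive_translate _ _ sp) (addrC (- x)).
  by ring.
Qed.

(** One set of nodes and weights serves two purposes: it approximates the integral on the left, and
    also every derivative up to order [N] of [smear phi f] by the same combination of translates of
    the reflected [phi]. The remainder [G] is then small with its derivatives, hence so is [q G].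
    The two errors, [w * I] and [C * (w * I)], explain the choice of [w]. *)
Lemma exchange (q : schwartz_distribution R d) phi f : test_function phi -> test_function f ->
  \int[leb]_x (convolution q phi x * f x) = q (smear phi f).
Proof.
move=> tp tf.
have intf := integrable_test tf.
have [_ [M M0 fM]] := (test_functionP f).1 tf.
have [_ [M' M'0 pM]] := (test_functionP phi).1 tp.
pose psi z := phi (0 - z).
have tpsi : test_function psi by exact: test_reflect.
have psiM : vanish_outside M' psi.
  by move=> z Mz; apply: pM; rewrite sub0r normrN.
have [C [N [C0 HC]]] := dist_bound q (M + M').
rewrite (eq_Rintegral _ (g := fun x => f x * convolution q phi x)); last by move=> x _; rewrite mulrC.
have cQ : continuous (convolution q phi) by exact: conv_continuous.
pose I := \int[leb]_x `|f x|.
have I0 : 0 <= I by apply: Rintegral_ge0 => x _.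
apply/eqP; rewrite -subr_eq0 -normr_le0; apply/ler_addgt0Pr => e e0; rewrite add0r.
pose w := e / ((C + 1) * I + 1).
have K0 : 0 < (C + 1) * I + 1 by rewrite ltr_wpDl// mulr_ge0// addr_ge0.
have w0 : 0 < w by rewrite divr_gt0.
have [c1 c10 H1] := heine_cantor (@compact_norm_le R d M) (fun x _ => cQ x) w0.
have [c2 c20 H2] := pderiv_uniform N tpsi w0.
have c0 : 0 < Num.min c1 c2 by rewrite lt_min c10.
have [L LM HL] := quadrature c0 intf fM.
have gM := vanish_smear fM pM.
have [|G [tG GM qG DG]] := sub_translates (L := L) q tpsi (test_smear tf tp) gM.
  move=> p /LM pM1 y My; apply: psiM.
  by have := lerB_dist y p.2; lra.
have GB : pderiv_bound N G (w * I).
  move=> s y sN; rewrite DG (pderive_smear _ _ intf tp).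
  have [spsi _] := (test_functionP _).1 (test_reflect y (test_pderive s tpsi)).
  apply: (HL (fun x => pderive s psi (y - x))); first exact: smooth_continuous spsi.
  move=> x x' _ _; rewrite lt_min => /andP[_ xx]; apply: H2 => //.
  by rewrite opprB addrC addrA subrK distrC.
have wI : 0 <= w * I by rewrite mulr_ge0// ltW.
have := HC G _ tG GM wI GB.
have psiE (p : R * E) : q (fun y => psi (y - p.2)) = convolution q phi p.2.
  by rewrite /convolution; congr (q _); apply/funext => y; rewrite /psi sub0r opprB.
rewrite qG (eq_bigr (fun p => p.1 * convolution q phi p.2)); last by move=> p _; rewrite psiE.
have := HL _ w cQ; rewrite -/I => /(_ _)/wrap[] => [x y xM yM|].
  by rewrite lt_min => /andP[xy _]; exact: H1.
move: (\sum_(p <- L) _) => S; move: (\int[leb]_x _) => J h1 h2.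
have := ler_distD S J (q (smear phi f)); rewrite (distrC S) => h3.
apply: (le_trans h3); apply: (le_trans (lerD h1 h2)).
rewrite (_ : _ + _ = (C + 1) * I * w); last by ring.
rewrite /w; apply: mul_div_succ_le; last exact: ltW.
by rewrite mulr_ge0// addr_ge0.
Qed.

Lemma smear_translate phi f y : leb.-integrable setT (EFin \o f) -> test_function phi ->
  smear phi f y = \int[leb]_z (phi z * f (y + z)).
Proof.
move=> intf tp; rewrite /smear.
have tt := test_translate (- y) tp.
have int := integrable_mul_test intf tt.
have := Rintegral_affine y ltr01 int; rewrite expr1n mul1r => E1.
rewrite (eq_Rintegral _ (g := fun x => f x * phi (- y + x))); last first.
  by move=> x _; rewrite addrC.
rewrite -E1; apply: eq_Rintegral => z _.
by rewrite scale1r addrC addKr mulrC addrC.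
Qed.

(** In contrast with [pderive_smear], the derivatives fall on [f]. For [phi] of unit mass the
    resulting bounds do not degrade as [phi] concentrates. *)
Lemma pderive_smear_translate phi f s y : test_function f -> test_function phi ->
  pderive s (smear phi f) y = \int[leb]_z (phi z * pderive s f (y + z)).
Proof.
move=> tf tp; have intp := integrable_test tp.
have intf := integrable_test tf.
pose h z := f (0 - z).
have th : test_function h by exact: test_reflect.
have sh : smooth (convolution (integral_distribution intp) h) by exact: conv_smooth.
have -> : smear phi f = (fun y => convolution (integral_distribution intp) h (0 - y)).
  apply/funext => z; rewrite (smear_translate _ intf tp); apply: eq_Rintegral => x _.
  by rewrite /h !sub0r opprD !opprK.
rewrite (pderive_reflect _ _ sh) (pderive_conv _ _ th).
have sf : smooth f by have /test_functionP[] := tf.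
rewrite /convolution /=.
rewrite -RintegralZl//; last first.
  exact: (integrable_mul_test intp (test_reflect (0 - y) (test_pderive s th))).
apply: eq_Rintegral => z _; rewrite /h (pderive_reflect _ _ sf) mulrCA mulrA.
rewrite -mulrA (mulrA (_ ^+ _)) -expr2 -exprM mulnC exprM sqrrN !expr1n mul1r.
by rewrite !sub0r opprB opprK addrC.
Qed.

(** The difference is an average, against [phi], of increments of [pderive s f] over vectors shorter
    than [c]; this [c] depends on [f], [N] and [e] but not on the mollifier. *)
Lemma smear_cvg f N e : test_function f -> 0 < e -> exists2 c, 0 < c & forall phi M,
  mollifier phi -> 0 <= M -> M < c -> vanish_outside M phi ->
  pderiv_bound N (fun y => -1 * f y + smear phi f y) e.
Proof.
move=> tf e0; have [c c0 Hc] := pderiv_uniform N tf e0.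
exists c => // phi M [tp p0 p1] M0 Mc pM s y sN.
have [sf _] := (test_functionP f).1 tf.
have [ss _] := (test_functionP _).1 (test_smear tf tp).
have intp := integrable_test tp.
rewrite (pderive_comb _ _ sf ss) (pderive_smear_translate _ _ tf tp).
have ti := integrable_mul_test intp (test_translate y (test_pderive s tf)).
rewrite mulN1r addrC -[pderive s f y]mul1r -p1 -RintegralZr//.
have iy : leb.-integrable setT (EFin \o (fun x => phi x * pderive s f y)).
  by apply: (integrable_mul_continuous intp pM (g := cst (pderive s f y))); exact: cst_continuous.
rewrite -RintegralB//.
rewrite (eq_Rintegral _ (g := fun x => phi x * (pderive s f (y + x) - pderive s f y))); last first.
  by move=> x _; rewrite mulrBr.
have n1 : \int[leb]_x `|phi x| = 1.
  by rewrite -p1; apply: eq_Rintegral => x _; rewrite ger0_norm.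
rewrite -[leRHS]mulr1 -n1; apply: Rintegral_le_norm => //.
  apply: measurable_funB; last exact: measurable_cst.
  apply: continuous_measurable_rV.
  by have [/smooth_continuous] := (test_functionP _).1 (test_translate y (test_pderive s tf)).
move=> x px; apply: Hc => //; rewrite addrC addKr (le_lt_trans _ Mc)//.
by rewrite leNgt; apply/negP => /pM p0'; rewrite p0' eqxx in px.
Qed.

Lemma smear_pairing_cvg (q : schwartz_distribution R d) f e : test_function f -> 0 < e ->
  exists2 c, 0 < c & forall phi M, mollifier phi -> 0 <= M -> M < c -> vanish_outside M phi ->
  `|q f - q (smear phi f)| <= e.
Proof.
move=> tf e0; have [_ [M' M'0 fM]] := (test_functionP f).1 tf.
have [C [N [C0 HC]]] := dist_bound q (M' + 1).
have C1 : 0 < C + 1 by rewrite ltr_wpDl.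
have [c c0 Hc] := smear_cvg N tf (divr_gt0 e0 C1).
exists (Num.min c 1); first by rewrite lt_min c0 ltr01.
move=> phi M mp M0; rewrite lt_min => /andP[Mc M1] pM.
have tp : test_function phi by case: mp.
have ts := test_smear tf tp.
have := HC (fun y => -1 * f y + smear phi f y) (e / (C + 1)) (testD _ tf ts).
rewrite (distribution_linear q _ tf ts) => H.
rewrite distrC (_ : _ - _ = -1 * q f + q (smear phi f)); last by rewrite mulN1r addrC.
apply: le_trans (H _ _ _) _.
- apply: vanish_comb; first by apply: vanishW fM; rewrite lerDl.
  by apply: vanishW (vanish_smear fM pM); rewrite lerD2l ltW.
- by rewrite divr_ge0// ltW.
- exact: Hc mp M0 Mc pM.
- by apply: mul_div_succ_le => //; exact: ltW.
Qed.

End exchange.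

(** * Mollifiers and cut-offs *)

Section mollifiers.
Context (R : realType) (d : nat).
Local Notation E := 'rV[R]_d.
Local Notation leb := (lebesgue_rV R d).
Implicit Types (f g phi psi chi : E -> R) (x y : E) (M C B : R).

(** The L^oo norm is the essential supremum only when the whole space has positive measure. *)
Lemma lebesgue_setT_gt0 : (0 < leb setT)%E.
Proof.
apply: (@lt_le_trans _ _ (leb [set x : E | `|x| <= 1])).
  by rewrite lebesgue_norm_le// lte_fin exprn_gt0// mulr1.
by apply: le_measure; rewrite ?inE//; exact: measurable_norm_le.
Qed.

(** The norm on rows is a maximum, hence not smooth; the Euclidean square sum is smooth and is at
    least 1 wherever the maximum exceeds 1. *)
Definition bump x : R := bexp 0 (1 - \sum_i x ord0 i ^+ 2).

Lemma bump_ge0 x : 0 <= bump x.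
Proof. by have /andP[] := bexp_le_sq 0 (1 - \sum_i x ord0 i ^+ 2). Qed.

Lemma vanish_bump : vanish_outside 1 bump.
Proof.
move=> x x1; apply: bexp_le0; rewrite subr_le0.
have [i xi] : exists i, 1 < `|x ord0 i|.
  apply/not_existsP => H; move: x1; apply/negP; rewrite -leNgt.
  by apply/norm_rV_le => // i; rewrite leNgt; apply/negP; exact: H.
rewrite (bigD1 i)//= -real_normK ?num_real// (@le_trans _ _ (`|x ord0 i| ^+ 2))//.
  by rewrite exprn_ege1// ltW.
by rewrite lerDl sumr_ge0// => j _; exact: sqr_ge0.
Qed.

Lemma smooth_bump : smooth bump.
Proof.
apply/smoothP => n; apply: ck_bexp.
rewrite (_ : (fun x => _) = (fun x => cst 1 x + (cst (-1) x) * \sum_i (x ord0 i * x ord0 i))).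
  apply: ckD; first exact: ck_cst.
  by apply: ckM; [exact: ck_cst|apply: ck_sum => i; apply: ckM; exact: ck_coord].
by apply/funext => x; rewrite mulN1r.
Qed.

Lemma test_bump : test_function bump.
Proof.
by apply/test_functionP; split; [exact: smooth_bump|exists 1 => //; exact: vanish_bump].
Qed.

Lemma integral_bump_gt0 : 0 < \int[leb]_x bump x.
Proof.
have b0 : 0 < bump 0.
  by apply: bexp_gt0; rewrite big1 ?subr0// => i _; rewrite mxE expr0n.
have [c c0 Hc] := continuous_ball 0 (smooth_continuous smooth_bump) (divr_gt0 b0 (ltr0n R 2)).
pose D := [set x : E | `|x| <= c / 2].
have c20 : 0 <= c / 2 by rewrite divr_ge0// ltW.
have mD : measurable D by exact: measurable_norm_le.
have intD : leb.-integrable setT (EFin \o (fun x => bump 0 / 2 * \1_D x)).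
  apply: (@integrable_bounded _ _ _ (bump 0 / 2) (c / 2)) => //.
  - by apply: measurable_funM => //; exact: measurable_indic.
  - move=> x; rewrite normrM ger0_norm ?divr_ge0 ?bump_ge0// indicE.
    by rewrite ler_piMr ?divr_ge0 ?bump_ge0//; case: (_ \in _); rewrite ?normr1 ?normr0.
  - move=> x xc; rewrite indicE memNset ?mulr0// /D /= => /(lt_le_trans xc).
    by rewrite ltxx.
apply: (@lt_le_trans _ _ (\int[leb]_x (bump 0 / 2 * \1_D x))).
  have intD1 : leb.-integrable setT (EFin \o (\1_D : E -> R)).
    apply: (@integrable_bounded _ _ _ 1 (c / 2)) => //.
    - by move=> x; rewrite indicE; case: (_ \in _); rewrite ?normr1 ?normr0.
    - move=> x xc; rewrite indicE memNset// /D /= => /(lt_le_trans xc).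
      by rewrite ltxx.
  rewrite RintegralZl// mulr_gt0 ?divr_gt0// /Rintegral integral_indic// setIT.
  by rewrite [X in fine X](lebesgue_norm_le d c20) exprn_gt0//= mulr_gt0// divr_gt0.
apply: le_Rintegral => //; first exact: integrable_test test_bump.
move=> x _; rewrite indicE; have [Dx|Dx] := pselect (D x); last first.
  by rewrite memNset// mulr0 bump_ge0.
rewrite mem_set// mulr1; have := Hc x; rewrite -ball_normE /= sub0r normrN.
have xc : `|x| < c by apply: le_lt_trans Dx _; rewrite ltr_pdivrMr// mulr_natr mulr2n ltrDl.
by move=> /(_ xc); rewrite ltr_norml => /andP[]; lra.
Qed.

Lemma mollifier_exists : exists2 phi : E -> R, mollifier phi & vanish_outside 1 phi.
Proof.
have I0 := integral_bump_gt0; set I := Rintegral _ _ _ in I0.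
have iI : 0 < I^-1 by rewrite invr_gt0.
exists (fun x => cst I^-1 x * bump x); last by move=> x /vanish_bump ->; rewrite mulr0.
split.
- by apply: testM; [exact: smooth_cst|exact: test_bump].
- by move=> x; rewrite mulr_ge0 ?bump_ge0// ltW.
- by rewrite RintegralZl ?mulVf ?gt_eqF//; exact: integrable_test test_bump.
Qed.

Lemma mollifier_dilate phi (l : R) : mollifier phi -> vanish_outside 1 phi -> 0 < l ->
  mollifier (fun x => l ^- d * phi (l^-1 *: x)) /\
  vanish_outside l (fun x => l ^- d * phi (l^-1 *: x)).
Proof.
move=> [tp p0 p1] pM l0; have li : 0 < l^-1 by rewrite invr_gt0.
have E1 : (fun x => phi (l^-1 *: x)) = (fun x => phi (l^-1 *: x + 0)).
  by apply/funext => x; rewrite addr0.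
have tpl : test_function (fun x => phi (l^-1 *: x)).
  by rewrite E1; apply: test_affine => //; exact: lt0r_neq0.
split; last first.
  move=> x lx; rewrite pM ?mulr0// normrZ gtr0_norm// ltr_pdivlMl//.
  by rewrite mulr1.
split.
- exact: (testM (smooth_cst (l ^- d)) tpl).
- by move=> x; rewrite mulr_ge0// invr_ge0 exprn_ge0// ltW.
- rewrite RintegralZl//; last exact: integrable_test.
  rewrite -p1 -(Rintegral_affine 0 li (integrable_test tp)) exprVn.
  by congr (_ * _); apply: eq_Rintegral => x _; rewrite addr0.
Qed.

(** A Lipschitz plateau, 1 up to radius [r + 1] and 0 beyond [r + 2], is averaged with a mollifier
    supported in the unit ball; around a point of norm at most [r] the average sees only the value
    1. *)
Lemma cutoff_exists (r : R) : 0 <= r -> exists chi : E -> R, [/\ test_function chi,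
  forall x, 0 <= chi x <= 1 & forall x, `|x| <= r -> chi x = 1].
Proof.
move=> r0; have [phi mphi phi1] := mollifier_exists.
have [tp p0 p1] := mphi.
pose g x := clamp 1 (r + 2 - `|x|).
have cg : continuous g.
  apply: (@lipschitz_fun_continuous R _ _ _ 1) => x y; rewrite mul1r.
  rewrite (le_trans (clamp_contract _ _ _))// opprD addrACA subrr add0r -opprB normrN opprK.
  by rewrite addrC; exact: ler_dist_dist.
have gM : vanish_outside (r + 2) g.
  by move=> x xr; rewrite /g /clamp (max_idPl _)// ge_min subr_le0 ltW.
have r20 : 0 <= r + 2 by rewrite addr_ge0.
have intg := integrable_continuous cg r20 gM.
have g01 x : 0 <= g x <= 1.
  exact: clampP.
have g1 x : `|x| <= r + 1 -> g x = 1.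
  by move=> xr; rewrite /g /clamp (min_idPr _) ?(max_idPr _)//; lra.
have intp := integrable_test tp.
have cgt x : continuous (fun z => g (x + z)).
  move=> z; apply: (@continuous_comp _ _ _ (fun z : E => x + z) g); last exact: cg.
  by apply: continuousD; [exact: cst_continuous|exact: cvg_id].
have intpg x : leb.-integrable setT (EFin \o (fun z => phi z * g (x + z))).
  exact: integrable_mul_continuous intp phi1 (cgt x).
exists (smear phi g); split.
- apply/test_functionP; split; first exact: smooth_smear.
  by exists (r + 2 + 1); [rewrite addr_ge0|exact: vanish_smear].
- move=> x; rewrite (smear_translate _ intg tp); apply/andP; split.
    by apply: Rintegral_ge0 => z _; have /andP[? _] := g01 (x + z); rewrite mulr_ge0.
  rewrite -p1; apply: le_Rintegral => // z _.
  by have /andP[_ ?] := g01 (x + z); rewrite ler_piMr.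
- move=> x xr; rewrite (smear_translate _ intg tp) -p1; apply: eq_Rintegral => z _.
  have [z1|/phi1 ->] := leP `|z| 1; last by rewrite mul0r.
  by rewrite g1 ?mulr1// (le_trans (ler_normD _ _))// lerD.
Qed.

End mollifiers.

(** * Regularizing nets *)

Section regularization.
Context (R : realType) (d : nat).
Local Notation E := 'rV[R]_d.
Local Notation leb := (lebesgue_rV R d).
Implicit Types (f g phi psi chi : E -> R) (x y : E) (M C B : R).

Lemma closed_dist_le x M : closed [set y : E | `|x - y| <= M].
Proof.
rewrite (_ : [set y | _] = (fun y : E => -1 *: y + x) @^-1` [set z | `|z| <= M]); last first.
  by apply/seteqP; split=> y /=; rewrite scaleN1r addrC.
by apply: closed_comp => [y _|]; [exact: affine_continuous|exact: closed_norm_le].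
Qed.

(** For [x] far from [K] the support of [y |-> phi (x - y)] misses [K]. The convolution is thus
    continuous and vanishes outside a ball. *)
Lemma compactly_supported_conv_bounded (q : schwartz_distribution R d) phi :
  compactly_supported q -> test_function phi -> exists2 B, 0 <= B & forall x, `|convolution q phi x| <= B.
Proof.
move=> [K cK qK] tp; have [r r0 Kr] := compact_norm_bounded cK.
have [_ [M M0 pM]] := (test_functionP phi).1 tp.
have cc : continuous (convolution q phi) by exact: conv_continuous.
apply: (continuous_vanish_bounded (M := r + M) cc) => x xrM.
apply: qK; first exact: test_reflect.
rewrite -subset0 => y [sy /Kr /= yr]; suff: `|x - y| <= M.
  by have := lerB_dist x y; lra.
suff: closure [set y : E | `|x - y| <= M] y.
  by rewrite -(closure_id _).1//; exact: closed_dist_le.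
apply: closure_subset sy => z /= pz; rewrite leNgt; apply/negP => /pM p0.
by rewrite p0 eqxx in pz.
Qed.

Lemma dist0 (q : schwartz_distribution R d) : q (fun _ => 0) = 0.
Proof.
have t0 : test_function (fun _ : E => 0 : R).
  apply/test_functionP; split; first exact: smooth_cst.
  by exists 0 => // x _.
have := distribution_linear q 1 t0 t0; rewrite (_ : (fun x => _) = fun _ => 0); last first.
  by apply/funext => x; rewrite mulr0 addr0.
by rewrite mul1r -[LHS]addr0 => /addrI.
Qed.

Lemma mul_compactly_supported (q : schwartz_distribution R d) chi (tchi : test_function chi) :
  compactly_supported (mul_distribution q tchi).
Proof.
have [_ [M M0 cM]] := (test_functionP chi).1 tchi.
exists [set x | `|x| <= M]; first exact: compact_norm_le.
move=> f tf fM; rewrite /= /dist_mul (_ : (fun x => _) = fun _ => 0) ?dist0//.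
apply/funext => x; have [xM|/cM ->] := leP `|x| M; last by rewrite mul0r.
suff -> : f x = 0 by rewrite mulr0.
apply/eqP; apply: contraT => fx; have : (supp f `&` [set x | `|x| <= M]) x.
  by split=> //; exact: subset_closure.
by rewrite fM.
Qed.

Lemma Lfun_infty_bound g : g \in Lfun leb +oo%E ->
  exists2 G, 0 <= G & {ae leb, forall x, `|g x| <= G}.
Proof.
rewrite inE => /andP[_]; rewrite inE /finLfun /= /finite_norm unlock lebesgue_setT_gt0 ess_supEae.
move=> /ereal_inf_lt[[r| |]//= H _]; last first.
  by exists 0 => //; apply: filterS H => x; rewrite leeNy_eq.
exists `|r| => //; apply: filterS H => x /=; rewrite lee_fin => /le_trans; apply.
exact: ler_norm.
Qed.

Lemma bounded_pairing g : g \in Lfun leb +oo%E ->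
  exists2 G, 0 <= G & forall f, test_function f -> `|\int[leb]_x (g x * f x)| <= G * \int[leb]_x `|f x|.
Proof.
move=> gL; have mg : measurable_fun setT g by exact: measurable_Lfun gL.
have [G G0 gG] := Lfun_infty_bound gL; exists G => // f tf.
pose D := [set x | `|g x| <= G].
have mD : measurable D.
  rewrite (_ : D = (fun x => `|g x|) @^-1` `]-oo, G]); last first.
    by apply/seteqP; split=> x; rewrite /D /= in_itv.
  rewrite -[X in measurable X]setTI.
  have mn : measurable_fun setT (fun x => `|g x|) by exact: measurableT_comp.
  by apply: mn.
(* Truncation turns the almost everywhere bound into one valid at every point, without changing the
   integrals. *)
pose g' x := g x * \1_D x.
have mg' : measurable_fun setT g' by apply: measurable_funM => //; exact: measurable_indic.
have mf : measurable_fun setT f.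
  by apply: continuous_measurable_rV; have /test_functionP[/smooth_continuous] := tf.
have -> : \int[leb]_x (g x * f x) = \int[leb]_x (f x * g' x).
  rewrite /Rintegral; congr fine; apply: ae_eq_integral => //.
  - by apply/measurable_EFinP; exact: measurable_funM.
  - by apply/measurable_EFinP; exact: measurable_funM.
  - apply: filterS gG => x gx _; rewrite /g' indicE mem_set// mulr1 mulrC.
    by [].
apply: Rintegral_le_norm => //; first exact: integrable_test.
move=> x _; rewrite /g' indicE; have [Dx|Dx] := pselect (D x).
  by rewrite mem_set// mulr1.
by rewrite memNset// mulr0 normr0.
Qed.

(** The pairing is controlled by an L1 norm, and the reflected translates of [phi] are dominated by
    [C] times translates of one indicator, whose integral does not depend on [x]. *)
Lemma bounded_conv_bounded (q : schwartz_distribution R d) phi :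
  bounded_distribution q -> test_function phi -> exists2 B, 0 <= B & forall x, `|convolution q phi x| <= B.
Proof.
move=> [g gL qg] tp; have [G G0 HG] := bounded_pairing gL.
have [sp [M M0 pM]] := (test_functionP phi).1 tp.
have [C C0 pC] := continuous_vanish_bounded (smooth_continuous sp) pM.
pose D := [set x : E | `|x| <= M].
have mD : measurable D by exact: measurable_norm_le.
have intD (b : E) : leb.-integrable setT (EFin \o (fun y => (\1_D (1 *: y + b) : R))).
  apply: (@integrable_bounded _ _ _ 1 (M + `|b|)) => //.
  - apply: (@measurableT_comp _ _ _ _ _ _ (\1_D : E -> R)); first exact: measurable_indic.
    exact: measurable_affine_rV.
  - by move=> x; rewrite indicE; case: (_ \in _); rewrite ?normr1 ?normr0.
  - exact: addr_ge0.
  - move=> y My; rewrite indicE memNset// /D /= scale1r => H.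
    by have := ler_normB (y + b) b; rewrite addrK; lra.
exists (G * (C * \int[leb]_x \1_D x)).
  by rewrite mulr_ge0// mulr_ge0// Rintegral_ge0.
move=> x; have tr := test_reflect x tp; rewrite /convolution qg//.
apply: (le_trans (HG _ tr)); rewrite ler_wpM2l//.
have int0 : leb.-integrable setT (EFin \o (fun y => (\1_D y : R))).
  by apply: eq_integrable (intD 0) => // y _; rewrite /= scale1r addr0.
rewrite -(Rintegral_affine (- x) ltr01 int0) expr1n mul1r -RintegralZl//.
apply: le_Rintegral => //.
- exact: integrable_norm (integrable_test tr).
- exact: (@integrableZl _ _ _ leb setT measurableT C _ (intD (- x))).
- move=> y _; rewrite indicE scale1r; have [yM|yM] := leP `|x - y| M.
    by rewrite mem_set ?mulr1// /D /= distrC.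
  by rewrite pM// normr0 mulr_ge0.
Qed.

(** Discrete model of [regularizing_net], with scale [1 / (n + 1)] and cut-offs equal to 1 on the
    ball of radius [n]. Composing it with an index function that tends to infinity as [e] tends to 0
    gives a net, so the speed can be chosen afterwards. *)
Definition regularizing_sequence (q : schwartz_distribution R d) (Q : nat -> E -> R) :=
  exists phi (chi : nat -> E -> R), mollifier phi /\
    let phin n := fun x => (n.+1%:R^-1 : R) ^- d * phi ((n.+1%:R^-1 : R)^-1 *: x) in
    (forall n, Q n = convolution q (phin n)) \/
    [/\ ~ compactly_supported q, ~ bounded_distribution q,
        forall n, test_function (chi n) /\ forall x, 0 <= chi n x <= 1,
        forall n x, `|x| <= n%:R -> chi n x = 1 &
        forall n, Q n = convolution (dist_mul (chi n) q) (phin n)].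

Lemma regularizing_sequence_exists (q : schwartz_distribution R d) :
  exists Q, [/\ regularizing_sequence q Q,
    forall n, smooth (Q n),
    forall n, exists2 B, 0 <= B & forall x, `|Q n x| <= B &
    forall f e, test_function f -> 0 < e -> exists m, forall n, (m <= n)%N ->
      `|q f - \int[leb]_x (Q n x * f x)| <= e].
Proof.
have [phi mphi phi1] := mollifier_exists R d.
have [chi Hchi] := choice (fun n : nat => cutoff_exists d (ler0n R n)).
pose phin n := fun x => (n.+1%:R^-1 : R) ^- d * phi ((n.+1%:R^-1 : R)^-1 *: x).
have n0 n : 0 < n.+1%:R^-1 :> R by rewrite invr_gt0 ltr0n.
have mphin n := (mollifier_dilate mphi phi1 (n0 n)).1.
have vphin n := (mollifier_dilate mphi phi1 (n0 n)).2.
have tphin n : test_function (phin n) by case: (mphin n).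
have small (c : R) : 0 < c -> exists m, forall n, (m <= n)%N -> n.+1%:R^-1 < c.
  move=> c0; exists (Num.truncn c^-1) => n mn.
  rewrite invf_plt ?posrE ?ltr0n//; apply: lt_le_trans (truncnS_gt _) _.
  by rewrite ler_nat ltnS.
have cvgq f e : test_function f -> 0 < e -> exists m, forall n, (m <= n)%N ->
    `|q f - q (smear (phin n) f)| <= e.
  move=> tf e0; have [c c0 Hc] := smear_pairing_cvg q tf e0.
  have [m Hm] := small c c0; exists m => n mn.
  exact: (Hc _ _ (mphin n) (ltW (n0 n)) (Hm n mn) (vphin n)).
have [cb|ncb] := pselect (compactly_supported q \/ bounded_distribution q).
  exists (fun n => convolution q (phin n)); split.
  - by exists phi, chi; split=> //; left.
  - by move=> n; exact: conv_smooth.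
  - move=> n; case: cb => cb; first exact: compactly_supported_conv_bounded.
    exact: bounded_conv_bounded.
  - move=> f e tf e0; have [m Hm] := cvgq f e tf e0; exists m => n mn.
    by rewrite exchange//; exact: Hm.
have tchi n : test_function (chi n) by case: (Hchi n).
have QE n : convolution (dist_mul (chi n) q) (phin n) = convolution (mul_distribution q (tchi n)) (phin n) by [].
exists (fun n => convolution (dist_mul (chi n) q) (phin n)); split.
- exists phi, chi; split=> //; right; split=> //.
  + by move=> cs; apply: ncb; left.
  + by move=> bd; apply: ncb; right.
  + by move=> n; case: (Hchi n).
  + by move=> n; case: (Hchi n).
- by move=> n; rewrite QE; exact: conv_smooth.
- move=> n; rewrite QE; apply: compactly_supported_conv_bounded => //.
  exact: mul_compactly_supported.
- move=> f e tf e0; have [m Hm] := cvgq f e tf e0.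
  have [_ [M M0 fM]] := (test_functionP f).1 tf.
  (* From this index on, the cut-off equals 1 on the ball of radius [M + 1], which contains the
     support of the smeared [f]. *)
  exists (maxn m (Num.truncn (M + 1)).+1) => n; rewrite geq_max => /andP[mn Mn].
  rewrite QE exchange//= /dist_mul.
  rewrite (_ : (fun x => _) = smear (phin n) f); first exact: Hm.
  apply/funext => x; have [xM|xM] := leP `|x| (M + 1); last first.
    rewrite (@vanish_smear _ _ (phin n) f M 1) ?mulr0//.
    by apply: vanishW (vphin n); rewrite invf_le1 ?ltr0n// ler1n.
  have [_ _ ->] := Hchi n; first by rewrite mul1r.
  apply: (le_trans xM); apply: ltW; apply: lt_le_trans (truncnS_gt _) _.
  by rewrite ler_nat.
Qed.

(** [k e] is the largest [m <= - ln e] with [B m <= B 0 - ln e]. The offset [B 0] makes 0 admissible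
    for every [e <= 1], and the first condition makes a largest index exist. A given [m] is
    admissible once [- ln e] exceeds both [m] and [B m - B 0], so [k e] tends to infinity. *)
Lemma slow_index (B : nat -> R) : exists k : R -> nat,
  (forall e, 0 < e <= 1 -> B (k e) <= B 0%N - ln e) /\
  forall m : nat, \forall e \near 0^'+, (m <= k e)%N.
Proof.
have /choice [k Hk] : forall e : R, exists k : nat, 0 < e <= 1 ->
    B k <= B 0%N - ln e /\ forall m, m%:R <= - ln e -> B m <= B 0%N - ln e -> (m <= k)%N.
  move=> e; have [e01|ne] := pselect (0 < e <= 1); last by exists 0%N.
  have /andP[e0 e1] := e01.
  have ln0 : 0 <= - ln e by rewrite oppr_ge0; apply: ln_le0.
  pose P m := (m%:R <= - ln e) && (B m <= B 0%N - ln e).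
  have P0 : exists m, P m by exists 0%N; rewrite /P ln0 lerDl.
  have Pb m : P m -> (m <= Num.truncn (- ln e))%N.
    by move=> /andP[ml _]; rewrite truncn_ge_nat.
  case: (ex_maxnP P0 Pb) => k /andP[_ Bk] Hk; exists k => _; split=> // m m1 m2.
  by apply: Hk; rewrite /P m1.
exists k; split; first by move=> e /Hk[].
move=> m; pose b : R := Num.max m%:R (B m - B 0%N).
near=> e.
have e0 : 0 < e by near: e; exact: nbhs_right_gt.
have e1 : e <= 1 by apply: ltW; near: e; exact: nbhs_right_lt.
have eb : e <= expR (- b) by apply: ltW; near: e; apply: nbhs_right_lt; exact: expR_gt0.
have lb : b <= - ln e.
  by rewrite lerNr -(expRK (- b)) ler_ln ?posrE ?expR_gt0.
have [|_] := Hk e; first by rewrite e0.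
apply; first by apply: le_trans lb; rewrite le_max lexx.
have : B m - B 0%N <= - ln e by apply: le_trans lb; rewrite le_max lexx orbT.
by lra.
Unshelve. all: by end_near.
Qed.

Lemma slow_regularizing_net (q : schwartz_distribution R d) :
  exists (qe : R -> E -> R) B0, [/\ regularizing_net q qe, 0 <= B0,
    forall e, 0 < e <= 1 -> continuous (qe e) &
    forall e, 0 < e <= 1 -> forall x, `|qe e x| <= B0 - ln e].
Proof.
have [Q [Qform Qs Qb Qc]] := regularizing_sequence_exists q.
have /choice [B HB] : forall n, exists B, 0 <= B /\ forall x, `|Q n x| <= B.
  by move=> n; have [B ? ?] := Qb n; exists B.
have [k [Bk ktoy]] := slow_index B.
exists (fun e => Q (k e)), (B 0%N); split.
- split.
  + by move=> e _; exact: Qs.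
  + move=> f tf; apply/(@cvgrPdist_le _ _ _ (0 : R)^'+) => c c0.
    have [m Hm] := Qc f c tf c0.
    by have := ktoy m; apply: filterS => e; exact: Hm.
  + have [phi [chi [mphi form]]] := Qform.
    exists phi, (fun e => (k e).+1%:R^-1); split=> //.
      split; first by move=> e _; rewrite invr_gt0 ltr0n.
      apply/(@cvgrPdist_le _ _ _ (0 : R)^'+) => c c0.
      have := ktoy (Num.truncn c^-1); apply: filterS => e ke.
      rewrite sub0r normrN gtr0_norm ?invr_gt0 ?ltr0n//.
      rewrite invf_ple ?posrE ?ltr0n//; apply: (le_trans (ltW (truncnS_gt _))).
      by rewrite ler_nat ltnS.
    case: form => [QE|[ncs nbd Hchi chi1 QE]]; first by left=> e _; rewrite QE.
    right; split=> //; exists (fun e => chi (k e)); last by move=> e _; rewrite QE.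
    split=> [e _|K cK]; first exact: Hchi.
    have [r r0 Kr] := compact_norm_bounded cK.
    have := ktoy (Num.truncn r).+1; apply: filterS => e ke x /Kr /= xr.
    apply: chi1; apply: (le_trans xr); apply: ltW; apply: lt_le_trans (truncnS_gt _) _.
    by rewrite ler_nat.
- by have [] := HB 0%N.
- by move=> e _; exact: smooth_continuous.
- by move=> e e01 x; apply: le_trans (Bk e e01); have [_] := HB (k e).
Qed.

End regularization.

(** * Strong solutions *)

Section strong_solutions.
Context (R : realType) (V : normedModType R).
Implicit Types (u w : R -> V).

Lemma lipschitz_abs_continuous T u (C : R) :
  (forall s t, `|u s - u t| <= C * `|s - t|) -> abs_continuous T u.
Proof.
move=> uC e e0; have C0 : 0 < `|C| + 1 by rewrite ltr_wpDl.
exists (e / (`|C| + 1)); first by rewrite divr_gt0.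
move=> n a b ab _ H; apply: (@le_lt_trans _ _ ((`|C| + 1) * \sum_i (b i - a i))).
  rewrite mulr_sumr; apply: ler_sum => i _; have [_ abi _] := ab i.
  rewrite (le_trans (uC _ _))// (@ger0_norm _ (b i - a i)) ?subr_ge0//.
  by rewrite ler_wpM2r ?subr_ge0// (le_trans (ler_norm C))// lerDl.
by rewrite mulrC -ltr_pdivlMr.
Qed.

Lemma simple_fun_comp (h : R -> R) w : measurable_fun setT (h : measurableTypeR R -> measurableTypeR R) ->
  finite_set (range h) -> simple_fun (w \o h).
Proof.
move=> mh fh; split.
  rewrite (_ : range _ = w @` range h); first exact: finite_image.
  by rewrite image_comp.
move=> v; rewrite (_ : _ @^-1` _ = \bigcup_(a in range h `&` [set a | w a = v]) (h @^-1` [set a])); last first.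
  apply/seteqP; split=> [t /= wt|t [a [_ /= wa]] /= ha]; last by rewrite /= ha.
  by exists (h t) => //; split=> //; exists t.
apply: fin_bigcup_measurable; first exact: finite_setIl.
move=> a _; rewrite -[X in measurable X]setTI; apply: mh => //; exact: measurable_set1.
Qed.

(** Rounds [t], clamped to [[0, T]], down to the grid of step [1 / (n + 1)]. It takes finitely many
    values, so [w \o cell T n] is a simple function, and it tends to [w] by continuity. *)
Definition cell T (n : nat) (t : R) : R := (Num.truncn (clamp T t * n.+1%:R))%:R / n.+1%:R.

Lemma cell_dist T n t : 0 <= T -> `|cell T n t - clamp T t| <= n.+1%:R^-1.
Proof.
move=> T0; have /andP[c0 _] := clampP T0 t.
have n0 : 0 < n.+1%:R :> R by rewrite ltr0n.
have /andP[h1 h2] := truncn_itv (mulr_ge0 c0 (ltW n0)).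
rewrite /cell ler_norml lerBlDr lerBrDl; apply/andP; split.
  by rewrite ler_pdivlMr// mulrBl mulVf ?gt_eqF// lerBlDr natr1 ltW.
by rewrite ler_pdivrMr// mulrDl mulVf ?gt_eqF// (le_trans h1)// lerDr.
Qed.

Lemma cell_finite T n : 0 <= T -> finite_set (range (cell T n)).
Proof.
move=> T0; apply: (@sub_finite_set _ _ ((fun k : nat => k%:R / n.+1%:R : R) @` `I_(Num.truncn (T * n.+1%:R)).+1)).
  move=> _ [t _ <-]; exists (Num.truncn (clamp T t * n.+1%:R)) => //=.
  rewrite ltnS; apply: le_truncn; rewrite ler_wpM2r//.
  by have /andP[] := clampP T0 t.
exact: finite_image.
Qed.

Lemma measurable_cell T n : 0 <= T ->
  measurable_fun setT (cell T n : measurableTypeR R -> measurableTypeR R).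
Proof.
move=> T0.
have mtr : measurable_fun setT (fun t : measurableTypeR R => Num.truncn (clamp T t * n.+1%:R)).
  move=> _ Y mY; rewrite setTI.
  rewrite (_ : _ @^-1` Y = \bigcup_(k in Y) ((fun t : measurableTypeR R => clamp T t * n.+1%:R) @^-1` `[k%:R, k.+1%:R[)); last first.
    apply/seteqP; split=> [t /= Yt|t [k Yk] /=].
      exists (Num.truncn (clamp T t * n.+1%:R)) => //=; rewrite in_itv /=.
      by apply: truncn_itv; rewrite mulr_ge0//; have /andP[] := clampP T0 t.
    by rewrite in_itv /= => /truncn_def ->.
  apply: bigcup_measurable => k _; rewrite -[X in measurable X]setTI.
  have mc : measurable_fun setT (fun t : measurableTypeR R => clamp T t * n.+1%:R : measurableTypeR R).
    apply: measurable_funM => //; apply: continuous_measurable_fun.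
    apply: (@lipschitz_fun_continuous R R R _ 1) => x y; rewrite mul1r.
    exact: clamp_contract.
  by apply: mc.
apply: (@measurableT_comp _ _ _ _ _ _ (fun k : nat => k%:R / n.+1%:R : measurableTypeR R)) mtr.
by [].
Qed.

(** Meant for [u] the derivative of a solution, known to agree with the continuous [w] only in the
    open interval. *)
Lemma continuous_bochner_integrable T u w : 0 < T -> continuous w ->
  (forall t, 0 < t < T -> u t = w t) -> bochner_integrable `]0, T[ u.
Proof.
move=> T0 cw uw; have T_ge0 := ltW T0; split.
  exists (fun n => w \o cell T n).
    by move=> n; apply: simple_fun_comp; [exact: measurable_cell|exact: cell_finite].
  apply: aeW => t; rewrite /= in_itv /= => tT; rewrite uw//.
  apply/(@cvgrPdist_le _ _ _ \oo) => e e0.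
  have /(@cvgrPdist_le _ _ _ (nbhs t))/(_ _ e0)/nbhs_ballP[c /= c0 Hc] := cw t.
  exists (Num.truncn c^-1) => // n /= mn; apply: Hc; rewrite -ball_normE /=.
  have tc : clamp T t = t by apply: clamp_id; case/andP: tT => /ltW -> /ltW ->.
  have := cell_dist n t T_ge0; rewrite tc distrC => /le_lt_trans; apply.
  rewrite invf_plt ?posrE ?ltr0n//; apply: lt_le_trans (truncnS_gt _) _.
  by rewrite ler_nat ltnS.
have [C _ wC] : exists2 C, 0 <= C & forall t, 0 <= t <= T -> `|w t| <= C.
  have cK : compact (w @` `[0, T]).
    by apply: continuous_compact (@segment_compact _ 0 T); exact: continuous_subspaceT.
  have [C C0 H] := compact_norm_bounded cK; exists C => // t tT.
  by apply: H; exists t => //; rewrite /= in_itv.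
apply: (@le_lt_trans _ _ (\int[@lebesgue_measure R]_(t in `]0%R, T[) `|w t|%:E)%E).
  rewrite le_eqVlt; apply/orP; left; apply/eqP.
  by apply: eq_integral => t; rewrite inE /= in_itv /= => tT; rewrite uw.
apply: (@le_lt_trans _ _ (\int[@lebesgue_measure R]_(t in `]0%R, T[) C%:E)%E).
  apply: ge0_le_integral => //.
  - apply/measurable_EFinP; apply: measurable_funTS; apply: continuous_measurable_fun => t.
    exact: (@continuous_comp _ _ _ w Num.norm t (cw t) (@norm_continuous _ _ _)).
  - by move=> t; rewrite /= in_itv /= => /andP[/ltW t0 /ltW tT]; rewrite lee_fin wC// t0.
rewrite integral_cst//= lebesgue_measure_itv /= lte_fin T0 sube0 -EFinM.
exact: ltry.
Qed.

Lemma sup_norm_ub T u : {within `[0, T], continuous u} ->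
  forall t, 0 <= t <= T -> `|u t| <= sup_norm T u.
Proof.
move=> cu t tT; have [C _ H] := compact_norm_bounded (continuous_compact cu (@segment_compact _ 0 T)).
apply: ub_le_sup; last by exists t => //; rewrite /= in_itv.
by exists C => _ [s sT <-]; apply: H; exists s.
Qed.

Lemma sup_norm_le T u (c : R) : 0 <= T -> (forall t, 0 <= t <= T -> `|u t| <= c) -> 0 <= sup_norm T u <= c.
Proof.
move=> T0 uc; have n0 : [set `|u t| | t in `[0, T]] `|u 0|.
  by exists 0 => //; rewrite /= in_itv /= lexx.
apply/andP; split.
  apply: le_trans (ub_le_sup _ n0); first exact: normr_ge0.
  by exists c => _ /= [s + <-]; rewrite in_itv /=; exact: uc.
apply: ge_sup; first by exists `|u 0|.
by move=> _ /= [s + <-]; rewrite in_itv /=; exact: uc.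
Qed.

End strong_solutions.

(** * Chaos expansions *)

Section chaos_estimate.
Context (R : realType).

Lemma weight_ge1 gamma : 1 <= weight R gamma.
Proof.
rewrite /weight; elim/big_ind: _ => // [x y x1 y1|i _].
  by rewrite -[1]mulr1 ler_pM.
by rewrite exprn_ege1// ler1n muln_gt0.
Qed.

Lemma weight_powR_le gamma (p p' : R) : p' <= p -> weight R gamma `^ (- p) <= weight R gamma `^ (- p').
Proof. by move=> pp; apply: ler_powR; [exact: weight_ge1|rewrite lerN2]. Qed.

Lemma esum_scale_le (I : choiceType) (a : I -> \bar R) (c : R) : 0 <= c -> (forall i, (0 <= a i)%E) ->
  (\esum_(i in [set: I]) (c%:E * a i) <= c%:E * \esum_(i in [set: I]) a i)%E.
Proof.
move=> c0 a0; apply: ub_ereal_sup => _ [X XI <-].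
rewrite -ge0_mule_fsumr//.
by apply: lee_wpmul2l; [rewrite lee_fin|apply: ereal_sup_ubound; exists X].
Qed.

Definition chaos_sum (Y : Type) (nrm : Y -> R) (p : R) (F : multiindex -> Y) : \bar R :=
  (\esum_(gamma in [set: multiindex]) (nrm (F gamma) ^+ 2 * weight R gamma `^ (- p))%:E)%E.

Lemma chaos_sum_fin (Y : Type) (nrm : Y -> R) (p : R) (F : multiindex -> Y) :
  (chaos_norm nrm p F < +oo)%E -> exists2 s : R, 0 <= s & chaos_sum nrm p F = s%:E.
Proof.
have n2 : (2^-1 : R) != 0 by rewrite invr_eq0 pnatr_eq0.
move=> /(lty_poweRy n2) H.
have s0 : (0 <= chaos_sum nrm p F)%E.
  by apply: esum_ge0 => gamma _; rewrite lee_fin mulr_ge0 ?sqr_ge0 ?powR_ge0.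
exists (fine (chaos_sum nrm p F)); first exact: fine_ge0.
by rewrite fineK// ge0_fin_numE.
Qed.

(** [C] is fixed by [F] and [G] before [U] and [K] are given, so one value serves all [e]. The proof
    combines [(a + b)^2 <= 2 * (a^2 + b^2)] with the fact that the weights are at least 1, so that
    raising [p] lowers each term. *)
Lemma chaos_norm_le (Y Z : Type) (nY : Y -> R) (nZ : Z -> R) (F : multiindex -> Y)
    (G : multiindex -> Z) (p pF pG : R) : pF <= p -> pG <= p ->
  (chaos_norm nY pF F < +oo)%E -> (chaos_norm nZ pG G < +oo)%E ->
  exists2 C : R, 0 <= C & forall (W : Type) (nW : W -> R) (U : multiindex -> W) (K : R), 0 <= K ->
    (forall gamma, 0 <= nW (U gamma) <= K * (nZ (G gamma) + nY (F gamma))) ->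
    (chaos_norm nW p U <= (K * C)%:E)%E.
Proof.
move=> pFp pGp /chaos_sum_fin[sF sF0 sFE] /chaos_sum_fin[sG sG0 sGE].
have s0 : 0 <= 2 * (sG + sF) by rewrite mulr_ge0// addr_ge0.
exists (Num.sqrt (2 * (sG + sF))); first exact: sqrtr_ge0.
move=> W nW U K K0 HU; rewrite -[chaos_norm _ _ _]/((chaos_sum nW p U `^ 2^-1)%E).
have -> : (K * Num.sqrt (2 * (sG + sF)))%:E = (((K ^+ 2 * (2 * (sG + sF)))%:E) `^ 2^-1)%E.
  rewrite poweR_EFin; congr EFin; rewrite powR12_sqrt; last by rewrite mulr_ge0 ?sqr_ge0.
  by rewrite [RHS]sqrtrM ?sqr_ge0// sqrtr_sqr ger0_norm.
have U0 : (0 <= chaos_sum nW p U)%E.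
  by apply: esum_ge0 => gamma _; rewrite lee_fin mulr_ge0 ?sqr_ge0 ?powR_ge0.
apply: gt0_ler_poweR.
- by rewrite invr_ge0.
- by rewrite in_itv /= U0 leey.
- by rewrite in_itv /= leey lee_fin mulr_ge0 ?sqr_ge0.
rewrite (_ : (K ^+ 2 * _)%:E = ((K ^+ 2 * 2)%:E * (chaos_sum nZ pG G + chaos_sum nY pF F))%E); last first.
  by rewrite sFE sGE -EFinD -EFinM mulrA.
rewrite /chaos_sum -esumD; last 2 first.
- by move=> gamma _; rewrite lee_fin mulr_ge0 ?sqr_ge0 ?powR_ge0.
- by move=> gamma _; rewrite lee_fin mulr_ge0 ?sqr_ge0 ?powR_ge0.
apply: le_trans (esum_scale_le _ _); last 2 first.
- by rewrite mulr_ge0// sqr_ge0.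
- by move=> gamma; rewrite -EFinD lee_fin addr_ge0// mulr_ge0 ?sqr_ge0 ?powR_ge0.
apply: le_esum => gamma _; rewrite -EFinD -EFinM lee_fin.
have /andP[u0 uK] := HU gamma.
move: (nW (U gamma)) (nZ (G gamma)) (nY (F gamma)) u0 uK => u a b u0 uK.
have wF := weight_powR_le gamma pFp; have wG := weight_powR_le gamma pGp.
have w0 : 0 <= weight R gamma `^ (- p) by exact: powR_ge0.
move: (weight R gamma `^ (- p)) (weight R gamma `^ (- pF)) (weight R gamma `^ (- pG)) w0 wF wG => w wf wg w0 wF wG.
have u2 : u ^+ 2 <= K ^+ 2 * 2 * (a ^+ 2 + b ^+ 2).
  apply: (@le_trans _ _ ((K * (a + b)) ^+ 2)).
    by rewrite ler_pXn2r// nnegrE// (le_trans u0).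
  rewrite exprMn -mulrA ler_wpM2l ?sqr_ge0//.
  by have := sqr_ge0 (a - b); lra.
apply: (le_trans (ler_wpM2r w0 u2)); rewrite -[leLHS]mulrA ler_wpM2l ?mulr_ge0 ?sqr_ge0//.
by rewrite mulrDl lerD// ler_wpM2l// sqr_ge0.
Qed.

End chaos_estimate.

(** * Solutions for one potential, then the net *)

Section problem.
Context (R : realType) (d : nat) (T : R) (A : linop (L2 R d)) (S : R -> L2 R d -> L2 R d).
Hypotheses (T_gt0 : 0 < T) (A_closed : closed_op A) (S_semigroup : C0_semigroup S)
  (A_generates : generates A S).
Variable M : R.
Hypotheses (M_ge1 : 1 <= M)
  (HM : forall t x, 0 <= t <= T + 1 -> `|S t x| <= M * `|x|).
Local Notation leb := (lebesgue_rV R d).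

Lemma lipschitz_clamp (f : R -> L2 R d) : [lipschitz f t | t in `[0, T]] ->
  exists L, forall s t, `|f (clamp T s) - f (clamp T t)| <= L * `|s - t|.
Proof.
move=> [L0 [_ HL]]; have T_ge0 := ltW T_gt0.
have := HL (`|L0| + 1); rewrite (le_lt_trans (ler_norm L0)) ?ltrDl// => /(_ isT) H.
exists (`|L0| + 1) => s t; have := H (clamp T s, clamp T t).
rewrite /= !in_itv /= !clampP// => /(_ (conj isT isT)) /le_trans; apply.
by rewrite ler_wpM2l ?addr_ge0// clamp_contract.
Qed.

(** The factor in the estimate depends only on [M], [T] and [b]: it is the same for all chaos
    coefficients, whatever the Lipschitz constant of [f]. *)
Lemma strong_solution_exists (r : 'rV[R]_d -> R) (b : R) (f : R -> L2 R d) (g : L2 R d) :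
  continuous r -> 0 < b -> (forall x, `|r x| <= b) ->
  {within `[0, T], continuous f} -> [lipschitz f t | t in `[0, T]] -> dom A g ->
  exists2 u, strong_solution T A r f g u &
  0 <= sup_norm T u <= 2 * M * (T + 1) * expR (2 * M * b * (T + 1)) * (`|g| + sup_norm T f).
Proof.
move=> cr b0 rb cf fL domg; have T_ge0 := ltW T_gt0.
have mr : measurable_fun setT r by exact: continuous_measurable_rV.
have [L HL] := lipschitz_clamp fL.
(* The potential is moved to the right-hand side as a bounded perturbation. *)
pose B u := - Lmul r u.
have B_linear : linear B.
  move=> a x y; rewrite /B /Lmul (multiplier_linear mr rb) opprD.
  by rewrite scalerN.
have HB x : `|B x| <= b * `|x|.
  by rewrite /B normrN; apply: multiplier_norm => //; exact: ltW.
have Hf t : `|f (clamp T t)| <= sup_norm T f by apply: sup_norm_ub => //; exact: clampP.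
have [u [w [u0 [C uC] Hu cw uw]]] := inhomogeneous_classical_solution S_semigroup A_generates
  (@L2_parallelogram _ _ _ _) A_closed T_gt0 M_ge1 b0 HM B_linear HB Hf HL domg.
have cu : continuous u := lipschitz_fun_continuous uC.
have du t : 0 < t < T -> derivable u t 1 /\ derive1 u t = w t.
  by move=> tT; have /has_derP[? uwE] := uw t tT; rewrite derive1E.
have sf0 : 0 <= sup_norm T f by apply: le_trans (Hf 0).
exists u; last first.
  apply: sup_norm_le => // t tT; have [_ _ ut] := Hu t tT.
  apply: (le_trans ut); rewrite -!mulrA [expR _ * _]mulrC !mulrA ler_wpM2r ?expR_ge0//.
  rewrite -(mulrA (2 * M)) ler_wpM2l//; first by rewrite mulr_ge0// (le_trans ler01).
  by rewrite mulrDr lerD2r ler_peMl// lerDr.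
split.
- split; first exact: continuous_subspaceT.
  by move=> t; rewrite in_itv /= => tT; have [] := Hu t tT.
- exact: lipschitz_abs_continuous uC.
- by apply: aeW => t; rewrite in_itv /= => tT; have [] := du t tT.
- by apply: (continuous_bochner_integrable T_gt0 cw) => t tT; have [] := du t tT.
- split=> //; apply: aeW => t; rewrite in_itv /= => tT.
  have tT' : 0 <= t <= T by case/andP: tT => /ltW -> /ltW ->.
  have [_ -> ] := du t tT; have [_ -> _] := Hu t tT'.
  by rewrite clamp_id// /B; lmodule.
Qed.

Lemma Lnorm_infty_le (r : 'rV[R]_d -> R) (c : R) : 0 <= c -> (forall x, `|r x| <= c) ->
  ('N[leb]_(+oo)[EFin \o r] <= c%:E)%E.
Proof.
move=> c0 rc; rewrite unlock; case: ifPn => _; last by rewrite lee_fin.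
by rewrite ess_supEae; apply: ereal_inf_lbound; apply: aeW => x /=; rewrite lee_fin.
Qed.

End problem.

Theorem theorem9 (R : realType) (d : nat) (d_gt0 : (0 < d)%N) (T : R)
    (T_gt0 : 0 < T) (A : linop (L2 R d)) (A_closed : closed_op A)
    (A_dense : dense (dom A))
    (A_generates : exists2 S, C0_semigroup S & generates A S)
    (F : multiindex -> R -> L2 R d)
    (F_chaos : chaos (CT T setT) (sup_norm T) F)
    (F_lipschitz : forall gamma, [lipschitz (F gamma t) | t in `[0, T]])
    (G : multiindex -> L2 R d) (G_chaos : chaos (dom A) Num.norm G)
    (q : schwartz_distribution R d) :
  exists U : R -> multiindex -> R -> L2 R d, very_weak_solution T A q F G U.
Proof.
have [S S_semigroup AS] := A_generates.
have [M M_ge1 HM] := semigroup_bounded S_semigroup (T + 1).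
have [pF pF0 [FC Ffin]] := F_chaos.
have [pG pG0 [GC Gfin]] := G_chaos.
have [qe [B0 [qe_net B00 qe_cont qe_bound]]] := slow_regularizing_net q.
have M0 : 0 <= M by exact: le_trans ler01 M_ge1.
have T10 : 0 <= T + 1 by rewrite addr_ge0// ltW.
have ln0 (e : R) : 0 < e <= 1 -> 0 <= - ln e by move=> /andP[_ e1]; rewrite oppr_ge0 ln_le0.
(* The perturbation bound is [B0 + 1 - ln e]; the added 1 makes it positive even when [B0 = 0] and
   [e = 1]. *)
pose K e := 2 * M * (T + 1) * expR (2 * M * (B0 + 1 - ln e) * (T + 1)).
have K0 e : 0 <= K e by rewrite mulr_ge0 ?expR_ge0// mulr_ge0// mulr_ge0.
have /choice[U HU] : forall e, exists Ue : multiindex -> R -> L2 R d, 0 < e <= 1 ->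
    forall gamma, strong_solution T A (qe e) (F gamma) (G gamma) (Ue gamma) /\
      0 <= sup_norm T (Ue gamma) <= K e * (`|G gamma| + sup_norm T (F gamma)).
  move=> e; have [e01|ne] := pselect (0 < e <= 1); last by exists (fun _ => cst 0).
  have /choice[u Hu] : forall gamma, exists u, strong_solution T A (qe e) (F gamma) (G gamma) u /\
      0 <= sup_norm T u <= K e * (`|G gamma| + sup_norm T (F gamma)).
    move=> gamma; have [cF _] := FC gamma.
    have b0 : 0 < B0 + 1 - ln e by have := ln0 e e01; lra.
    have [|u su nu] := @strong_solution_exists R d T A S T_gt0 A_closed S_semigroup AS M M_ge1 HM
      (qe e) _ (F gamma) (G gamma) (qe_cont e e01) b0 _ cF (F_lipschitz gamma) (GC gamma).
    - by move=> x; apply: (le_trans (qe_bound e e01 x)); lra.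
    by exists u.
  by exists u.
(* A common weight for [F] and [G]; the lower bound 2 secures the requirement that the supremum of
   the weights exceed 1. *)
pose p := Num.max (Num.max pF pG) 2.
have pFp : pF <= p by rewrite !le_max lexx.
have pGp : pG <= p by rewrite !le_max lexx orbT.
have p2 : 2 <= p by rewrite le_max lexx orbT.
have p0 : 0 <= p by exact: le_trans p2.
have [C C0 HC] := chaos_norm_le pFp pGp Ffin Gfin.
have Unorm e : 0 < e <= 1 -> (chaos_norm (sup_norm T) p (U e) <= (K e * C)%:E)%E.
  by move=> e01; apply: HC => // gamma; have [] := HU e e01 gamma.
have Uclass e : 0 < e <= 1 -> chaos_p (CT T (dom A)) (sup_norm T) p (U e).
  move=> e01; split; first by move=> gamma; have [[]] := HU e e01 gamma.
  exact: le_lt_trans (Unorm e e01) (ltry _).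
have Uclass' e : 0 < e <= 1 -> chaos_p (CT T setT) (sup_norm T) p (U e).
  by move=> /Uclass[UC Ufin]; split=> // gamma; have [] := UC gamma.
exists U; split; first by move=> e /Uclass' ?; exists p.
exists qe; split=> //.
(* For [e <= 1], [B0 <= B0 / e], and [- ln e <= 1 / e] by the tangent bound of the exponential at
   0. *)
- exists 1%N, (B0 + 1); split; first by rewrite ltr_wpDl.
  move=> e e01; have /andP[e0 e1] := e01.
  apply: (@le_trans _ _ (B0 - ln e)%:E).
    apply: Lnorm_infty_le; last exact: qe_bound.
    by rewrite addr_ge0// ln0.
  rewrite lee_fin expr1 mulrDl mul1r lerD//.
    by rewrite ler_peMr// invf_ge1.
  have := expR_ge1Dx (- ln e); rewrite expRN lnK ?posrE// => /(le_trans _); apply.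
  by rewrite lerDr.
- move=> e e01; split; first by exists p; [exact: p0|exact: Uclass].
  by move=> gamma; have [] := HU e e01 gamma.
(* The weight does not depend on [e], so its supremum over the net is [p] itself. *)
exists (fun _ => p); set P := [set _ | _ in _].
have PE : P = [set p].
  apply/seteqP; split=> [_ [e _ <-]//|_ ->]; exists 1 => //.
  by rewrite /= in_itv /= ltr01 lexx.
split=> //; first by move=> e e01; split=> //; exact: Uclass'.
- by rewrite PE; exact: has_sup1.
- by rewrite PE sup1; apply: lt_le_trans p2; rewrite ltr1n.
rewrite PE sup1.
(* [K e] is [kappa * expR (kappa * (B0 + 1))] times [e] to the power [- kappa]; as moderateness asks
   for an integer exponent, [kappa] is rounded up to [N]. The 1 added to the constant makes it
   positive even if [C = 0]. *)
pose kappa := 2 * M * (T + 1); pose N := (Num.truncn kappa).+1.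
have kappa0 : 0 <= kappa by rewrite mulr_ge0// mulr_ge0.
exists N, (kappa * expR (kappa * (B0 + 1)) * C + 1); split.
  by rewrite ltr_wpDl// mulr_ge0// mulr_ge0// expR_ge0.
move=> e e01; apply: (le_trans (Unorm e e01)); rewrite lee_fin.
have /andP[e0 e1] := e01.
have expN : expR (N%:R * - ln e) = e ^- N.
  by rewrite expRM_natl expRN lnK ?posrE// exprVn.
have eN : 0 <= e ^- N by rewrite -expN expR_ge0.
have KE : K e <= kappa * expR (kappa * (B0 + 1)) * e ^- N.
  rewrite -[leRHS]mulrA /K -/kappa ler_wpM2l// -expN -expRD ler_expR.
  rewrite (_ : 2 * M * _ * _ = kappa * (B0 + 1) + kappa * - ln e); last by rewrite /kappa; ring.
  by rewrite lerD2l ler_wpM2r ?ln0// ltW// truncnS_gt.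
apply: (le_trans (ler_wpM2r C0 KE)); rewrite mulrDl mulrAC lerDl mul1r.
exact: eN.
Qed.
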